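(* For any $\beta>0$ and any positive integer $m$, the expected clustering coefficient of $G^n_{m,\beta}$ satisfies \[ \mathbb{E}[C(G^n_{m,\beta})]=\frac{3c_1\log n}{c_2\,n}+O(1/n)\qquad(n\to\infty), \] where \[ c_1=m(m-1)\frac{(1+\beta)^2}{\beta^2}+m(m-1)^2\frac{(1+\beta)^3}{\beta^2(2+\beta)},\qquad c_2=\frac{2+5\beta}{2\beta}m^2+\frac{2-\beta}{2\beta}m. \]
   Context: Fix a real $\beta>0$ and a positive integer $m$. The random tree process $(G^n_{1,\beta})_{n\ge1}$ is defined as follows. $G^1_{1,\beta}$ consists of a single vertex $v_1$ and no edges. Given $G^n_{1,\beta}$ with vertices $v_1,\dots,v_n$ and directed edges $e_2,\dots,e_n$ (where $e_i$ is the edge whose tail is $v_i$), $G^{n+1}_{1,\beta}$ is obtained by adding a vertex $v_{n+1}$ and a directed edge $e_{n+1}$ with tail $v_{n+1}$ and head a ''target vertex'' determined by a random variable $f_{n+1}$, independent of $f_2,\dots,f_n$, taking values in $\Omega_{n+1}=\{(i,v):1\le i\le n\}\cup\{(i,h),(i,t):2\le i\le n\}$ with $\Pr(f_{n+1}=(i,v))=\beta/((2+\beta)n-2)$ and $\Pr(f_{n+1}=(i,h))=\Pr(f_{n+1}=(i,t))=1/((2+\beta)n-2)$. If $f_{n+1}=(i,v)$ the target is $v_i$ (chosen ''uniformly''); if $f_{n+1}=(i,h)$ the target is the head of $e_i$, and if $f_{n+1}=(i,t)$ the target is the tail $v_i$ of $e_i$ (chosen ''preferentially'', by copying the head half-edge,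 resp. tail half-edge, of $e_i$). Consequently the target is $v_i$ with probability $(d_n(v_i)+\beta)/((2+\beta)n-2)$, where $d_n(v)$ is the degree of $v$ in $G^n_{1,\beta}$. Each edge is regarded as two half-edges, one at each endpoint; the degree of a vertex is the number of half-edges at it (loops count twice). For $n\ge1$, $G^n_{m,\beta}$ is the undirected multigraph obtained from $G^{nm}_{1,\beta}$ by identifying, for each $j=1,\dots,n$, the vertices $v_{(j-1)m+1},\dots,v_{jm}$ into a single vertex $w_j$, keeping all edges (so loops and multiple edges may occur). A triangle in a multigraph is a set of three edges joining three distinct vertices pairwise; triangles are counted with multiplicity, i.e. the number of triangles on $w_a,w_b,w_c$ is the number of such sets of three edges. The clustering coefficient of a multigraph $G$ is \[ C(G)=\frac{3\times(\text{number of triangles in }G)}{\sum_{v\in V(G)}\binom{d(v)}{2}}, \] (taken to be $0$ if the denominator is $0$). *)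

(* Defs.v *)
From Stdlib Require Import Reals Lra Lia List Arith Bool.
Import ListNotations.
Open Scope R_scope.
Local Open Scope bool_scope.

(* A choice f_{k+1} in Omega_{k+1} (k = number of existing vertices) is encoded
   as a pair (i, tag): tag 0 = (i,v), tag 1 = (i,h), tag 2 = (i,t).
   [choices beta k] lists every element of Omega_{k+1} with its probability. *)
Definition choices (beta : R) (k : nat) : list (R * (nat * nat)) :=
  let D := (2 + beta) * INR k - 2 in
  map (fun i => (beta / D, (i, 0%nat))) (seq 1 k) ++
  flat_map (fun i => [(1 / D, (i, 1%nat)); (1 / D, (i, 2%nat))]) (seq 2 (k - 1)).

(* History of G^N_{1,beta}: list hs of length N-1, where nth (i-2) hs is the
   index of the head of e_i (vertices are v_1, ..., v_N, indexed from 1). *)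
Definition target (hs : list nat) (c : nat * nat) : nat :=
  let '(i, tag) := c in
  if Nat.eqb tag 1 then nth (i - 2) hs 0%nat else i.

Fixpoint outcomes (beta : R) (N : nat) : list (R * list nat) :=
  match N with
  | O => [(1, [])]
  | S k =>
      match k with
      | O => [(1, [])]
      | S _ =>
          flat_map (fun ph : R * list nat =>
                      let '(p, hs) := ph in
                      map (fun qc : R * (nat * nat) =>
                             let '(q, c) := qc in (p * q, hs ++ [target hs c]))
                          (choices beta k))
                   (outcomes beta k)
      end
  end.

(* vertex v_j of G^{nm}_{1,beta} belongs to w_{blk m j} *)
Definition blk (m j : nat) : nat := ((j - 1) / m + 1)%nat.

Definition edges_m (m : nat) (hs : list nat) : list (nat * nat) :=
  map (fun ih : nat * nat => let '(i, h) := ih in (blk m i, blk m h))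
      (combine (seq 2 (length hs)) hs).

(* degree = number of half-edges at w (loops count twice) *)
Definition degree (E : list (nat * nat)) (w : nat) : nat :=
  fold_right (fun e acc => let '(a, b) := e in
     ((if Nat.eqb a w then 1 else 0) + (if Nat.eqb b w then 1 else 0) + acc)%nat) 0%nat E.

Definition same_pair (e : nat * nat) (x y : nat) : bool :=
  let '(a, b) := e in
  (Nat.eqb a x && Nat.eqb b y) || (Nat.eqb a y && Nat.eqb b x).

Definition is_triangle (e1 e2 e3 : nat * nat) : bool :=
  let '(a, b) := e1 in
  let '(c, d) := e2 in
  negb (Nat.eqb a b) &&
  existsb (fun x => negb (Nat.eqb x a) && negb (Nat.eqb x b) &&
             ((same_pair e2 a x && same_pair e3 b x) ||
              (same_pair e2 b x && same_pair e3 a x))) [c; d].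

(* number of triangles, counted with multiplicity: number of 3-sets of edges
   (edges distinguished by index) forming a triangle *)
Definition triangles (E : list (nat * nat)) : nat :=
  let L := length E in
  let z := (0%nat, 0%nat) in
  length (filter (fun t : nat * nat * nat => let '(i, j, k) := t in
                    is_triangle (nth i E z) (nth j E z) (nth k E z))
    (flat_map (fun i =>
       flat_map (fun j => map (fun k => (i, j, k)) (seq (S j) (L - S j)))
                (seq (S i) (L - S i)))
     (seq 0 L))).

Definition sum_binom2 (n : nat) (E : list (nat * nat)) : nat :=
  fold_right (fun w acc => (let d := degree E w in d * (d - 1) / 2) + acc)%nat
             0%nat (seq 1 n).

Definition clustering (n : nat) (E : list (nat * nat)) : R :=
  let S := sum_binom2 n E in
  if Nat.eqb S 0 then 0 else 3 * INR (triangles E) / INR S.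

Definition expected_clustering (beta : R) (m n : nat) : R :=
  fold_right (fun ph acc => let '(p, hs) := ph in
                p * clustering n (edges_m m hs) + acc) 0
             (outcomes beta (n * m)).

Definition const_c1 (beta : R) (m : nat) : R :=
  INR m * (INR m - 1) * (1 + beta) ^ 2 / beta ^ 2
  + INR m * (INR m - 1) ^ 2 * (1 + beta) ^ 3 / (beta ^ 2 * (2 + beta)).

Definition const_c2 (beta : R) (m : nat) : R :=
  (2 + 5 * beta) / (2 * beta) * INR m ^ 2 + (2 - beta) / (2 * beta) * INR m.

(* Main.v *)
Require Import Defs.
From Stdlib Require Import Reals Lra Lia Psatz List Arith Bool.
Import ListNotations.
Open Scope R_scope.

(* Follow the tree vertex by vertex, giving each block [w_x] the weight
   [deg + beta * size], so that the next target lies in block x with probability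
   proportional to its weight.  With the sums restricted to closed blocks, each of
   the sum of squared weights, the sum of weight products over edges, and the sum of
   end weights over 2-paths from the open block has a conditional mean step that is
   linear in the others; a triangle is created exactly when such a 2-path is closed.
   Solving these recursions up to a power gain [k^(-gap)] gives
   E[T] = c1 log n + O(1).  To pass to E[T / S], where S is the sum of the binomials,
   write S - c2 n in terms of the centred sum of squared weights, whose second moment
   is O(n^(2 - 2 gap)), and control E[T |S - c2 n|] by Young's inequality: it only
   remains to see that E[T^2] is O(n^(2 gap)), which follows from an envelope
   (weighted edges plus lower order terms) of growth rate (1 + eta) / k. *)

(** * Finite sums and power growth *)

(** The ratio dictates the precision. Since [S] has a deterministic linear lower bound, [T / S]
    differs from [T / (c2 n)] by at most a multiple of [T (|S - c2 n| + 1) / n^2], so an error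
    O(1/n) requires E[T |S - c2 n|] = O(n) without any loss, for two dependent and heavy-tailed
    quantities. The exponents [2 * gap] and [2 - 2 * gap] of the two second moments are matched so
    that they add up to exactly 2. The tail of an edge never lies in an older block than its head,
    so a triangle is completed while its newest block is open. Quantities attached to the open block
    restart from zero at each closing and live for at most [m] steps, so their errors do not
    accumulate. Sums over closed blocks do accumulate, but their mean recursions have rate about
    [2 / ((2 + beta) k)]; that [2 / (2 + beta) < 1] is the source of [gap]. Means depend on the
    position [k mod m] inside the open block. Explicit periodic corrections remove this dependence,
    so that all recursions advance by single vertices and not by blocks. *)

Fixpoint Sum (n : nat) (f : nat -> R) : R :=
  match n with O => 0 | S k => Sum k f + f k end.

Lemma Sum_ext n f g : (forall i, (i < n)%nat -> f i = g i) -> Sum n f = Sum n g.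
Proof.
  induction n as [|n IH]; simpl; intros H; [easy|].
  rewrite IH by (intros; apply H; lia). rewrite H by lia. easy.
Qed.

Lemma Sum_plus n f g : Sum n (fun i => f i + g i) = Sum n f + Sum n g.
Proof. induction n as [|n IH]; simpl; [ring|rewrite IH; ring]. Qed.

Lemma Sum_scal n a f : Sum n (fun i => a * f i) = a * Sum n f.
Proof. induction n as [|n IH]; simpl; [ring|rewrite IH; ring]. Qed.

Lemma Sum_le n f g : (forall i, (i < n)%nat -> f i <= g i) -> Sum n f <= Sum n g.
Proof.
  induction n as [|n IH]; simpl; intros H; [lra|].
  apply Rplus_le_compat; [apply IH; intros; apply H|apply H]; lia.
Qed.

Lemma Sum_zero n f : (forall i, (i < n)%nat -> f i = 0) -> Sum n f = 0.
Proof.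
  induction n as [|n IH]; simpl; intros H; [easy|].
  rewrite IH by (intros; apply H; lia). rewrite H by lia. ring.
Qed.

Lemma Sum_nonneg n f : (forall i, (i < n)%nat -> 0 <= f i) -> 0 <= Sum n f.
Proof.
  intros H. rewrite <- (Sum_zero n (fun _ => 0)) by easy. now apply Sum_le.
Qed.

Lemma Sum_exchange n p f :
  Sum n (fun i => Sum p (fun j => f i j)) = Sum p (fun j => Sum n (fun i => f i j)).
Proof.
  induction n as [|n IH]; simpl.
  - symmetry; now apply Sum_zero.
  - rewrite IH, <- Sum_plus. easy.
Qed.

Lemma Sum_single n x g : (x < n)%nat ->
  Sum n (fun i => if Nat.eqb i x then g i else 0) = g x.
Proof.
  induction n as [|n IH]; intros H; [lia|]. simpl.
  destruct (Nat.eqb_spec n x) as [->|Hn].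
  - rewrite Sum_zero; [ring|]. intros i Hi.
    destruct (Nat.eqb_spec i x); [lia|easy].
  - rewrite IH by lia. ring.
Qed.

Lemma Sum_term n f x : (forall i, (i < n)%nat -> 0 <= f i) -> (x < n)%nat -> f x <= Sum n f.
Proof.
  intros H Hx. rewrite <- (Sum_single n x f Hx). apply Sum_le. intros i Hi.
  destruct (Nat.eqb i x); [lra|now apply H].
Qed.

(** * Real powers of the index *)

Definition pw (k : nat) (t : R) : R := Rpower (INR k) t.

Lemma INR_ge1 k : (1 <= k)%nat -> 1 <= INR k.
Proof. intros H. apply (le_INR 1). easy. Qed.

Lemma pw_pos k t : 0 < pw k t.
Proof. apply exp_pos. Qed.

Lemma pw_0 k : (1 <= k)%nat -> pw k 0 = 1.
Proof. intros H. apply Rpower_O. pose proof (INR_ge1 k H). lra. Qed.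

Lemma pw_1 k : (1 <= k)%nat -> pw k 1 = INR k.
Proof. intros H. apply Rpower_1. pose proof (INR_ge1 k H). lra. Qed.

Lemma pw_plus k s t : pw k (s + t) = pw k s * pw k t.
Proof. apply Rpower_plus. Qed.

Lemma pw_neg1 k : (1 <= k)%nat -> pw k (-1) = / INR k.
Proof.
  intros H. unfold pw. replace (-1) with (- (1)) by lra.
  rewrite Rpower_Ropp, Rpower_1; [easy|].
  pose proof (INR_ge1 k H). lra.
Qed.

Lemma pw_minus1 k t : (1 <= k)%nat -> pw k (t - 1) = pw k t / INR k.
Proof. intros H. replace (t - 1) with (t + -1) by lra. rewrite pw_plus, pw_neg1; easy. Qed.

Lemma pw_le k s t : (1 <= k)%nat -> s <= t -> pw k s <= pw k t.
Proof.
  intros H [Hst| ->]; [|lra]. pose proof (INR_ge1 k H) as [H1|H1].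
  - left. now apply Rpower_lt.
  - unfold pw. rewrite <- H1. unfold Rpower. rewrite ln_1, !Rmult_0_r. lra.
Qed.

Lemma pw_ge1 k t : (1 <= k)%nat -> 0 <= t -> 1 <= pw k t.
Proof. intros H Ht. rewrite <- (pw_0 k H). now apply pw_le. Qed.

Lemma ln_le x y : 0 < x -> x <= y -> ln x <= ln y.
Proof. intros Hx [H| ->]; [left; now apply ln_increasing|lra]. Qed.

Lemma ln_ratio_lower k : (1 <= k)%nat -> / INR (S k) <= ln (INR (S k)) - ln (INR k).
Proof.
  intros H. pose proof (INR_ge1 k H) as H1. rewrite S_INR.
  rewrite <- (ln_exp (/ (INR k + 1))).
  assert (0 < / (INR k + 1)) by (apply Rinv_0_lt_compat; lra).
  pose proof (exp_ineq1_le (- / (INR k + 1))) as He.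
  assert (Hq : INR k / (INR k + 1) <= exp (- / (INR k + 1))).
  { replace (INR k / (INR k + 1)) with (1 + - / (INR k + 1)) by (field; lra). easy. }
  assert (Hl : ln (INR k / (INR k + 1)) <= - / (INR k + 1)).
  { rewrite <- (ln_exp (- / (INR k + 1))). apply ln_le; [|easy].
    apply Rdiv_lt_0_compat; lra. }
  unfold Rdiv in Hl. rewrite ln_mult, ln_Rinv in Hl; try lra. rewrite ln_exp. lra.
Qed.

Lemma ln_ratio_upper k : (1 <= k)%nat -> ln (INR (S k)) - ln (INR k) <= / INR k.
Proof.
  intros H. pose proof (INR_ge1 k H) as H1. rewrite S_INR.
  assert (0 < / INR k) by (apply Rinv_0_lt_compat; lra).
  pose proof (exp_ineq1_le (/ INR k)) as He.
  assert (Hl : ln ((INR k + 1) * / INR k) <= / INR k).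
  { rewrite <- (ln_exp (/ INR k)) at 2. apply ln_le.
    - apply Rmult_lt_0_compat; lra.
    - replace ((INR k + 1) * / INR k) with (1 + / INR k) by (field; lra). easy. }
  rewrite ln_mult, ln_Rinv in Hl; lra.
Qed.

Lemma pw_S k t : (1 <= k)%nat ->
  pw (S k) t = pw k t * exp (t * (ln (INR (S k)) - ln (INR k))).
Proof. intros H. unfold pw, Rpower. rewrite <- exp_plus. f_equal. ring. Qed.

(** The denominator [S k] makes the bound valid for every [t >= 0]; with [k] in its place it would
    fail for [0 < t < 1]. *)
Lemma pw_S_ge k t : (1 <= k)%nat -> 0 <= t -> pw k t * (1 + t / INR (S k)) <= pw (S k) t.
Proof.
  intros H Ht. rewrite pw_S by easy. apply Rmult_le_compat_l; [left; apply pw_pos|].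
  pose proof (ln_ratio_lower k H). pose proof (exp_ineq1_le (t * (ln (INR (S k)) - ln (INR k)))).
  unfold Rdiv. nra.
Qed.

(** Discrete derivative of [k^(-d)]: it turns a source of order [k^(-d-1)] into a telescoping
    sum. *)
Lemma pw_S_decr k d : (1 <= k)%nat -> 0 < d ->
  d / (2 + d) * pw k (- d - 1) <= pw k (- d) - pw (S k) (- d).
Proof.
  intros H Hd. rewrite pw_S, pw_minus1 by easy.
  pose proof (ln_ratio_lower k H) as Hl. pose proof (pw_pos k (- d)) as Hp.
  set (L := ln (INR (S k)) - ln (INR k)) in *. pose proof (INR_ge1 k H) as H1.
  rewrite S_INR in Hl.
  assert (Hi : 0 < / (INR k + 1)) by (apply Rinv_0_lt_compat; lra).
  replace (- d * L) with (- (d * L)) by ring. rewrite exp_Ropp.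
  pose proof (exp_ineq1_le (d * L)) as He.
  assert (Hx : 1 + d * / (INR k + 1) <= exp (d * L)) by nra.
  assert (Hy : / exp (d * L) <= / (1 + d * / (INR k + 1))).
  { apply Rinv_le_contravar; nra. }
  assert (Hz : d / (2 + d) / INR k <= 1 - / (1 + d * / (INR k + 1))).
  { replace (1 - / (1 + d * / (INR k + 1))) with (d / (INR k + 1 + d)) by (field; lra).
    unfold Rdiv. rewrite Rmult_assoc, <- Rinv_mult. apply Rmult_le_compat_l; [lra|].
    apply Rinv_le_contravar; nra. }
  replace (d / (2 + d) * (pw k (- d) / INR k)) with (pw k (- d) * (d / (2 + d) / INR k))
    by (field; lra).
  nra.
Qed.

Lemma pw_le_S t : exists c, 1 <= c /\ forall k, (1 <= k)%nat -> pw k t <= c * pw (S k) t.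
Proof.
  exists (exp (Rabs t)). split.
  - pose proof (exp_ineq1_le (Rabs t)). pose proof (Rabs_pos t). lra.
  - intros k H. rewrite pw_S by easy.
    pose proof (ln_ratio_lower k H) as Hl. pose proof (ln_ratio_upper k H) as Hu.
    set (L := ln (INR (S k)) - ln (INR k)) in *.
    pose proof (INR_ge1 k H) as H1. assert (H2 : 1 <= INR (S k)) by (apply INR_ge1; lia).
    assert (0 < / INR (S k)) by (apply Rinv_0_lt_compat; lra).
    assert (/ INR k <= 1) by (rewrite <- Rinv_1; apply Rinv_le_contravar; lra).
    assert (HL : - Rabs t <= t * L) by (unfold Rabs; destruct (Rcase_abs t); nra).
    rewrite (Rmult_comm (pw k t)), <- Rmult_assoc, <- exp_plus.
    pose proof (pw_pos k t). pose proof (exp_ineq1_le (Rabs t + t * L)). nra.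
Qed.

(** * Orders of growth and linear recursions *)

Definition bigO (x : nat -> R) (t : R) : Prop :=
  exists K, forall k, (1 <= k)%nat -> Rabs (x k) <= K * pw k t.

Lemma bigO_pos x t : bigO x t ->
  exists K, 0 < K /\ forall k, (1 <= k)%nat -> Rabs (x k) <= K * pw k t.
Proof.
  intros [K HK]. exists (Rabs K + 1). pose proof (Rabs_pos K). split; [lra|].
  intros k Hk. specialize (HK k Hk). pose proof (pw_pos k t). pose proof (Rle_abs K). nra.
Qed.

Lemma finite_bound (x : nat -> R) n : exists K, 0 < K /\ forall k, (k <= n)%nat -> Rabs (x k) <= K.
Proof.
  induction n as [|n [K [HK H]]].
  - exists (Rabs (x O) + 1). pose proof (Rabs_pos (x O)). split; [lra|].
    intros k Hk. replace k with O by lia. lra.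
  - exists (K + Rabs (x (S n))). pose proof (Rabs_pos (x (S n))). split; [lra|].
    intros k Hk. destruct (Nat.eq_dec k (S n)) as [->|]; [lra|].
    specialize (H k ltac:(lia)). lra.
Qed.

(** Finitely many initial values go into the constant; this is why the recursions below may be
    assumed only from some [k0] on. *)
Lemma bigO_eventually x t K k0 :
  (forall k, (k0 <= k)%nat -> (1 <= k)%nat -> Rabs (x k) <= K * pw k t) -> bigO x t.
Proof.
  intros H. destruct (finite_bound (fun k => x k / pw k t) k0) as [B [HB H0]].
  exists (B + Rabs K). intros k Hk. pose proof (pw_pos k t) as Hp.
  pose proof (Rabs_pos K). pose proof (Rle_abs K).
  destruct (le_lt_dec k0 k) as [Hle|Hlt].
  - specialize (H k Hle Hk). nra.
  - specialize (H0 k ltac:(lia)). unfold Rdiv in H0.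
    rewrite Rabs_mult, (Rabs_right (/ pw k t)) in H0
      by (left; apply Rinv_0_lt_compat; easy).
    apply Rmult_le_compat_r with (r := pw k t) in H0; [|lra].
    rewrite Rmult_assoc, Rinv_l, Rmult_1_r in H0 by lra. nra.
Qed.

Lemma bigO_weaken x s t : s <= t -> bigO x s -> bigO x t.
Proof.
  intros Hst Hx. destruct (bigO_pos _ _ Hx) as [K [HK H]]. exists K. intros k Hk.
  specialize (H k Hk). pose proof (pw_le k s t Hk Hst). nra.
Qed.

Lemma bigO_le x y t : (forall k, (1 <= k)%nat -> Rabs (x k) <= y k) -> bigO y t -> bigO x t.
Proof.
  intros H [K HK]. exists K. intros k Hk. specialize (H k Hk). specialize (HK k Hk).
  pose proof (Rle_abs (y k)). lra.
Qed.

Lemma bigO_ext x y t : (forall k, (1 <= k)%nat -> x k = y k) -> bigO y t -> bigO x t.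
Proof. intros H [K HK]. exists K. intros k Hk. rewrite H by easy. now apply HK. Qed.

Lemma bigO_plus x y t : bigO x t -> bigO y t -> bigO (fun k => x k + y k) t.
Proof.
  intros [K H] [K' H']. exists (K + K'). intros k Hk. specialize (H k Hk). specialize (H' k Hk).
  pose proof (Rabs_triang (x k) (y k)). lra.
Qed.

Lemma bigO_scal x a t : bigO x t -> bigO (fun k => a * x k) t.
Proof.
  intros [K H]. exists (Rabs a * K). intros k Hk. specialize (H k Hk).
  rewrite Rabs_mult, Rmult_assoc. apply Rmult_le_compat_l; [apply Rabs_pos|easy].
Qed.

Lemma bigO_mult x y s t r : s + t = r -> bigO x s -> bigO y t -> bigO (fun k => x k * y k) r.
Proof.
  intros <- Hx Hy. destruct (bigO_pos _ _ Hx) as [K [HK H]], (bigO_pos _ _ Hy) as [K' [HK' H']].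
  exists (K * K'). intros k Hk. specialize (H k Hk). specialize (H' k Hk).
  rewrite Rabs_mult, pw_plus. replace (K * K' * (pw k s * pw k t)) with ((K * pw k s) * (K' * pw k t)) by ring.
  apply Rmult_le_compat; try apply Rabs_pos; easy.
Qed.

Lemma bigO_const a t : 0 <= t -> bigO (fun _ => a) t.
Proof.
  intros Ht. apply (bigO_weaken _ 0 t Ht). exists (Rabs a). intros k Hk. rewrite pw_0 by easy. lra.
Qed.

Lemma bigO_id : bigO (fun k => INR k) 1.
Proof. exists 1. intros k Hk. pose proof (INR_ge1 k Hk). rewrite pw_1, Rabs_right by (easy || lra). lra. Qed.

Lemma bigO_inv : bigO (fun k => / INR k) (-1).
Proof.
  exists 1. intros k Hk. pose proof (INR_ge1 k Hk). rewrite pw_neg1 by easy.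
  rewrite Rabs_right; [lra|]. left. apply Rinv_0_lt_compat. lra.
Qed.

Lemma bigO_pw t : bigO (fun k => pw k t) t.
Proof. exists 1. intros k Hk. pose proof (pw_pos k t). rewrite Rabs_right; lra. Qed.

Lemma exists_nat_ge (r : R) : exists n : nat, forall k, (n <= k)%nat -> r <= INR k.
Proof.
  destruct (INR_archimed 1 r ltac:(lra)) as [n Hn]. exists n. intros k Hk.
  apply le_INR in Hk. lra.
Qed.

(** A discrete Gronwall inequality: the homogeneous part grows like [k^a], the source contributes
    [k^t], and the strict inequality [a < t] excludes a logarithm. The proof compares [x] with
    [M * k^t]. *)
Lemma bigO_growth x s a t k0 :
  0 <= a -> a < t ->
  (forall k, (1 <= k)%nat -> 0 <= x k) ->
  (forall k, (k0 <= k)%nat -> (1 <= k)%nat -> x (S k) <= (1 + a / INR k) * x k + s k) ->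
  bigO s (t - 1) -> bigO x t.
Proof.
  intros Ha Hat Hx Hrec Hs. destruct (bigO_pos _ _ Hs) as [K [HK HsK]].
  (* The distance from [a] to [t] is split: [b - a] absorbs the source, and [t - b] pays for the
     denominator [S k] in [pw_S_ge] as soon as [k >= b / (t - b)]. *)
  set (b := (a + t) / 2). assert (Hab : a < b < t) by (unfold b; lra).
  destruct (exists_nat_ge (b / (t - b))) as [k1 Hk1].
  set (k2 := S (Nat.max k0 k1)).
  set (M := x k2 + K / (b - a)).
  assert (HM0 : 0 <= K / (b - a)) by (apply Rlt_le, Rdiv_lt_0_compat; lra).
  assert (Hx2 : 0 <= x k2) by (apply Hx; unfold k2; lia).
  apply (bigO_eventually _ _ M k2). intros k Hk Hk'.
  rewrite Rabs_right by (apply Rle_ge, Hx; easy). clear Hk'.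
  induction Hk as [|k Hk IH].
  - pose proof (pw_ge1 k2 t ltac:(unfold k2; lia) ltac:(lra)). unfold M. nra.
  - assert (H1 : (1 <= k)%nat) by (unfold k2 in Hk; lia).
    pose proof (INR_ge1 k H1) as HI.
    specialize (Hrec k ltac:(unfold k2 in Hk; lia) H1).
    specialize (HsK k H1). rewrite pw_minus1 in HsK by easy.
    pose proof (Rle_abs (s k)) as Habs.
    pose proof (pw_S_ge k t H1 ltac:(lra)) as Hg.
    pose proof (pw_pos k t) as Hp.
    assert (Hbt : b / INR k <= t / INR (S k)).
    { rewrite S_INR. specialize (Hk1 k ltac:(unfold k2 in Hk; lia)).
      apply Rmult_le_compat_r with (r := t - b) in Hk1; [|lra].
      unfold Rdiv in Hk1 at 1. rewrite Rmult_assoc, Rinv_l, Rmult_1_r in Hk1 by lra.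
      apply Rmult_le_reg_r with (r := INR k * (INR k + 1)); [nra|].
      replace (b / INR k * (INR k * (INR k + 1))) with (b * (INR k + 1)) by (field; lra).
      replace (t / (INR k + 1) * (INR k * (INR k + 1))) with (t * INR k) by (field; lra). nra. }
    assert (HKM : K <= (b - a) * M).
    { unfold M. replace K with ((b - a) * (K / (b - a))) at 1 by (field; lra). nra. }
    assert (Hi : 0 < / INR k) by (apply Rinv_0_lt_compat; lra).
    assert (HMp : 0 <= M) by (unfold M; lra).
    assert (E1 : x (S k) <= (1 + a / INR k) * (M * pw k t) + (b - a) * M * (pw k t / INR k)).
    { assert (0 <= pw k t / INR k) by (unfold Rdiv; nra).
      assert (0 <= a / INR k) by (unfold Rdiv; nra). nra. }
    assert (E2 : (1 + a / INR k) * (M * pw k t) + (b - a) * M * (pw k t / INR k)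
                 = M * (pw k t * (1 + b / INR k))) by (field; lra).
    assert (pw k t * (1 + b / INR k) <= pw (S k) t) by nra. nra.
Qed.

(** The increments are summable: each is at most a difference of consecutive values of [M * k^(-d)],
    with [M * d / (2 + d) = K]. *)
Lemma bigO_convergent x d k0 s :
  0 < d ->
  (forall k, (k0 <= k)%nat -> (1 <= k)%nat -> x (S k) - x k = s k) ->
  bigO s (- d - 1) -> bigO x 0.
Proof.
  intros Hd Hrec Hs. destruct (bigO_pos _ _ Hs) as [K [HK HsK]].
  set (M := K * (2 + d) / d). set (k1 := S k0).
  assert (HM : 0 < M) by (unfold M; apply Rdiv_lt_0_compat; nra).
  apply (bigO_eventually _ _ (Rabs (x k1) + M * pw k1 (- d)) k1).
  intros k Hk _. rewrite pw_0 by (unfold k1 in Hk; lia).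
  cut (Rabs (x k) <= Rabs (x k1) + M * (pw k1 (- d) - pw k (- d))).
  { pose proof (pw_pos k (- d)). nra. }
  induction Hk as [|k Hk IH].
  - lra.
  - assert (H1 : (1 <= k)%nat) by (unfold k1 in Hk; lia).
    specialize (Hrec k ltac:(unfold k1 in Hk; lia) H1). specialize (HsK k H1).
    pose proof (pw_S_decr k d H1 Hd) as Hp.
    replace (x (S k)) with (x k + s k) by lra.
    pose proof (Rabs_triang (x k) (s k)).
    assert (K * pw k (- d - 1) <= M * (pw k (- d) - pw (S k) (- d))).
    { replace (K * pw k (- d - 1)) with (M * (d / (2 + d) * pw k (- d - 1)))
        by (unfold M; field; lra).
      apply Rmult_le_compat_l; lra. }
    lra.
Qed.

Lemma mod_S_cases m k : (1 <= m)%nat ->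
  ((S k) mod m = S (k mod m) /\ (S k) / m = k / m /\ S (k mod m) < m)%nat \/
  ((S k) mod m = 0 /\ (S k) / m = S (k / m) /\ S (k mod m) = m)%nat.
Proof.
  intros Hm. pose proof (Nat.div_mod k m ltac:(lia)) as E.
  pose proof (Nat.mod_upper_bound k m ltac:(lia)) as Hu.
  destruct (Nat.eq_dec (S (k mod m)) m) as [Hr|Hr].
  - right. assert (Ek : S k = (m * S (k / m) + 0)%nat) by nia.
    split; [|split]; [| |easy].
    + symmetry. apply (Nat.mod_unique (S k) m (S (k / m))); lia.
    + symmetry. apply (Nat.div_unique (S k) m (S (k / m)) 0); lia.
  - left. assert (Ek : S k = (m * (k / m) + S (k mod m))%nat) by lia.
    split; [|split]; [| |lia].
    + symmetry. apply (Nat.mod_unique (S k) m (k / m)); lia.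
    + symmetry. apply (Nat.div_unique (S k) m (k / m) (S (k mod m))); lia.
Qed.

(** Fewer than [m] steps separate two zeros of [x], so even a constant factor per step is harmless
    and [x] keeps the order of its source, which need not be divided by [k]. *)
Lemma bigO_reset m x s L t :
  (1 <= m)%nat -> 0 <= L ->
  (forall k, (1 <= k)%nat -> 0 <= x k) ->
  (forall k, (1 <= k)%nat -> (S k) mod m = O -> x (S k) = 0) ->
  (forall k, (1 <= k)%nat -> (S k) mod m <> O -> x (S k) <= L * x k + s k) ->
  bigO s t -> bigO x t.
Proof.
  intros Hm HL Hx H0 Hrec Hs. destruct (bigO_pos _ _ Hs) as [K [HK HsK]].
  destruct (pw_le_S t) as [c [Hc Hpc]].
  (* The sequence starts at 1 without a reset, so [x 1] enters the constant. In [G], the factor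
     [L + 1] covers the recursion and its source, and [c] the passage from [pw k t] to
     [pw (S k) t]. *)
  set (M := K + x 1%nat). assert (Hx1 := Hx 1%nat ltac:(lia)).
  set (G := c * (L + 1)). assert (HG : 1 <= G) by (unfold G; nra).
  assert (HM : 0 < M) by (unfold M; lra).
  assert (Hb : forall k, (1 <= k)%nat -> x k <= M * G ^ (k mod m) * pw k t).
  { intros k Hk. induction Hk as [|k Hk IH].
    - replace (pw 1 t) with 1
        by (unfold pw, Rpower; simpl; rewrite ln_1, Rmult_0_r, exp_0; easy).
      pose proof (pow_R1_Rle G (1 mod m) HG). unfold M in *. nra.
    - pose proof (pw_pos (S k) t) as Hp.
      destruct (mod_S_cases m k Hm) as [[E [_ Hlt]]|[E _]].
      + specialize (Hrec k Hk ltac:(lia)). specialize (HsK k Hk). specialize (Hpc k Hk).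
        pose proof (Rle_abs (s k)). rewrite E. simpl.
        set (g := G ^ (k mod m)) in *.
        assert (1 <= g) by (apply pow_R1_Rle; easy).
        pose proof (pw_pos k t).
        assert (x (S k) <= (L * (M * g) + K) * pw k t) by nra.
        assert (L * (M * g) + K <= (L + 1) * (M * g)) by (unfold M in *; nra).
        assert (0 <= (L + 1) * (M * g)) by nra.
        assert (x (S k) <= (L + 1) * (M * g) * pw k t) by nra.
        assert ((L + 1) * (M * g) * pw k t <= (L + 1) * (M * g) * (c * pw (S k) t)) by nra.
        unfold G. nra.
      + rewrite H0 by easy. rewrite E. simpl. nra. }
  exists (M * G ^ m). intros k Hk. specialize (Hb k Hk).
  rewrite Rabs_right by (apply Rle_ge, Hx; easy).
  pose proof (Nat.mod_upper_bound k m ltac:(lia)).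
  assert (G ^ (k mod m) <= G ^ m) by (apply Rle_pow; [easy|lia]).
  pose proof (pw_pos k t).
  assert (M * G ^ (k mod m) <= M * G ^ m) by nra. nra.
Qed.

(** * Triangles of a growing edge list *)

Definition lsum {A : Type} (l : list A) (f : A -> R) : R :=
  fold_right (fun x acc => f x + acc) 0 l.

Lemma lsum_cons {A} x (l : list A) f : lsum (x :: l) f = f x + lsum l f.
Proof. easy. Qed.

Lemma lsum_app {A} (l l' : list A) f : lsum (l ++ l') f = lsum l f + lsum l' f.
Proof. induction l as [|x l IH]; simpl app; [simpl; ring|]. rewrite !lsum_cons, IH. ring. Qed.

Lemma lsum_map {A B} (h : A -> B) l f : lsum (map h l) f = lsum l (fun x => f (h x)).
Proof. induction l as [|x l IH]; simpl; [easy|]. f_equal. exact IH. Qed.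

Lemma lsum_flat_map {A B} (h : A -> list B) l f :
  lsum (flat_map h l) f = lsum l (fun x => lsum (h x) f).
Proof. induction l as [|x l IH]; simpl; [easy|]. rewrite lsum_app. f_equal. exact IH. Qed.

Lemma lsum_ext {A} (l : list A) f g : (forall x, In x l -> f x = g x) -> lsum l f = lsum l g.
Proof.
  induction l as [|x l IH]; simpl; intros H; [easy|]. f_equal; [apply H; now left|].
  apply IH. intros y Hy. apply H. now right.
Qed.

Lemma lsum_plus {A} (l : list A) f g : lsum l (fun x => f x + g x) = lsum l f + lsum l g.
Proof. induction l as [|x l IH]; [simpl; ring|]. rewrite !lsum_cons, IH. ring. Qed.

Lemma lsum_scal {A} (l : list A) a f : lsum l (fun x => a * f x) = a * lsum l f.
Proof. induction l as [|x l IH]; [simpl; ring|]. rewrite !lsum_cons, IH. ring. Qed.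

Lemma lsum_le {A} (l : list A) f g : (forall x, In x l -> f x <= g x) -> lsum l f <= lsum l g.
Proof.
  induction l as [|x l IH]; simpl; intros H; [lra|].
  apply Rplus_le_compat; [apply H; now left|]. apply IH. intros y Hy. apply H. now right.
Qed.

Lemma lsum_zero {A} (l : list A) f : (forall x, In x l -> f x = 0) -> lsum l f = 0.
Proof.
  intros H. rewrite (lsum_ext l f (fun x => 0 * f x)), lsum_scal; [ring|].
  intros x Hx. rewrite H by easy. ring.
Qed.

Lemma lsum_const {A} (l : list A) a : lsum l (fun _ => a) = a * INR (length l).
Proof.
  induction l as [|x l IH]; simpl length; [simpl; ring|]. rewrite S_INR, lsum_cons, IH. ring.
Qed.

Lemma lsum_Sum {A} (l : list A) n (f : A -> nat -> R) :
  lsum l (fun x => Sum n (f x)) = Sum n (fun i => lsum l (fun x => f x i)).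
Proof.
  induction l as [|x l IH].
  - symmetry; now apply Sum_zero.
  - rewrite lsum_cons, IH, <- Sum_plus. easy.
Qed.

Definition b2r (b : bool) : R := if b then 1 else 0.

Lemma b2r_nonneg b : 0 <= b2r b.
Proof. destruct b; simpl; lra. Qed.

Lemma INR_length_filter {A} (l : list A) p : INR (length (filter p l)) = lsum l (fun x => b2r (p x)).
Proof.
  induction l as [|x l IH]; [easy|]. cbn [filter lsum fold_right].
  fold (lsum l (fun x => b2r (p x))). destruct (p x); cbn [length b2r]; [rewrite S_INR|]; rewrite IH; ring.
Qed.

Lemma lsum_nth {A} (l : list A) z f : lsum (seq 0 (length l)) (fun i => f (nth i l z)) = lsum l f.
Proof.
  rewrite <- (lsum_map (fun i => nth i l z) (seq 0 (length l)) f). f_equal.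
  induction l as [|x l IH]; [easy|]. cbn [length seq map nth]. f_equal.
  rewrite <- seq_shift, map_map. exact IH.
Qed.

Lemma seq_snoc a L : (a <= L)%nat -> seq a (S L - a) = seq a (L - a) ++ [L].
Proof.
  intros H. replace (S L - a)%nat with ((L - a) + 1)%nat by lia.
  rewrite seq_app. simpl. do 2 f_equal. lia.
Qed.

Definition pair_sum {A} (z : A) (l : list A) (F : A -> A -> R) : R :=
  lsum (seq 0 (length l)) (fun i =>
    lsum (seq (S i) (length l - S i)) (fun j => F (nth i l z) (nth j l z))).

Lemma pair_sum_snoc {A} (z : A) l x F :
  pair_sum z (l ++ [x]) F = pair_sum z l F + lsum l (fun y => F y x).
Proof.
  unfold pair_sum. rewrite length_app, Nat.add_1_r. cbn [length].
  rewrite seq_S, lsum_app, Nat.add_0_l. cbn [lsum fold_right].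
  rewrite Nat.sub_diag. cbn [seq lsum fold_right]. rewrite !Rplus_0_r.
  rewrite <- (lsum_nth l z (fun y => F y x)), <- lsum_plus. apply lsum_ext.
  intros i Hi. apply in_seq in Hi.
  rewrite (seq_snoc (S i)) by lia.
  rewrite lsum_app. cbn [lsum fold_right]. rewrite Rplus_0_r. f_equal.
  - apply lsum_ext. intros j Hj. apply in_seq in Hj. rewrite !app_nth1 by lia. easy.
  - rewrite app_nth1, app_nth2, Nat.sub_diag by lia. easy.
Qed.

Definition triple_b2r (E : list (nat * nat)) (i j k : nat) : R :=
  b2r (is_triangle (nth i E (0, 0)%nat) (nth j E (0, 0)%nat) (nth k E (0, 0)%nat)).

Lemma triangles_lsum E : INR (triangles E) =
  lsum (seq 0 (length E)) (fun i => lsum (seq (S i) (length E - S i))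
    (fun j => lsum (seq (S j) (length E - S j)) (triple_b2r E i j))).
Proof.
  unfold triangles. rewrite INR_length_filter, lsum_flat_map. apply lsum_ext. intros i _.
  rewrite lsum_flat_map. apply lsum_ext. intros j _. rewrite lsum_map. easy.
Qed.

(** The new edge has the largest index, so it is the third edge of every new triple. *)
Lemma triangles_snoc E e :
  INR (triangles (E ++ [e])) = INR (triangles E)
    + pair_sum (0, 0)%nat E (fun x y => b2r (is_triangle x y e)).
Proof.
  rewrite !triangles_lsum. unfold pair_sum. rewrite length_app, Nat.add_1_r.
  rewrite seq_S, lsum_app, Nat.add_0_l. cbn [lsum fold_right].
  rewrite Nat.sub_diag. cbn [seq lsum fold_right]. rewrite !Rplus_0_r.
  rewrite <- lsum_plus. apply lsum_ext. intros i Hi. apply in_seq in Hi.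
  rewrite (seq_snoc (S i)) by lia.
  rewrite lsum_app. cbn [lsum fold_right].
  rewrite Nat.sub_diag. cbn [seq lsum fold_right]. rewrite !Rplus_0_r, <- lsum_plus.
  apply lsum_ext. intros j Hj. apply in_seq in Hj.
  rewrite (seq_snoc (S j)) by lia. rewrite lsum_app.
  cbn [lsum fold_right]. rewrite Rplus_0_r. f_equal.
  - apply lsum_ext. intros l Hl. apply in_seq in Hl. unfold triple_b2r.
    rewrite !app_nth1 by lia. easy.
  - unfold triple_b2r. rewrite (app_nth1 E [e] (0, 0)%nat (n:=i)), (app_nth1 E [e] (0, 0)%nat (n:=j)), app_nth2, Nat.sub_diag by lia. easy.
Qed.

(** Contribution of one edge to the adjacency matrix with multiplicities; loops count 0, so the
    diagonal vanishes. *)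
Definition link (e : nat * nat) (x y : nat) : R :=
  if Nat.eqb (fst e) (snd e) then 0
  else b2r (Nat.eqb (fst e) x && Nat.eqb (snd e) y) + b2r (Nat.eqb (fst e) y && Nat.eqb (snd e) x).

Lemma link_sym e x y : link e x y = link e y x.
Proof. unfold link. destruct (Nat.eqb (fst e) (snd e)); ring. Qed.

Lemma link_nonneg e x y : 0 <= link e x y.
Proof.
  unfold link. destruct (Nat.eqb (fst e) (snd e)); [lra|].
  pose proof (b2r_nonneg (Nat.eqb (fst e) x && Nat.eqb (snd e) y)).
  pose proof (b2r_nonneg (Nat.eqb (fst e) y && Nat.eqb (snd e) x)). lra.
Qed.

Lemma Sum_link c e g : (fst e <= c)%nat -> (snd e <= c)%nat ->
  Sum c (fun y => link e c y * g y) =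
  b2r (Nat.eqb (fst e) c && Nat.ltb (snd e) c) * g (snd e)
  + b2r (Nat.eqb (snd e) c && Nat.ltb (fst e) c) * g (fst e).
Proof.
  destruct e as [p q]. cbn [fst snd]. intros Hp Hq.
  destruct (Nat.eqb_spec p c) as [->|Hpc]; destruct (Nat.eqb_spec q c) as [->|Hqc]; cbn [andb].
  - rewrite Sum_zero; [rewrite Nat.ltb_irrefl; simpl; ring|].
    intros i _. unfold link. cbn [fst snd]. rewrite Nat.eqb_refl. ring.
  - rewrite (proj2 (Nat.ltb_lt q c)) by lia. rewrite <- (Sum_single c q g) by lia. cbn [b2r].
    rewrite Rmult_0_l, Rplus_0_r, <- Sum_scal. apply Sum_ext. intros i Hi. unfold link. cbn [fst snd].
    rewrite (Nat.eqb_sym i q), Nat.eqb_refl, (proj2 (Nat.eqb_neq c q)), (proj2 (Nat.eqb_neq c i)) by lia.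
    destruct (Nat.eqb q i); simpl; ring.
  - rewrite (proj2 (Nat.ltb_lt p c)) by lia. rewrite <- (Sum_single c p g) by lia. cbn [b2r].
    rewrite Rmult_0_l, Rplus_0_l, <- Sum_scal. apply Sum_ext. intros i Hi. unfold link. cbn [fst snd].
    rewrite (Nat.eqb_sym i p), Nat.eqb_refl, (proj2 (Nat.eqb_neq p c)), (proj2 (Nat.eqb_neq c i)) by lia.
    destruct (Nat.eqb p i); simpl; ring.
  - rewrite Sum_zero; [simpl; ring|].
    intros i _. unfold link. cbn [fst snd].
    rewrite (proj2 (Nat.eqb_neq p c)), (proj2 (Nat.eqb_neq q c)) by lia.
    rewrite andb_false_r. destruct (Nat.eqb p q); simpl; ring.
Qed.

Lemma is_triangle_loop e1 e2 c : is_triangle e1 e2 (c, c) = false.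
Proof.
  destruct e1 as [p q], e2 as [p' q']. unfold is_triangle, same_pair. cbn [existsb].
  repeat (match goal with |- context [Nat.eqb ?x ?y] => destruct (Nat.eqb_spec x y) end;
          subst; rewrite ?Nat.eqb_refl; cbn [negb andb orb]; try easy; try congruence).
Qed.

(** As [c] is the largest block, [e1] and [e2] complete the edge [(c, a)] exactly when they form a
    path from [c] to [a] through a smaller block [y]. The two sums are the two orders in which they
    can do so. *)
Lemma is_triangle_link e1 e2 c a :
  (fst e1 <= c)%nat -> (snd e1 <= c)%nat -> (fst e2 <= c)%nat -> (snd e2 <= c)%nat -> (a < c)%nat ->
  b2r (is_triangle e1 e2 (c, a)) =
  Sum c (fun y => link e1 c y * link e2 y a) + Sum c (fun y => link e2 c y * link e1 y a).
Proof.
  intros H1 H2 H3 H4 Ha. rewrite !Sum_link by easy.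
  destruct e1 as [p q], e2 as [p' q']. unfold link, is_triangle, same_pair. cbn [fst snd existsb] in *.
  destruct (Nat.ltb_spec q c), (Nat.ltb_spec p c), (Nat.ltb_spec q' c), (Nat.ltb_spec p' c);
  repeat (match goal with |- context [Nat.eqb ?x ?y] => destruct (Nat.eqb_spec x y) end;
          try (exfalso; lia); subst; rewrite ?Nat.eqb_refl; cbn [negb andb orb b2r];
          try (exfalso; lia); try ring).
Qed.

(** The two orders of each unordered pair make up the off-diagonal part of a product of two edge
    sums. The diagonal part is zero: one edge cannot join both [c] to [y] and [y] to [a] when
    [a < c]. *)
Lemma pair_sum_triangle E c a :
  (forall e, In e E -> (fst e <= c)%nat /\ (snd e <= c)%nat) -> (a < c)%nat ->
  pair_sum (0, 0)%nat E (fun x y => b2r (is_triangle x y (c, a))) =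
  Sum c (fun y => lsum E (fun e => link e c y) * lsum E (fun e => link e y a)).
Proof.
  intros H Ha. induction E as [|e E IH] using rev_ind.
  - symmetry. apply Sum_zero. intros; simpl; ring.
  - rewrite pair_sum_snoc, IH by (intros; apply H, in_or_app; now left).
    rewrite (lsum_ext E _ (fun x => Sum c (fun y => link x c y * link e y a + link e c y * link x y a))).
    2:{ intros x Hx. rewrite Sum_plus. destruct (H x), (H e); try (apply in_or_app; simpl; tauto).
        now apply is_triangle_link. }
    rewrite lsum_Sum, <- Sum_plus. apply Sum_ext. intros y Hy.
    rewrite !lsum_app, lsum_plus, lsum_scal. cbn [lsum fold_right].
    rewrite (lsum_ext E (fun x => link x c y * link e y a) (fun x => link e y a * link x c y)), lsum_scal
      by (intros; ring).
    assert (Hz : link e c y * link e y a = 0).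
    { unfold link. destruct e as [p q]. cbn [fst snd].
      repeat (match goal with |- context [Nat.eqb ?x ?y] => destruct (Nat.eqb_spec x y) end;
        subst; cbn [andb b2r]; try lia; try ring). }
    fold (lsum E (fun e0 => link e0 c y)) (lsum E (fun e0 => link e0 y a)).
    rewrite !Rplus_0_r, Rmult_plus_distr_r, !Rmult_plus_distr_l, Hz. ring.
Qed.

(** * The weighted block process *)

Inductive hist : list nat -> Prop :=
| hist_nil : hist []
| hist_snoc hs v : hist hs -> (1 <= v <= S (length hs))%nat -> hist (hs ++ [v]).

Definition nv (hs : list nat) : nat := S (length hs).

Lemma nv_snoc hs v : nv (hs ++ [v]) = S (nv hs).
Proof. unfold nv. rewrite length_app. simpl. lia. Qed.

Lemma nv_pos hs : (1 <= nv hs)%nat.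
Proof. unfold nv. lia. Qed.

Lemma hist_nth hs : hist hs -> forall j, (j < length hs)%nat -> (1 <= nth j hs 0 <= S j)%nat.
Proof.
  induction 1 as [|hs v Hh IH Hv]; intros j Hj; [simpl in Hj; lia|].
  rewrite length_app in Hj. simpl in Hj. destruct (Nat.eq_dec j (length hs)) as [->|Hn].
  - rewrite app_nth2, Nat.sub_diag by lia. simpl. lia.
  - rewrite app_nth1 by lia. apply IH. lia.
Qed.

Lemma combine_seq_snoc (a : nat) (hs : list nat) v :
  combine (seq a (length (hs ++ [v]))) (hs ++ [v])
  = combine (seq a (length hs)) hs ++ [((a + length hs)%nat, v)].
Proof.
  revert a. induction hs as [|h hs IH]; intros a; simpl.
  - do 2 f_equal. lia.
  - f_equal. rewrite IH. do 2 f_equal. f_equal. lia.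
Qed.

Section Model.

Context (beta : R) (m : nat) (Hbeta : 0 < beta) (Hm : (1 <= m)%nat).

(** The block that receives vertex [k + 1]; it is still empty when [m] divides [k]. *)
Definition blk_next (k : nat) : nat := S (k / m).
Definition den (k : nat) : R := (2 + beta) * INR k - 2.

Lemma blk_S k : blk m (S k) = blk_next k.
Proof. unfold blk, blk_next. simpl. rewrite Nat.sub_0_r. lia. Qed.

Lemma blk_le i j : (i <= j)%nat -> (blk m i <= blk m j)%nat.
Proof. intros H. unfold blk. apply Nat.add_le_mono_r, Nat.Div0.div_le_mono. lia. Qed.

Lemma den_lower k : (1 <= k)%nat -> beta * INR k <= den k.
Proof. intros H. pose proof (INR_ge1 k H). unfold den. lra. Qed.

Lemma den_pos k : (1 <= k)%nat -> 0 < den k.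
Proof. intros H. pose proof (INR_ge1 k H). pose proof (den_lower k H). nra. Qed.

Lemma edges_snoc hs v :
  edges_m m (hs ++ [v]) = edges_m m hs ++ [(blk_next (nv hs), blk m v)].
Proof.
  unfold edges_m. rewrite combine_seq_snoc, map_app. cbn [map]. do 3 f_equal.
  rewrite <- blk_S. easy.
Qed.

Lemma edges_blk hs : hist hs -> forall e, In e (edges_m m hs) ->
  (fst e <= blk m (nv hs) /\ snd e <= blk m (nv hs))%nat.
Proof.
  induction 1 as [|hs v Hh IH Hv]; intros e He; [easy|].
  rewrite edges_snoc in He. rewrite nv_snoc.
  pose proof (blk_le (nv hs) (S (nv hs)) ltac:(lia)).
  apply in_app_or in He as [He|[<-|[]]].
  - specialize (IH e He). lia.
  - cbn [fst snd]. rewrite <- blk_S. split; [lia|]. apply blk_le. unfold nv. lia.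
Qed.

(* [wt hs x] is [deg + beta * size] of block x: the target of the next vertex lies in
   block x with probability [wt hs x / den (nv hs)]. *)
Definition wt (hs : list nat) (x : nat) : R :=
  beta * lsum (seq 1 (nv hs)) (fun v => b2r (Nat.eqb (blk m v) x))
  + lsum (edges_m m hs) (fun e => b2r (Nat.eqb (fst e) x) + b2r (Nat.eqb (snd e) x)).

Definition adj (hs : list nat) (x y : nat) : R := lsum (edges_m m hs) (fun e => link e x y).

Lemma wt_snoc hs v x :
  wt (hs ++ [v]) x = wt hs x + (1 + beta) * b2r (Nat.eqb (blk_next (nv hs)) x) + b2r (Nat.eqb (blk m v) x).
Proof.
  unfold wt. rewrite nv_snoc, edges_snoc, lsum_app, seq_S, lsum_app.
  cbn [lsum fold_right fst snd Nat.add]. rewrite blk_S. unfold lsum. ring.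
Qed.

Lemma adj_snoc hs v x y : adj (hs ++ [v]) x y = adj hs x y + link (blk_next (nv hs), blk m v) x y.
Proof. unfold adj. rewrite edges_snoc, lsum_app. cbn [lsum fold_right]. unfold lsum. ring. Qed.

Lemma adj_sym hs x y : adj hs x y = adj hs y x.
Proof. unfold adj. apply lsum_ext. intros e _. apply link_sym. Qed.

Lemma adj_nonneg hs x y : 0 <= adj hs x y.
Proof.
  unfold adj. rewrite <- (lsum_zero (edges_m m hs) (fun _ => 0)) by easy.
  apply lsum_le. intros e _. apply link_nonneg.
Qed.

Lemma adj_diag hs x : adj hs x x = 0.
Proof.
  unfold adj. apply lsum_zero. intros [p q] _. unfold link. cbn [fst snd].
  destruct (Nat.eqb_spec p q); [easy|].
  destruct (Nat.eqb_spec p x), (Nat.eqb_spec q x); simpl; try ring; lia.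
Qed.

Lemma wt_nonneg hs x : 0 <= wt hs x.
Proof.
  unfold wt. apply Rplus_le_le_0_compat.
  - apply Rmult_le_pos; [lra|].
    rewrite <- (lsum_zero (seq 1 (nv hs)) (fun _ => 0)) by easy. apply lsum_le. intros; apply b2r_nonneg.
  - rewrite <- (lsum_zero (edges_m m hs) (fun _ => 0)) by easy. apply lsum_le. intros e _.
    pose proof (b2r_nonneg (Nat.eqb (fst e) x)). pose proof (b2r_nonneg (Nat.eqb (snd e) x)). lra.
Qed.

Lemma wt_fresh hs x : hist hs -> (blk m (nv hs) < x)%nat -> wt hs x = 0.
Proof.
  intros Hh Hx. unfold wt. rewrite !lsum_zero; [ring| |].
  - intros e He. destruct (edges_blk hs Hh e He).
    rewrite !(proj2 (Nat.eqb_neq _ _)) by lia. simpl. ring.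
  - intros v Hv. apply in_seq in Hv. pose proof (blk_le v (nv hs) ltac:(lia)).
    rewrite (proj2 (Nat.eqb_neq _ _)) by lia. easy.
Qed.

Lemma adj_fresh hs x y : hist hs -> (blk m (nv hs) < x)%nat -> adj hs x y = 0.
Proof.
  intros Hh Hx. unfold adj. apply lsum_zero. intros e He.
  destruct (edges_blk hs Hh e He). unfold link.
  rewrite !(proj2 (Nat.eqb_neq _ x)) by lia. rewrite andb_false_r.
  destruct (Nat.eqb (fst e) (snd e)); simpl; ring.
Qed.

(** The choice of a target is the draw of a token: a vertex of mass [beta] or a half-edge of mass 1.
    Grouping the tokens by block gives [wt], and the total mass is [den]. *)
Definition token_sum (hs : list nat) (g : nat -> R) : R :=
  beta * lsum (seq 1 (nv hs)) (fun v => g (blk m v))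
  + lsum (edges_m m hs) (fun e => g (fst e) + g (snd e)).

Lemma token_sum_snoc hs v g :
  token_sum (hs ++ [v]) g = token_sum hs g + (1 + beta) * g (blk_next (nv hs)) + g (blk m v).
Proof.
  unfold token_sum. rewrite nv_snoc, edges_snoc, lsum_app, seq_S, lsum_app.
  cbn [lsum fold_right fst snd Nat.add]. rewrite blk_S. unfold lsum. ring.
Qed.

Lemma Sum_ind_l n b (g : nat -> R) : (b < n)%nat ->
  Sum n (fun x => b2r (Nat.eqb b x) * g x) = g b.
Proof.
  intros H. rewrite <- (Sum_single n b g H). apply Sum_ext. intros i _.
  rewrite Nat.eqb_sym. destruct (Nat.eqb i b); simpl; ring.
Qed.

Lemma token_sum_wt hs g M : hist hs -> (blk m (nv hs) < M)%nat ->
  Sum M (fun x => wt hs x * g x) = token_sum hs g.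
Proof.
  intros Hh. induction Hh as [|hs v Hh IH Hv]; intros HM.
  - unfold wt, token_sum, edges_m. cbn [nv length seq lsum fold_right combine map].
    unfold nv in HM. cbn [length] in HM.
    rewrite (Sum_ext M _ (fun x => beta * (b2r (Nat.eqb (blk m 1) x) * g x))) by (intros; ring).
    rewrite Sum_scal, Sum_ind_l by easy. ring.
  - rewrite nv_snoc in HM. pose proof (blk_le (nv hs) (S (nv hs)) ltac:(lia)).
    pose proof (blk_le v (nv hs) (proj2 Hv)).
    rewrite (Sum_ext M _ (fun x => wt hs x * g x + (1 + beta) * (b2r (Nat.eqb (blk_next (nv hs)) x) * g x)
       + b2r (Nat.eqb (blk m v) x) * g x)) by (intros; rewrite wt_snoc; ring).
    rewrite !Sum_plus, Sum_scal, !Sum_ind_l by (try rewrite <- blk_S; lia).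
    rewrite token_sum_snoc, IH by lia. ring.
Qed.

Lemma blk_lt_cur hs : (blk m (nv hs) < S (blk_next (nv hs)))%nat.
Proof. rewrite <- blk_S. pose proof (blk_le (nv hs) (S (nv hs)) ltac:(lia)). lia. Qed.

Lemma token_sum_one hs : hist hs -> token_sum hs (fun _ => 1) = den (nv hs).
Proof.
  intros Hh. unfold token_sum. rewrite !lsum_const, length_seq.
  unfold edges_m. rewrite length_map, length_combine, length_seq, Nat.min_id.
  unfold den, nv. rewrite S_INR. ring.
Qed.

Lemma wt_total hs M : hist hs -> (blk m (nv hs) < M)%nat -> Sum M (wt hs) = den (nv hs).
Proof.
  intros Hh HM. rewrite <- (token_sum_one hs Hh), <- (token_sum_wt hs _ M Hh HM).
  apply Sum_ext. intros; ring.
Qed.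

(* Expectation over the block of the target of the next vertex. *)
Definition tgt (hs : list nat) (g : nat -> R) : R :=
  (Sum (blk_next (nv hs)) (fun x => wt hs x * g x) + wt hs (blk_next (nv hs)) * g (blk_next (nv hs))) / den (nv hs).

Definition next (hs : list nat) (f : list nat -> R) : R :=
  lsum (choices beta (nv hs)) (fun qc => fst qc * f (hs ++ [target hs (snd qc)])).

Lemma choices_in hs q c : hist hs -> In (q, c) (choices beta (nv hs)) ->
  0 <= q /\ (1 <= target hs c <= nv hs)%nat.
Proof.
  intros Hh Hin. unfold choices in Hin. fold (den (nv hs)) in Hin.
  pose proof (den_pos (nv hs) (nv_pos hs)) as Hd.
  assert (H1 : 0 <= beta / den (nv hs)) by (apply Rlt_le, Rdiv_lt_0_compat; easy).
  assert (H2 : 0 <= 1 / den (nv hs)) by (apply Rlt_le, Rdiv_lt_0_compat; lra).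
  apply in_app_or in Hin as [Hin|Hin].
  - apply in_map_iff in Hin as [i [E Hi]]. apply in_seq in Hi. injection E as <- <-.
    split; [easy|]. cbn. lia.
  - apply in_flat_map in Hin as [i [Hi Hin]]. apply in_seq in Hi. unfold nv in *.
    destruct Hin as [E|[E|[]]]; injection E as <- <-; (split; [easy|]); cbn [target Nat.eqb].
    + pose proof (hist_nth hs Hh (i - 2) ltac:(lia)). lia.
    + lia.
Qed.

(** Passage from the concrete law of [f_{k+1}] to the block process: only the block of the target
    matters, and the choices [(i,h)] and [(i,t)] run through all half-edges. *)
Lemma next_tgt hs f g : hist hs ->
  (forall v, (1 <= v <= nv hs)%nat -> f (hs ++ [v]) = g (blk m v)) -> next hs f = tgt hs g.
Proof.
  intros Hh Hf. unfold tgt.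
  replace (Sum (blk_next (nv hs)) (fun x => wt hs x * g x) + wt hs (blk_next (nv hs)) * g (blk_next (nv hs)))
    with (Sum (S (blk_next (nv hs))) (fun x => wt hs x * g x)) by easy.
  rewrite (token_sum_wt hs g _ Hh (blk_lt_cur hs)).
  unfold next. rewrite (lsum_ext _ _ (fun qc => fst qc * g (blk m (target hs (snd qc))))).
  2:{ intros [q c] Hin. destruct (choices_in hs q c Hh Hin). cbn [fst snd]. now rewrite Hf. }
  unfold choices. fold (den (nv hs)). pose proof (den_pos (nv hs) (nv_pos hs)) as Hd.
  rewrite lsum_app, lsum_map, lsum_flat_map. cbn [fst snd lsum fold_right target Nat.eqb].
  unfold token_sum, edges_m. rewrite lsum_map. rewrite lsum_scal.
  (* The history begins with [e_2], so the head of [e_i] stands at position [i - 2]. *)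
  assert (E : forall F : nat * nat -> R, lsum (combine (seq 2 (length hs)) hs) F =
     lsum (seq 2 (nv hs - 1)) (fun i => F (i, nth (i - 2) hs 0%nat))).
  { intros F. unfold nv. replace (S (length hs) - 1)%nat with (length hs) by lia.
    rewrite <- (lsum_map (fun i => (i, nth (i - 2) hs 0%nat)) (seq 2 (length hs)) F). f_equal.
    clear. cut (forall a, combine (seq a (length hs)) hs =
       map (fun i => (i, nth (i - a) hs 0%nat)) (seq a (length hs))); [easy|].
    induction hs as [|h hs IH]; intros a; [easy|]. cbn [length seq combine map].
    rewrite Nat.sub_diag. f_equal. rewrite IH. apply map_ext_in. intros i Hi. apply in_seq in Hi.
    replace (i - a)%nat with (S (i - S a)) by lia. easy. }
  rewrite E. cbn [fst snd]. unfold Rdiv.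
  rewrite (lsum_ext (seq 2 (nv hs - 1)) _ (fun i => / den (nv hs) *
     (g (blk m i) + g (blk m (nth (i - 2) hs 0%nat))))) by (intros; ring).
  rewrite lsum_scal. ring.
Qed.

Lemma tgt_ext hs g g' : (forall x, (x <= blk_next (nv hs))%nat -> g x = g' x) -> tgt hs g = tgt hs g'.
Proof.
  intros H. unfold tgt. rewrite H by lia. f_equal. f_equal. apply Sum_ext. intros i Hi.
  now rewrite H by lia.
Qed.

Lemma tgt_plus hs g g' : tgt hs (fun x => g x + g' x) = tgt hs g + tgt hs g'.
Proof.
  unfold tgt. rewrite (Sum_ext _ _ (fun x => wt hs x * g x + wt hs x * g' x)) by (intros; ring).
  rewrite Sum_plus. unfold Rdiv. ring.
Qed.

Lemma tgt_scal hs a g : tgt hs (fun x => a * g x) = a * tgt hs g.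
Proof.
  unfold tgt. rewrite (Sum_ext _ _ (fun x => a * (wt hs x * g x))) by (intros; ring).
  rewrite Sum_scal. unfold Rdiv. ring.
Qed.

Lemma tgt_const hs a : hist hs -> tgt hs (fun _ => a) = a.
Proof.
  intros Hh. unfold tgt. pose proof (den_pos (nv hs) (nv_pos hs)) as Hd.
  pose proof (wt_total hs _ Hh (blk_lt_cur hs)) as Ht. cbn [Sum] in Ht.
  rewrite (Sum_ext _ _ (fun x => a * wt hs x)) by (intros; ring). rewrite Sum_scal.
  rewrite <- Ht. rewrite <- Ht in Hd. field. lra.
Qed.

(** * Expectations over histories *)

Definition Ex (k : nat) (f : list nat -> R) : R :=
  lsum (outcomes beta k) (fun ph => fst ph * f (snd ph)).

Lemma outcomes_hist k : (1 <= k)%nat -> forall ph, In ph (outcomes beta k) ->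
  0 <= fst ph /\ hist (snd ph) /\ nv (snd ph) = k.
Proof.
  induction k as [|k IH]; intros Hk ph Hin; [lia|].
  destruct k as [|k].
  - destruct Hin as [<-|[]]. cbn [fst snd]. repeat split; [lra|constructor].
  - change (In ph (flat_map (fun ph : R * list nat => let '(p, hs) := ph in
       map (fun qc : R * (nat * nat) => let '(q, c) := qc in (p * q, hs ++ [target hs c]))
           (choices beta (S k))) (outcomes beta (S k)))) in Hin.
    apply in_flat_map in Hin as [[p hs] [Hp Hin]]. destruct (IH ltac:(lia) _ Hp) as [H0 [H1 H2]].
    cbn [fst snd] in *. apply in_map_iff in Hin as [[q c] [<- Hq]]. cbn [fst snd].
    rewrite <- H2 in Hq. destruct (choices_in hs q c H1 Hq). split; [|split].
    + now apply Rmult_le_pos.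
    + now constructor.
    + now rewrite nv_snoc, H2.
Qed.

Lemma Ex_ext k f g : (1 <= k)%nat -> (forall hs, hist hs -> nv hs = k -> f hs = g hs) -> Ex k f = Ex k g.
Proof.
  intros Hk H. apply lsum_ext. intros ph Hin. destruct (outcomes_hist k Hk ph Hin) as [_ [H1 H2]].
  now rewrite H.
Qed.

Lemma Ex_le k f g : (1 <= k)%nat -> (forall hs, hist hs -> nv hs = k -> f hs <= g hs) -> Ex k f <= Ex k g.
Proof.
  intros Hk H. apply lsum_le. intros ph Hin. destruct (outcomes_hist k Hk ph Hin) as [H0 [H1 H2]].
  apply Rmult_le_compat_l; [easy|]. now apply H.
Qed.

Lemma Ex_plus k f g : Ex k (fun hs => f hs + g hs) = Ex k f + Ex k g.
Proof. unfold Ex. rewrite <- lsum_plus. apply lsum_ext. intros; ring. Qed.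

Lemma Ex_scal k a f : Ex k (fun hs => a * f hs) = a * Ex k f.
Proof. unfold Ex. rewrite <- lsum_scal. apply lsum_ext. intros; ring. Qed.

Lemma Ex_S k f : (1 <= k)%nat -> Ex (S k) f = Ex k (fun hs => next hs f).
Proof.
  intros Hk. destruct k as [|k]; [lia|]. unfold Ex at 1.
  change (outcomes beta (S (S k))) with (flat_map (fun ph : R * list nat => let '(p, hs) := ph in
       map (fun qc : R * (nat * nat) => let '(q, c) := qc in (p * q, hs ++ [target hs c]))
           (choices beta (S k))) (outcomes beta (S k))).
  rewrite lsum_flat_map. unfold Ex. apply lsum_ext. intros [p hs] Hin.
  destruct (outcomes_hist (S k) Hk _ Hin) as [_ [_ E]]. cbn [fst snd] in *.
  rewrite lsum_map. unfold next. rewrite E, <- lsum_scal. apply lsum_ext. intros [q c] _.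
  cbn [fst snd]. ring.
Qed.

Lemma Ex_const k a : (1 <= k)%nat -> Ex k (fun _ => a) = a.
Proof.
  intros Hk. induction Hk as [|k Hk IH].
  - unfold Ex. simpl. ring.
  - rewrite Ex_S by easy. transitivity (Ex k (fun _ => a)); [|exact IH]. apply Ex_ext; [easy|]. intros hs Hh _.
    rewrite (next_tgt hs _ (fun _ => a)) by easy. now apply tgt_const.
Qed.

Lemma Ex_nonneg k f : (1 <= k)%nat -> (forall hs, hist hs -> nv hs = k -> 0 <= f hs) -> 0 <= Ex k f.
Proof. intros Hk H. rewrite <- (Ex_const k 0 Hk). now apply Ex_le. Qed.

Lemma Ex_step_le k f g : (1 <= k)%nat ->
  (forall hs, hist hs -> nv hs = k -> exists F,
     (forall v, (1 <= v <= nv hs)%nat -> f (hs ++ [v]) <= F (blk m v)) /\ tgt hs F <= g hs) ->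
  Ex (S k) f <= Ex k g.
Proof.
  intros Hk H. rewrite Ex_S by easy. apply Ex_le; [easy|]. intros hs Hh E.
  destruct (H hs Hh E) as [F [HF Hg]]. eapply Rle_trans; [|exact Hg].
  (* [next_tgt] applies to functions of the extended history; reading the target off its last entry
     turns [F] into one. *)
  rewrite <- (next_tgt hs (fun hs' => F (blk m (last hs' O))) F Hh).
  - apply lsum_le. intros [q c] Hin. destruct (choices_in hs q c Hh Hin). cbn [fst snd].
    apply Rmult_le_compat_l; [easy|]. rewrite last_last. now apply HF.
  - intros v _. now rewrite last_last.
Qed.

Lemma Ex_step_eq k f g : (1 <= k)%nat ->
  (forall hs, hist hs -> nv hs = k -> exists F,
     (forall v, (1 <= v <= nv hs)%nat -> f (hs ++ [v]) = F (blk m v)) /\ tgt hs F = g hs) ->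
  Ex (S k) f = Ex k g.
Proof.
  intros Hk H. rewrite Ex_S by easy. apply Ex_ext; [easy|]. intros hs Hh E.
  destruct (H hs Hh E) as [F [HF <-]]. now apply next_tgt.
Qed.

Lemma blk_le_cur hs v : (v <= nv hs)%nat -> (blk m v <= blk_next (nv hs))%nat.
Proof. intros H. rewrite <- blk_S. apply blk_le. lia. Qed.

Lemma cur_S k :
  (blk_next (S k) = blk_next k /\ (S k) mod m = S (k mod m) /\ S (k mod m) < m)%nat \/
  (blk_next (S k) = S (blk_next k) /\ (S k) mod m = 0 /\ S (k mod m) = m)%nat.
Proof. unfold blk_next. destruct (mod_S_cases m k Hm) as [[E1 [E2 E3]]|[E1 [E2 E3]]]; [left|right]; lia. Qed.

(* Blocks are numbered from 1 and block 0 is empty, so that sums over [x < open_blk hs]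
   range over the closed blocks. *)
Definition open_blk (hs : list nat) : nat := blk_next (nv hs).
Definition past (hs : list nat) (g : nat -> R) (x : nat) : R := if Nat.ltb x (open_blk hs) then g x else 0.
Definition atcur (hs : list nat) (x : nat) : R := b2r (Nat.eqb x (open_blk hs)).

Definition nbr (c : nat) (hs : list nat) (x : nat) : R := Sum c (fun y => adj hs x y * wt hs y).
Definition pow_sum (p c : nat) (hs : list nat) : R := Sum c (fun x => wt hs x ^ p).
Definition pair_wt (c : nat) (hs : list nat) : R := Sum c (fun x => wt hs x * nbr c hs x).
(* 2-paths from block c, weighted by their end: a new edge of c to that end closes a triangle. *)
Definition path_wt (c : nat) (hs : list nat) : R := Sum c (fun y => adj hs c y * nbr c hs y).

Definition wt_cur hs := wt hs (open_blk hs).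
Definition nbr_cur hs := nbr (open_blk hs) hs (open_blk hs).
Definition sq_wt hs := pow_sum 2 (open_blk hs) hs.
Definition cube_wt hs := pow_sum 3 (open_blk hs) hs.
Definition edge_wt hs := pair_wt (open_blk hs) hs.
Definition path_cur hs := path_wt (open_blk hs) hs.
Definition tri_num hs := INR (triangles (edges_m m hs)).

(** The [d_] functions are increments as functions of the block [x] of the target, before a possible
    closing of the open block. Those cut off by [past] vanish at the open block: there the new edge
    is a loop and changes no sum over closed blocks. *)
Definition d_sq_wt hs := past hs (fun x => 2 * wt hs x + 1).
Definition d_cube_wt hs := past hs (fun x => 3 * wt hs x ^ 2 + 3 * wt hs x + 1).
Definition d_edge_wt hs := past hs (fun x => 2 * nbr (open_blk hs) hs x).
Definition d_nbr_cur hs := past hs (fun x => adj hs (open_blk hs) x + wt hs x + 1).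
Definition d_tri hs := past hs (fun x => Sum (open_blk hs) (fun y => adj hs (open_blk hs) y * adj hs y x)).
Definition d_path_cur hs x := past hs (nbr (open_blk hs) hs) x + d_tri hs x.
(** The new vertex brings [beta], its tail half-edge 1, and a loop one more half-edge. *)
Definition d_wt_cur hs x := 1 + beta + atcur hs x.

Lemma wt_step hs v x : (x < open_blk hs)%nat -> wt (hs ++ [v]) x = wt hs x + b2r (Nat.eqb (blk m v) x).
Proof.
  intros H. rewrite wt_snoc. unfold open_blk in H. rewrite (proj2 (Nat.eqb_neq (blk_next (nv hs)) x)) by lia.
  cbn [b2r]. ring.
Qed.

Lemma wt_step_cur hs v : wt (hs ++ [v]) (open_blk hs) = wt_cur hs + d_wt_cur hs (blk m v).
Proof. rewrite wt_snoc. unfold wt_cur, d_wt_cur, atcur, open_blk. rewrite Nat.eqb_refl. cbn [b2r]. ring. Qed.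

Lemma adj_step hs v x y : (x < open_blk hs)%nat -> (y < open_blk hs)%nat -> adj (hs ++ [v]) x y = adj hs x y.
Proof.
  intros Hx Hy. rewrite adj_snoc. unfold link. unfold open_blk in *. cbn [fst snd].
  rewrite (proj2 (Nat.eqb_neq (blk_next (nv hs)) x)), (proj2 (Nat.eqb_neq (blk_next (nv hs)) y)) by lia. cbn [andb b2r].
  destruct (Nat.eqb _ _); ring.
Qed.

Lemma adj_step_cur hs v y : (y < open_blk hs)%nat -> adj (hs ++ [v]) (open_blk hs) y = adj hs (open_blk hs) y + b2r (Nat.eqb (blk m v) y).
Proof.
  intros Hy. rewrite adj_snoc. unfold link. unfold open_blk in *. cbn [fst snd].
  rewrite Nat.eqb_refl, (proj2 (Nat.eqb_neq (blk_next (nv hs)) y)) by lia. cbn [andb b2r].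
  destruct (Nat.eqb_spec (blk_next (nv hs)) (blk m v)) as [E|_]; [|ring].
  rewrite <- E, (proj2 (Nat.eqb_neq (blk_next (nv hs)) y)) by lia. simpl. ring.
Qed.

Lemma Sum_past hs a F : (a <= open_blk hs)%nat ->
  Sum (open_blk hs) (fun x => b2r (Nat.eqb a x) * F x) = past hs F a.
Proof.
  intros Ha. unfold past. destruct (Nat.ltb_spec a (open_blk hs)) as [H|H].
  - now apply Sum_ind_l.
  - apply Sum_zero. intros i Hi. rewrite (proj2 (Nat.eqb_neq a i)) by lia. simpl. ring.
Qed.

Section Step.

Context (hs : list nat) (v : nat) (Hv : (v <= nv hs)%nat).

Let a := blk m v.
Let Ha : (a <= open_blk hs)%nat := blk_le_cur hs v Hv.

Lemma pow_sum2_step : pow_sum 2 (open_blk hs) (hs ++ [v]) = sq_wt hs + d_sq_wt hs a.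
Proof.
  unfold sq_wt, d_sq_wt, pow_sum. rewrite <- Sum_past by exact Ha. rewrite <- Sum_plus. apply Sum_ext.
  intros x Hx. rewrite wt_step by easy. fold a. destruct (Nat.eqb a x); simpl; ring.
Qed.

Lemma pow_sum3_step : pow_sum 3 (open_blk hs) (hs ++ [v]) = cube_wt hs + d_cube_wt hs a.
Proof.
  unfold cube_wt, d_cube_wt, pow_sum. rewrite <- Sum_past by exact Ha. rewrite <- Sum_plus. apply Sum_ext.
  intros x Hx. rewrite wt_step by easy. fold a. destruct (Nat.eqb a x); simpl; ring.
Qed.

Lemma nbr_step x : (x < open_blk hs)%nat ->
  nbr (open_blk hs) (hs ++ [v]) x = nbr (open_blk hs) hs x + past hs (adj hs x) a.
Proof.
  intros Hx. unfold nbr. rewrite <- Sum_past by exact Ha. rewrite <- Sum_plus. apply Sum_ext.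
  intros y Hy. rewrite wt_step, adj_step by easy. fold a. ring.
Qed.

Lemma nbr_step_cur : nbr (open_blk hs) (hs ++ [v]) (open_blk hs) = nbr_cur hs + d_nbr_cur hs a.
Proof.
  unfold nbr_cur, d_nbr_cur, nbr. rewrite <- Sum_past by exact Ha. rewrite <- Sum_plus. apply Sum_ext.
  intros y Hy. rewrite wt_step, adj_step_cur by easy. fold a. destruct (Nat.eqb a y); simpl; ring.
Qed.

Lemma pair_wt_step : pair_wt (open_blk hs) (hs ++ [v]) = edge_wt hs + d_edge_wt hs a.
Proof.
  unfold edge_wt, d_edge_wt, pair_wt.
  rewrite (Sum_ext _ _ (fun x => wt hs x * nbr (open_blk hs) hs x
     + (b2r (Nat.eqb a x) * nbr (open_blk hs) hs x
     + (wt hs x * past hs (adj hs x) a + b2r (Nat.eqb a x) * past hs (adj hs x) a)))).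
  2:{ intros x Hx. rewrite wt_step, nbr_step by easy. fold a. ring. }
  rewrite !Sum_plus, Sum_past, Sum_past by exact Ha. f_equal. unfold past.
  destruct (Nat.ltb a (open_blk hs)) eqn:E.
  - rewrite adj_diag. unfold nbr at 2.
    rewrite (Sum_ext (open_blk hs) (fun x => wt hs x * adj hs x a) (fun y => adj hs a y * wt hs y))
      by (intros; rewrite (adj_sym hs _ a); ring).
    unfold nbr. ring.
  - rewrite Sum_zero by (intros; ring). ring.
Qed.

(** A new edge to [a] starts paths of end weight [nbr a], and the added half-edge at [a] raises the
    weight of the paths that end there. The mixed term vanishes because [adj] is zero on the
    diagonal. *)
Lemma path_wt_step : path_wt (open_blk hs) (hs ++ [v]) = path_cur hs + d_path_cur hs a.
Proof.
  unfold path_cur, d_path_cur, d_tri, path_wt.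
  rewrite (Sum_ext _ _ (fun y => adj hs (open_blk hs) y * nbr (open_blk hs) hs y
     + (b2r (Nat.eqb a y) * nbr (open_blk hs) hs y
     + (adj hs (open_blk hs) y * past hs (adj hs y) a + b2r (Nat.eqb a y) * past hs (adj hs y) a)))).
  2:{ intros x Hx. rewrite adj_step_cur, nbr_step by easy. fold a. ring. }
  rewrite !Sum_plus, Sum_past, Sum_past by exact Ha. f_equal. f_equal. unfold past.
  destruct (Nat.ltb a (open_blk hs)) eqn:E.
  - rewrite adj_diag. ring.
  - rewrite Sum_zero by (intros; ring). ring.
Qed.

(** The new edge starts in the open block, which has the largest index, so [pair_sum_triangle]
    counts the new triangles as 2-paths through closed blocks. A loop closes none. *)
Lemma tri_num_step : hist hs -> tri_num (hs ++ [v]) = tri_num hs + d_tri hs a.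
Proof.
  intros Hh. unfold tri_num. rewrite edges_snoc, triangles_snoc. f_equal. fold (open_blk hs).
  unfold d_tri, past. destruct (Nat.ltb_spec a (open_blk hs)) as [H|H].
  - apply pair_sum_triangle; [|exact H]. intros e He. destruct (edges_blk hs Hh e He).
    pose proof (blk_le_cur hs (nv hs) ltac:(lia)). unfold open_blk in *. lia.
  - replace (blk m v) with (open_blk hs) by (apply Nat.le_antisymm; [exact H|exact Ha]). unfold pair_sum.
    apply lsum_zero. intros i _. apply lsum_zero. intros j _. now rewrite is_triangle_loop.
Qed.

End Step.

(* The current block either stays open or is closed and joins the past. *)
Lemma state_step hs v : hist hs -> (1 <= v <= nv hs)%nat ->
  let a := blk m v in let hs' := hs ++ [v] in
  ((nv hs') mod m = S (nv hs mod m) /\ (nv hs' mod m < m)%nat /\ wt_cur hs' = wt_cur hs + d_wt_cur hs a /\ nbr_cur hs' = nbr_cur hs + d_nbr_cur hs a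
    /\ path_cur hs' = path_cur hs + d_path_cur hs a /\ sq_wt hs' = sq_wt hs + d_sq_wt hs a
    /\ cube_wt hs' = cube_wt hs + d_cube_wt hs a /\ edge_wt hs' = edge_wt hs + d_edge_wt hs a) \/
  ((nv hs') mod m = O /\ S (nv hs mod m) = m /\ wt_cur hs' = 0 /\ nbr_cur hs' = 0 /\ path_cur hs' = 0
    /\ sq_wt hs' = sq_wt hs + d_sq_wt hs a + (wt_cur hs + d_wt_cur hs a) ^ 2
    /\ cube_wt hs' = cube_wt hs + d_cube_wt hs a + (wt_cur hs + d_wt_cur hs a) ^ 3
    /\ edge_wt hs' = edge_wt hs + d_edge_wt hs a + 2 * (wt_cur hs + d_wt_cur hs a) * (nbr_cur hs + d_nbr_cur hs a)).
Proof.
  intros Hh Hv a hs'. assert (Hvl : (v <= nv hs)%nat) by lia.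
  assert (Hh' : hist hs') by now constructor.
  assert (Env : nv hs' = S (nv hs)) by apply nv_snoc.
  destruct (cur_S (nv hs)) as [[E [E1 E2]]|[E [E1 E2]]]; [left|right].
  - assert (Ec : open_blk hs' = open_blk hs) by (unfold open_blk; rewrite Env; easy).
    rewrite Env. split; [easy|]. split; [lia|].
    unfold wt_cur at 1, nbr_cur at 1, path_cur at 1, sq_wt at 1, cube_wt at 1, edge_wt at 1. rewrite Ec. unfold hs', a.
    rewrite wt_step_cur, nbr_step_cur, path_wt_step, pow_sum2_step, pow_sum3_step, pair_wt_step by easy.
    easy.
  - assert (Ec : open_blk hs' = S (open_blk hs)) by (unfold open_blk; rewrite Env; easy).
    rewrite Env. split; [easy|]. split; [easy|].
    assert (Hf : (blk m (nv hs') < S (open_blk hs))%nat).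
    { rewrite Env, blk_S. unfold open_blk. lia. }
    unfold wt_cur at 1, nbr_cur at 1, path_cur at 1, sq_wt at 1, cube_wt at 1, edge_wt at 1. rewrite Ec.
    split; [now apply wt_fresh|].
    split; [apply Sum_zero; intros; rewrite adj_fresh by easy; ring|].
    split; [apply Sum_zero; intros; rewrite adj_fresh by easy; ring|].
    unfold pow_sum. cbn [Sum]. fold (pow_sum 2 (open_blk hs) hs') (pow_sum 3 (open_blk hs) hs').
    unfold hs', a. rewrite wt_step_cur, pow_sum2_step, pow_sum3_step by easy.
    split; [easy|]. split; [easy|].
    unfold pair_wt. cbn [Sum]. fold hs'.
    assert (En : nbr (S (open_blk hs)) hs' (open_blk hs) = nbr_cur hs + d_nbr_cur hs a).
    { unfold nbr. cbn [Sum]. fold (nbr (open_blk hs) hs' (open_blk hs)). rewrite adj_diag.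
      unfold hs', a. rewrite nbr_step_cur by easy. ring. }
    rewrite En. unfold hs' at 3. rewrite wt_step_cur. fold a.
    rewrite (Sum_ext _ _ (fun x => wt hs' x * nbr (open_blk hs) hs' x
        + wt hs' (open_blk hs) * (adj hs' (open_blk hs) x * wt hs' x))).
    2:{ intros x Hx. unfold nbr. cbn [Sum]. rewrite (adj_sym hs' x (open_blk hs)). ring. }
    rewrite Sum_plus, Sum_scal. fold (pair_wt (open_blk hs) hs') (nbr (open_blk hs) hs' (open_blk hs)).
    unfold hs'. rewrite pair_wt_step, wt_step_cur, nbr_step_cur by easy. fold a. ring.
Qed.

(** * Conditional mean steps *)

Lemma tgt_past hs F : tgt hs (past hs F) = Sum (open_blk hs) (fun x => wt hs x * F x) / den (nv hs).
Proof.
  unfold tgt, past. unfold open_blk. rewrite Nat.ltb_irrefl, Rmult_0_r, Rplus_0_r. f_equal.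
  apply Sum_ext. intros x Hx. rewrite (proj2 (Nat.ltb_lt _ _)) by lia. easy.
Qed.

Lemma tgt_atcur hs : tgt hs (atcur hs) = wt_cur hs / den (nv hs).
Proof.
  unfold tgt, atcur, wt_cur, open_blk. rewrite Nat.eqb_refl. cbn [b2r]. f_equal.
  rewrite Sum_zero; [ring|]. intros x Hx. rewrite (proj2 (Nat.eqb_neq _ _)) by lia. simpl. ring.
Qed.

Lemma wt_past hs : hist hs -> Sum (open_blk hs) (wt hs) = den (nv hs) - wt_cur hs.
Proof.
  intros Hh. rewrite <- (wt_total hs _ Hh (blk_lt_cur hs)). cbn [Sum]. unfold wt_cur, open_blk. ring.
Qed.

Lemma tgt_d_sq_wt hs : hist hs -> tgt hs (d_sq_wt hs) = (2 * sq_wt hs + den (nv hs) - wt_cur hs) / den (nv hs).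
Proof.
  intros Hh. unfold d_sq_wt. rewrite tgt_past. f_equal.
  rewrite (Sum_ext _ _ (fun x => 2 * wt hs x ^ 2 + wt hs x)) by (intros; ring).
  rewrite Sum_plus, Sum_scal, wt_past by easy. unfold sq_wt, pow_sum. ring.
Qed.

Lemma tgt_d_cube_wt hs : hist hs ->
  tgt hs (d_cube_wt hs) = (3 * cube_wt hs + 3 * sq_wt hs + den (nv hs) - wt_cur hs) / den (nv hs).
Proof.
  intros Hh. unfold d_cube_wt. rewrite tgt_past. f_equal.
  rewrite (Sum_ext _ _ (fun x => 3 * wt hs x ^ 3 + (3 * wt hs x ^ 2 + wt hs x))) by (intros; ring).
  rewrite !Sum_plus, !Sum_scal, wt_past by easy. unfold sq_wt, cube_wt, pow_sum. ring.
Qed.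

Lemma tgt_d_edge_wt hs : tgt hs (d_edge_wt hs) = 2 * edge_wt hs / den (nv hs).
Proof.
  unfold d_edge_wt. rewrite tgt_past. f_equal.
  rewrite (Sum_ext _ _ (fun x => 2 * (wt hs x * nbr (open_blk hs) hs x))) by (intros; ring).
  now rewrite Sum_scal.
Qed.

Lemma tgt_d_nbr_cur hs : hist hs -> tgt hs (d_nbr_cur hs) = (nbr_cur hs + sq_wt hs + den (nv hs) - wt_cur hs) / den (nv hs).
Proof.
  intros Hh. unfold d_nbr_cur. rewrite tgt_past. f_equal.
  rewrite (Sum_ext _ _ (fun x => adj hs (open_blk hs) x * wt hs x + (wt hs x ^ 2 + wt hs x))) by (intros; ring).
  rewrite !Sum_plus, wt_past by easy. unfold sq_wt, pow_sum, nbr_cur, nbr. ring.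
Qed.

Lemma tgt_d_tri hs : tgt hs (d_tri hs) = path_cur hs / den (nv hs).
Proof.
  unfold d_tri. rewrite tgt_past. f_equal. unfold path_cur, path_wt, nbr.
  rewrite (Sum_ext _ _ (fun x => Sum (open_blk hs) (fun y => adj hs (open_blk hs) y * (adj hs y x * wt hs x)))).
  2:{ intros x _. rewrite <- Sum_scal. apply Sum_ext. intros; ring. }
  rewrite Sum_exchange. apply Sum_ext. intros y _. now rewrite Sum_scal.
Qed.

Lemma tgt_d_path_cur hs : tgt hs (d_path_cur hs) = (edge_wt hs + path_cur hs) / den (nv hs).
Proof.
  unfold d_path_cur. rewrite tgt_plus, tgt_past, tgt_d_tri. unfold edge_wt, pair_wt, Rdiv. ring.
Qed.

Lemma tgt_d_wt_cur hs : hist hs -> tgt hs (d_wt_cur hs) = 1 + beta + wt_cur hs / den (nv hs).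
Proof. intros Hh. unfold d_wt_cur. now rewrite tgt_plus, tgt_const, tgt_atcur by easy. Qed.

(* The [- 1] is due to [v_1], the only vertex without an outgoing edge. *)
Lemma hist_bounds hs : hist hs ->
  (1 + beta) * INR (nv hs mod m) - 1 <= wt_cur hs <= (2 + beta) * INR (nv hs mod m) /\
  Sum (open_blk hs) (adj hs (open_blk hs)) <= INR (nv hs mod m) /\
  (forall x y, (x < open_blk hs)%nat -> (y < open_blk hs)%nat -> adj hs x y <= INR m).
Proof.
  induction 1 as [|hs v Hh IH Hv].
  - assert (Hadj : forall x y, adj [] x y = 0) by easy.
    split; [|split].
    + unfold wt_cur, open_blk, blk_next, wt, nv. cbn [length].
      cbn [edges_m map combine length seq lsum fold_right].
      unfold blk. rewrite Nat.sub_diag, Nat.Div0.div_0_l.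
      destruct (Nat.eq_dec m 1) as [->|Hn].
      * simpl. lra.
      * rewrite Nat.mod_small, Nat.div_small by lia. simpl. lra.
    + rewrite Sum_zero by easy. apply pos_INR.
    + intros. rewrite Hadj. apply pos_INR.
  - destruct IH as [IH1 [IH2 IH3]].
    assert (Hvl : (v <= nv hs)%nat) by (unfold nv; lia).
    assert (Hv' : (1 <= v <= nv hs)%nat) by (unfold nv; lia).
    pose proof (blk_le_cur hs v Hvl) as Ha. fold (open_blk hs) in Ha.
    assert (Hat : 0 <= atcur hs (blk m v) <= 1)
      by (unfold atcur; destruct (Nat.eqb _ _); simpl; lra).
    assert (Hs : Sum (open_blk hs) (adj (hs ++ [v]) (open_blk hs)) <= INR (nv hs mod m) + 1).
    { rewrite (Sum_ext _ _ (fun y => adj hs (open_blk hs) y + b2r (Nat.eqb (blk m v) y) * 1)).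
      2:{ intros y Hy. rewrite adj_step_cur by easy. ring. }
      rewrite Sum_plus, Sum_past by easy. unfold past. destruct (Nat.ltb _ _); lra. }
    assert (Env : nv (hs ++ [v]) = S (nv hs)) by apply nv_snoc.
    destruct (state_step hs v Hh Hv') as [[E [E' [Ew _]]]|[E [E' [Ew _]]]];
    destruct (cur_S (nv hs)) as [[F [F1 F2]]|[F [F1 F2]]]; try (rewrite Env in E; lia).
    + assert (Ec : open_blk (hs ++ [v]) = open_blk hs) by (unfold open_blk; now rewrite Env).
      rewrite E, S_INR, Ew, Ec. unfold d_wt_cur. split; [lra|]. split; [lra|].
      intros x y Hx Hy. rewrite adj_step by easy. now apply IH3.
    + assert (Ec : open_blk (hs ++ [v]) = S (open_blk hs)) by (unfold open_blk; now rewrite Env).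
      assert (Hb : (blk m (nv (hs ++ [v])) < S (open_blk hs))%nat) by (rewrite Env, blk_S; unfold open_blk; lia).
      assert (Hh' : hist (hs ++ [v])) by now constructor.
      rewrite E, Ew, Ec. split; [simpl; lra|]. split.
      { rewrite Sum_zero; [simpl; lra|]. intros. now apply adj_fresh. }
      assert (Hm' : INR m = INR (nv hs mod m) + 1) by (rewrite <- S_INR, E'; easy).
      (* Edges between two blocks all have their tails in the newer one, so there are at most [m] of
         them; the bound is settled when the newer block closes. *)
      assert (Hlast : forall y, (y < open_blk hs)%nat -> adj (hs ++ [v]) (open_blk hs) y <= INR m).
      { intros y Hy. rewrite Hm'. eapply Rle_trans; [|exact Hs].
        apply (Sum_term (open_blk hs) (adj (hs ++ [v]) (open_blk hs)) y); [|easy]. intros; apply adj_nonneg. }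
      intros x y Hx Hy.
      destruct (Nat.eq_dec x (open_blk hs)) as [->|Hxc]; destruct (Nat.eq_dec y (open_blk hs)) as [->|Hyc].
      * rewrite adj_diag. apply pos_INR.
      * apply Hlast; lia.
      * rewrite adj_sym. apply Hlast; lia.
      * rewrite adj_step by lia. apply IH3; lia.
Qed.

(** * Bounds valid for every history *)

Lemma INR_mod_le k : INR (k mod m) <= INR m.
Proof. apply le_INR. pose proof (Nat.mod_upper_bound k m ltac:(lia)). lia. Qed.

(** The number of loops at the open block, reduced by one while that block contains [v_1]. *)
Definition loops hs := wt_cur hs - (1 + beta) * INR (nv hs mod m).

Lemma wt_cur_bounds hs : hist hs -> 0 <= wt_cur hs <= (2 + beta) * INR m.
Proof.
  intros Hh. split; [apply wt_nonneg; lra|]. destruct (hist_bounds hs Hh) as [H _].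
  pose proof (INR_mod_le (nv hs)). nra.
Qed.

Lemma loops_bounds hs : hist hs -> - INR m <= loops hs <= INR m.
Proof.
  intros Hh. destruct (hist_bounds hs Hh) as [H _]. unfold loops.
  pose proof (INR_mod_le (nv hs)). pose proof (pos_INR (nv hs mod m)).
  pose proof (INR_ge1 m Hm). lra.
Qed.

Lemma adj_cur_bound hs y : hist hs -> (y < open_blk hs)%nat -> adj hs (open_blk hs) y <= INR m.
Proof.
  intros Hh Hy. destruct (hist_bounds hs Hh) as [_ [H _]]. pose proof (INR_mod_le (nv hs)).
  pose proof (Sum_term (open_blk hs) (adj hs (open_blk hs)) y) as Ht.
  specialize (Ht ltac:(intros; apply adj_nonneg) Hy). lra.
Qed.

Lemma wt_past_le hs : hist hs -> Sum (open_blk hs) (wt hs) <= den (nv hs).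
Proof. intros Hh. rewrite wt_past by easy. pose proof (wt_cur_bounds hs Hh). lra. Qed.

Lemma nbr_nonneg c hs x : 0 <= nbr c hs x.
Proof. apply Sum_nonneg. intros; apply Rmult_le_pos; [apply adj_nonneg|apply wt_nonneg; lra]. Qed.

Lemma nbr_bound hs x : hist hs -> (x <= open_blk hs)%nat -> nbr (open_blk hs) hs x <= INR m * den (nv hs).
Proof.
  intros Hh Hx. apply Rle_trans with (Sum (open_blk hs) (fun y => INR m * wt hs y)).
  - apply Sum_le. intros y Hy. apply Rmult_le_compat_r; [apply wt_nonneg; lra|].
    destruct (Nat.eq_dec x (open_blk hs)) as [->|Hn]; [now apply adj_cur_bound|].
    apply hist_bounds; try easy; lia.
  - rewrite Sum_scal. apply Rmult_le_compat_l; [apply pos_INR|]. now apply wt_past_le.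
Qed.

Lemma past_range hs F B x : 0 <= B -> (forall y, (y < open_blk hs)%nat -> 0 <= F y <= B) -> 0 <= past hs F x <= B.
Proof.
  intros HB H. unfold past. destruct (Nat.ltb_spec x (open_blk hs)) as [Hx|Hx]; [now apply H|lra].
Qed.

(** At most [m] edges leave the open block and each multiplicity is at most [m]. This bound is what
    makes products with [tri_num] tractable later. *)
Lemma d_tri_bounds hs x : hist hs -> 0 <= d_tri hs x <= INR m ^ 2.
Proof.
  intros Hh. apply past_range; [apply pow_le, pos_INR|]. intros y Hy. split.
  - apply Sum_nonneg. intros; apply Rmult_le_pos; apply adj_nonneg.
  - apply Rle_trans with (Sum (open_blk hs) (fun z => INR m * adj hs (open_blk hs) z)).
    + apply Sum_le. intros z Hz. rewrite Rmult_comm. apply Rmult_le_compat_r; [apply adj_nonneg|].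
      apply hist_bounds; easy.
    + rewrite Sum_scal. replace (INR m ^ 2) with (INR m * INR m) by ring. apply Rmult_le_compat_l; [apply pos_INR|].
      destruct (hist_bounds hs Hh) as [_ [H _]]. pose proof (INR_mod_le (nv hs)). lra.
Qed.

Lemma wt_bound hs x : hist hs -> (x < open_blk hs)%nat -> wt hs x <= den (nv hs).
Proof.
  intros Hh Hx. eapply Rle_trans; [|apply wt_past_le; easy].
  apply (Sum_term (open_blk hs) (wt hs) x); [|easy]. intros; apply wt_nonneg; lra.
Qed.

Lemma tri_num_nonneg hs : 0 <= tri_num hs.
Proof. apply pos_INR. Qed.

Lemma sq_wt_nonneg hs : 0 <= sq_wt hs.
Proof. apply Sum_nonneg. intros. apply pow_le, wt_nonneg; lra. Qed.

Lemma cube_wt_nonneg hs : 0 <= cube_wt hs.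
Proof. apply Sum_nonneg. intros. apply pow_le, wt_nonneg; lra. Qed.

Lemma edge_wt_nonneg hs : 0 <= edge_wt hs.
Proof. apply Sum_nonneg. intros. apply Rmult_le_pos; [apply wt_nonneg; lra|apply nbr_nonneg]. Qed.

Lemma path_cur_nonneg hs : 0 <= path_cur hs.
Proof. apply Sum_nonneg. intros. apply Rmult_le_pos; [apply adj_nonneg|apply nbr_nonneg]. Qed.

Lemma nbr_cur_nonneg hs : 0 <= nbr_cur hs.
Proof. apply nbr_nonneg. Qed.

Lemma d_sq_wt_bounds hs x : hist hs -> 0 <= d_sq_wt hs x <= 2 * den (nv hs) + 1.
Proof.
  intros Hh. pose proof (den_pos (nv hs) (nv_pos hs)).
  apply past_range; [lra|]. intros y Hy.
  pose proof (wt_nonneg hs y). pose proof (wt_bound hs y Hh Hy). lra.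
Qed.

Lemma d_edge_wt_bounds hs x : hist hs -> 0 <= d_edge_wt hs x <= 2 * INR m * den (nv hs).
Proof.
  intros Hh. pose proof (den_pos (nv hs) (nv_pos hs)). pose proof (pos_INR m).
  apply past_range; [nra|]. intros y Hy.
  pose proof (nbr_nonneg (open_blk hs) hs y). pose proof (nbr_bound hs y Hh ltac:(lia)). lra.
Qed.

Lemma d_nbr_cur_bounds hs x : hist hs -> 0 <= d_nbr_cur hs x <= INR m + den (nv hs) + 1.
Proof.
  intros Hh. pose proof (den_pos (nv hs) (nv_pos hs)). pose proof (pos_INR m).
  apply past_range; [nra|]. intros y Hy.
  pose proof (adj_nonneg hs (open_blk hs) y). pose proof (adj_cur_bound hs y Hh Hy).
  pose proof (wt_nonneg hs y). pose proof (wt_bound hs y Hh Hy). lra.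
Qed.

Lemma d_path_cur_nonneg hs x : hist hs -> 0 <= d_path_cur hs x.
Proof.
  intros Hh. unfold d_path_cur. pose proof (d_tri_bounds hs x Hh). unfold past.
  pose proof (nbr_nonneg (open_blk hs) hs x). destruct (Nat.ltb x (open_blk hs)); lra.
Qed.

Lemma atcur_range hs x : 0 <= atcur hs x <= 1.
Proof. unfold atcur. destruct (Nat.eqb x (open_blk hs)); simpl; lra. Qed.

(** * First and second moments of the degree statistics *)

Definition exO (f : list nat -> R) (t : R) : Prop := bigO (fun k => Ex k f) t.

Lemma exO_plus f g t : exO f t -> exO g t -> exO (fun hs => f hs + g hs) t.
Proof.
  intros Hf Hg. apply (bigO_ext _ (fun k => Ex k f + Ex k g)).
  - intros k _. apply Ex_plus.
  - now apply bigO_plus.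
Qed.

Lemma exO_scal f a t : exO f t -> exO (fun hs => a * f hs) t.
Proof.
  intros Hf. apply (bigO_ext _ (fun k => a * Ex k f)).
  - intros k _. apply Ex_scal.
  - now apply bigO_scal.
Qed.

Lemma exO_weaken f s t : s <= t -> exO f s -> exO f t.
Proof. apply bigO_weaken. Qed.

Lemma exO_le f g t : (forall hs, hist hs -> 0 <= f hs <= g hs) -> exO g t -> exO f t.
Proof.
  intros H. apply bigO_le. intros k Hk. rewrite Rabs_right.
  - apply Ex_le; [easy|]. intros; now apply H.
  - apply Rle_ge, Ex_nonneg; [easy|]. intros; now apply H.
Qed.

Lemma exO_mult h f s t r : s + t = r -> bigO h s -> exO f t -> exO (fun hs => h (nv hs) * f hs) r.
Proof.
  intros E Hh Hf. apply (bigO_ext _ (fun k => h k * Ex k f)).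
  - intros k Hk. rewrite <- Ex_scal. apply Ex_ext; [easy|]. now intros hs _ ->.
  - now apply (bigO_mult _ _ s t).
Qed.

Lemma exO_fun h t : bigO h t -> exO (fun hs => h (nv hs)) t.
Proof.
  intros H. apply (bigO_ext _ h); [|easy]. intros k Hk. rewrite <- (Ex_const k (h k) Hk) at 1.
  apply Ex_ext; [easy|]. now intros hs _ ->.
Qed.

Lemma exO_const a t : 0 <= t -> exO (fun _ => a) t.
Proof. intros Ht. apply (exO_fun (fun _ => a)). now apply bigO_const. Qed.

Lemma Ex_abs k f : (1 <= k)%nat -> Rabs (Ex k f) <= Ex k (fun hs => Rabs (f hs)).
Proof.
  intros Hk. apply Rabs_le. split.
  - replace (- Ex k (fun hs => Rabs (f hs))) with (Ex k (fun hs => -1 * Rabs (f hs)))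
      by (rewrite Ex_scal; ring).
    apply Ex_le; [easy|]. intros hs _ _. pose proof (Rle_abs (- f hs)). rewrite Rabs_Ropp in *. lra.
  - apply Ex_le; [easy|]. intros hs _ _. apply Rle_abs.
Qed.

Lemma exO_growth f s a t k0 :
  0 <= a -> a < t -> (forall hs, hist hs -> 0 <= f hs) ->
  (forall hs, hist hs -> (k0 <= nv hs)%nat -> exists F,
     (forall v, (1 <= v <= nv hs)%nat -> f (hs ++ [v]) <= F (blk m v)) /\
     tgt hs F <= (1 + a / INR (nv hs)) * f hs + s hs) ->
  exO s (t - 1) -> exO f t.
Proof.
  intros Ha Hat Hf Hstep Hs. apply (bigO_growth _ (fun k => Ex k s) a t k0 Ha Hat).
  - intros k Hk. apply Ex_nonneg; [easy|]. intros; now apply Hf.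
  - intros k Hk0 Hk. rewrite <- Ex_scal, <- Ex_plus. apply Ex_step_le; [easy|].
    intros hs Hh E. subst k. now apply Hstep.
  - exact Hs.
Qed.

Lemma exO_reset f s L t :
  0 <= L -> (forall hs, hist hs -> 0 <= f hs) ->
  (forall hs, hist hs -> (nv hs mod m = 0)%nat -> (1 < nv hs)%nat -> f hs = 0) ->
  (forall hs, hist hs -> (S (nv hs mod m) < m)%nat -> exists F,
     (forall v, (1 <= v <= nv hs)%nat -> f (hs ++ [v]) <= F (blk m v)) /\
     tgt hs F <= L * f hs + s hs) ->
  exO s t -> exO f t.
Proof.
  intros HL Hf H0 Hstep Hs. apply (bigO_reset m _ (fun k => Ex k s) L t Hm HL).
  - intros k Hk. apply Ex_nonneg; [easy|]. intros; now apply Hf.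
  - intros k Hk E. rewrite <- (Ex_const (S k) 0) by lia. apply Ex_ext; [lia|].
    intros hs Hh En. apply H0; [easy|now rewrite En|lia].
  - intros k Hk E. rewrite <- Ex_scal, <- Ex_plus. apply Ex_step_le; [easy|].
    intros hs Hh En. subst k. apply Hstep; [easy|].
    destruct (mod_S_cases m (nv hs) Hm) as [[_ [_ H]]|[H _]]; lia.
  - exact Hs.
Qed.

(** This is [2 / (2 + beta / 2)]: above the limiting rate [2 / (2 + beta)] and still below 1. Giving
    up half of [beta] absorbs the [- 2] in [den] for large [k]. *)
Definition drift : R := 4 / (4 + beta).

Lemma drift_range : 0 < drift < 1.
Proof.
  unfold drift. split; [apply Rdiv_lt_0_compat; lra|].
  apply Rmult_lt_reg_r with (4 + beta); [lra|]. unfold Rdiv. rewrite Rmult_assoc, Rinv_l; lra.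
Qed.

Lemma inv_den_upper k : (1 <= k)%nat -> 0 < / den k <= / beta * / INR k.
Proof.
  intros Hk. pose proof (den_pos k Hk). pose proof (den_lower k Hk). pose proof (INR_ge1 k Hk).
  split; [now apply Rinv_0_lt_compat|]. rewrite <- Rinv_mult.
  apply Rinv_le_contravar; [nra|easy].
Qed.

Lemma inv_den_rate : exists k0, forall k, (k0 <= k)%nat -> (1 <= k)%nat -> / den k <= drift / 2 / INR k.
Proof.
  destruct (exists_nat_ge (4 / beta)) as [k0 H0]. exists k0. intros k Hk Hk1. specialize (H0 k Hk).
  pose proof (INR_ge1 k Hk1).
  assert (Hb : 4 <= beta * INR k).
  { apply Rmult_le_compat_l with (r := beta) in H0; [|lra].
    replace (beta * (4 / beta)) with 4 in H0 by (field; lra). easy. }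
  replace (drift / 2 / INR k) with (/ ((2 + beta / 2) * INR k)) by (unfold drift; field; lra).
  apply Rinv_le_contravar; [nra|]. unfold den. nra.
Qed.

Lemma bigO_inv_den : bigO (fun k => / den k) (-1).
Proof.
  apply (bigO_le _ (fun k => / beta * / INR k)).
  - intros k Hk. destruct (inv_den_upper k Hk). rewrite Rabs_right; lra.
  - apply bigO_scal, bigO_inv.
Qed.

Lemma exO_div_den f s t : s - 1 = t -> exO f s -> exO (fun hs => f hs / den (nv hs)) t.
Proof.
  intros E Hf. apply (bigO_ext _ (fun k => Ex k (fun hs => / den (nv hs) * f hs))).
  - intros k Hk. apply Ex_ext; [easy|]. intros; unfold Rdiv; ring.
  - apply (exO_mult (fun k => / den k) f (-1) s); [lra|apply bigO_inv_den|easy].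
Qed.

(** Bound for the weight of the open block after one more vertex, hence for the weight with which a
    block closes. *)
Definition wmax : R := (2 + beta) * INR m + (2 + beta).

Lemma wmax_pos : 0 < wmax.
Proof. unfold wmax. pose proof (pos_INR m). nra. Qed.

Lemma wt_cur_next_bounds hs x : hist hs -> 0 <= wt_cur hs + d_wt_cur hs x <= wmax.
Proof.
  intros Hh. pose proof (wt_cur_bounds hs Hh). pose proof (atcur_range hs x). unfold d_wt_cur, wmax. lra.
Qed.

Lemma rate_bound c k r y : 0 <= c -> 0 <= y -> (1 <= k)%nat -> / den k <= r / INR k ->
  c * y / den k <= c * r / INR k * y.
Proof.
  intros Hc Hy Hk H. unfold Rdiv in *.
  replace (c * r * / INR k * y) with (c * y * (r * / INR k)) by ring.
  apply Rmult_le_compat_l; [nra|easy].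
Qed.

Lemma sq_wt_exO : exO sq_wt 1.
Proof.
  destruct inv_den_rate as [k0 Hk0]. pose proof drift_range as Ha.
  apply (exO_growth sq_wt (fun _ => 1 + wmax ^ 2) drift 1 k0); try lra.
  - intros. apply sq_wt_nonneg.
  - intros hs Hh Hk. exists (fun x => sq_wt hs + d_sq_wt hs x + wmax ^ 2). split.
    + intros v Hv. pose proof (wt_cur_next_bounds hs (blk m v) Hh).
      destruct (state_step hs v Hh Hv) as [[_ [_ [_ [_ [_ [-> _]]]]]]|[_ [_ [_ [_ [_ [-> _]]]]]]]; nra.
    + rewrite !tgt_plus, !tgt_const, tgt_d_sq_wt by easy.
      pose proof (nv_pos hs) as Hp. pose proof (den_pos (nv hs) Hp).
      pose proof (rate_bound 2 (nv hs) (drift / 2) (sq_wt hs) ltac:(lra) (sq_wt_nonneg hs) Hp (Hk0 _ Hk Hp)).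
      pose proof (wt_cur_bounds hs Hh). destruct (inv_den_upper (nv hs) Hp).
      replace ((2 * sq_wt hs + den (nv hs) - wt_cur hs) / den (nv hs))
        with (2 * sq_wt hs / den (nv hs) + 1 - wt_cur hs * / den (nv hs)) by (field; lra).
      replace (2 * (drift / 2)) with drift in * by field. nra.
  - apply exO_const. lra.
Qed.

(** The rate [3 * (drift / 2)] is below 3/2, so 7/4 dominates it; what matters is an exponent below
    2. *)
Lemma cube_wt_exO : exO cube_wt (7 / 4).
Proof.
  destruct inv_den_rate as [k0 Hk0]. pose proof drift_range as Ha.
  apply (exO_growth cube_wt (fun hs => 3 * (sq_wt hs / den (nv hs)) + (1 + wmax ^ 3)) (3 * (drift / 2)) (7 / 4) k0); try lra.
  - intros. apply cube_wt_nonneg.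
  - intros hs Hh Hk. exists (fun x => cube_wt hs + d_cube_wt hs x + wmax ^ 3). split.
    + intros v Hv. pose proof (wt_cur_next_bounds hs (blk m v) Hh) as [Hw1 Hw2].
      pose proof (pow_incr _ _ 3 (conj Hw1 Hw2)). pose proof (pow_le _ 3 Hw1).
      destruct (state_step hs v Hh Hv) as [[_ [_ [_ [_ [_ [_ [-> _]]]]]]]|[_ [_ [_ [_ [_ [_ [-> _]]]]]]]]; lra.
    + rewrite !tgt_plus, !tgt_const, tgt_d_cube_wt by easy.
      pose proof (nv_pos hs) as Hp. pose proof (den_pos (nv hs) Hp).
      pose proof (rate_bound 3 (nv hs) (drift / 2) (cube_wt hs) ltac:(lra) (cube_wt_nonneg hs) Hp (Hk0 _ Hk Hp)).
      pose proof (wt_cur_bounds hs Hh). destruct (inv_den_upper (nv hs) Hp).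
      replace ((3 * cube_wt hs + 3 * sq_wt hs + den (nv hs) - wt_cur hs) / den (nv hs))
        with (3 * cube_wt hs / den (nv hs) + 3 * (sq_wt hs / den (nv hs)) + 1 - wt_cur hs * / den (nv hs)) by (field; lra).
      nra.
  - apply exO_plus; [|apply exO_const; lra]. apply exO_scal.
    apply (exO_div_den _ (7/4)); [lra|]. apply (exO_weaken _ 1); [lra|apply sq_wt_exO].
Qed.

Lemma INR_S_mod hs v : (nv (hs ++ [v]) mod m = S (nv hs mod m))%nat ->
  INR (nv (hs ++ [v]) mod m) = INR (nv hs mod m) + 1.
Proof. intros ->. apply S_INR. Qed.

(** A loop appears with probability [wt_cur / den], which is O(1/k), and the count is bounded and
    restarts with each block. *)
Lemma loops2_exO : exO (fun hs => loops hs ^ 2) (-1).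
Proof.
  pose proof (pos_INR m).
  apply (exO_reset _ (fun hs => (2 * INR m + 1) * wmax / den (nv hs)) 1 (-1)); try lra.
  - intros. apply pow2_ge_0.
  - intros hs Hh E Hn. unfold loops. rewrite E. simpl INR.
    destruct Hh as [|hs v Hh Hv]; [unfold nv in Hn; simpl in Hn; lia|].
    destruct (state_step hs v Hh Hv) as [[E' _]|[_ [_ [-> _]]]]; [lia|ring].
  - intros hs Hh Hr. exists (fun x => loops hs ^ 2 + (2 * INR m + 1) * atcur hs x). split.
    + intros v Hv. unfold loops at 1.
      destruct (state_step hs v Hh Hv) as [[E [_ [-> _]]]|[_ [E _]]]; [|lia].
      rewrite (INR_S_mod hs v E). pose proof (loops_bounds hs Hh). unfold d_wt_cur.
      replace (wt_cur hs + (1 + beta + atcur hs (blk m v)) - (1 + beta) * (INR (nv hs mod m) + 1))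
        with (loops hs + atcur hs (blk m v)) by (unfold loops; ring).
      unfold atcur. destruct (Nat.eqb _ _); simpl; nra.
    + rewrite tgt_plus, tgt_scal, tgt_const, tgt_atcur by easy.
      pose proof (wt_cur_next_bounds hs O Hh). pose proof (wt_cur_bounds hs Hh).
      destruct (inv_den_upper (nv hs) (nv_pos hs)).
      assert (wt_cur hs <= wmax) by (unfold wmax; lra).
      assert (wt_cur hs / den (nv hs) <= wmax / den (nv hs)) by (unfold Rdiv; nra).
      unfold Rdiv in *. nra.
  - apply (exO_div_den _ 0); [lra|]. apply exO_const. lra.
Qed.

(* Per tree vertex, the sum of squared weights grows by [q_lim], the weighted edge sum by
   [w_lim] (below), and [nbr_cur] grows by [u_lim] per vertex of the open block: these are the fixed
   points of the mean recursions. *)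
Definition q_lim : R := (2 + beta) * (INR m * (1 + beta) ^ 2 + 1) / beta.
Definition per (k : nat) : R := INR (k mod m) * (INR m - INR (k mod m)).

Lemma per_bound k : 0 <= per k <= INR m ^ 2.
Proof. unfold per. pose proof (INR_mod_le k). pose proof (pos_INR (k mod m)). nra. Qed.

Lemma per_S k : per (S k) = per k + (INR m - 2 * INR (k mod m) - 1).
Proof.
  unfold per. destruct (mod_S_cases m k Hm) as [[-> _]|[-> [_ E]]].
  - rewrite S_INR. ring.
  - simpl (INR 0).
    assert (INR m = INR (k mod m) + 1) by (rewrite <- S_INR, E; easy). rewrite H. ring.
Qed.

(* [per] makes the fluctuation insensitive to the position inside the current block. *)
Definition sq_dev hs : R :=
  sq_wt hs + wt_cur hs ^ 2 + (1 + beta) ^ 2 * per (nv hs) - q_lim * INR (nv hs).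

Definition d_sq_dev hs x : R :=
  d_sq_wt hs x + 2 * wt_cur hs * d_wt_cur hs x + d_wt_cur hs x ^ 2
  + (1 + beta) ^ 2 * (INR m - 2 * INR (nv hs mod m) - 1) - q_lim.

Lemma sq_dev_step hs v : hist hs -> (1 <= v <= nv hs)%nat -> sq_dev (hs ++ [v]) = sq_dev hs + d_sq_dev hs (blk m v).
Proof.
  intros Hh Hv. unfold sq_dev, d_sq_dev. rewrite nv_snoc, per_S, S_INR.
  destruct (state_step hs v Hh Hv) as [[_ [_ [-> [_ [_ [-> _]]]]]]|[_ [_ [-> [_ [_ [-> _]]]]]]]; ring.
Qed.

Lemma d_wt_cur_sq hs x : d_wt_cur hs x ^ 2 = (1 + beta) ^ 2 + (3 + 2 * beta) * atcur hs x.
Proof. unfold d_wt_cur, atcur. destruct (Nat.eqb _ _); simpl; ring. Qed.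

(** Two cancellations leave no term of order 1 except [loops]: the step of [per] cancels the
    dependence of [2 * (1 + beta) * wt_cur] on [k mod m], and [q_lim] solves [q = 2 * q / (2 + beta)
    + 1 + (1 + beta)^2 * m], where the last term is the squared weight of a closing block spread
    over its [m] vertices. *)
Lemma tgt_d_sq_dev hs : hist hs -> exists r, Rabs r <= 3 * wmax ^ 2 + (1 + beta) ^ 2 * INR m ^ 2 * 2 + 4 * q_lim + 5 * wmax * wmax /\
  tgt hs (d_sq_dev hs) = 2 * sq_dev hs / den (nv hs) + 2 * (1 + beta) * loops hs + r / den (nv hs).
Proof.
  intros Hh. pose proof (den_pos (nv hs) (nv_pos hs)) as Hd.
  assert (E : tgt hs (d_sq_dev hs) = (2 * sq_wt hs + den (nv hs) - wt_cur hs) / den (nv hs)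
    + (2 * wt_cur hs * (1 + beta + wt_cur hs / den (nv hs)) + ((1 + beta) ^ 2 + (3 + 2 * beta) * (wt_cur hs / den (nv hs)))
    + ((1 + beta) ^ 2 * (INR m - 2 * INR (nv hs mod m) - 1) - q_lim))).
  { rewrite <- tgt_d_sq_wt, <- tgt_d_wt_cur, <- (tgt_atcur hs), <- tgt_scal, <- tgt_scal by easy.
    rewrite <- (tgt_const hs ((1 + beta) ^ 2) Hh) at 1.
    rewrite <- (tgt_const hs ((1 + beta) ^ 2 * (INR m - 2 * INR (nv hs mod m) - 1) - q_lim) Hh) at 1.
    rewrite <- !tgt_plus. apply tgt_ext. intros x _. unfold d_sq_dev. rewrite d_wt_cur_sq. ring. }
  exists (- 2 * wt_cur hs ^ 2 - 2 * ((1 + beta) ^ 2 * per (nv hs)) + 4 / (2 + beta) * q_lim - wt_cur hs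
     + 2 * wt_cur hs ^ 2 + (3 + 2 * beta) * wt_cur hs).
  split.
  - pose proof (wt_cur_bounds hs Hh). pose proof (per_bound (nv hs)).
    assert (Hw : wt_cur hs <= wmax) by (unfold wmax; lra).
    assert (Hw2 : 3 + 2 * beta <= 3 * wmax) by (unfold wmax; pose proof (INR_ge1 m Hm); nra).
    assert (Hw3 : 1 <= wmax) by (unfold wmax; pose proof (pos_INR m); nra).
    assert (Hq : 0 <= q_lim).
    { unfold q_lim. apply Rmult_le_pos; [|left; now apply Rinv_0_lt_compat].
      pose proof (pos_INR m). pose proof (pow2_ge_0 (1 + beta)). nra. }
    assert (H4 : 0 <= 4 / (2 + beta) <= 4).
    { split; [left; apply Rdiv_lt_0_compat; lra|].
      apply Rmult_le_reg_r with (2 + beta); [lra|]. unfold Rdiv. rewrite Rmult_assoc, Rinv_l; lra. }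
    assert (0 <= (1 + beta) ^ 2 * per (nv hs) <= (1 + beta) ^ 2 * INR m ^ 2).
    { pose proof (pow2_ge_0 (1 + beta)). split; nra. }
    assert (0 <= 4 / (2 + beta) * q_lim <= 4 * q_lim) by nra.
    assert (0 <= wt_cur hs ^ 2 <= wmax ^ 2) by nra.
    assert (0 <= (3 + 2 * beta) * wt_cur hs <= 3 * wmax * wmax) by nra.
    assert (wt_cur hs <= wmax * wmax) by nra.
    apply Rabs_le. simpl in *. split; lra.
  - rewrite E. unfold sq_dev, loops.
    set (D := den (nv hs)) in *. set (k := INR (nv hs)).
    assert (Ek : k = (D + 2) / (2 + beta)) by (unfold D, den, k; field; lra).
    fold k. rewrite Ek. unfold q_lim. field. lra.
Qed.

Lemma exO_abs f t : exO (fun hs => Rabs (f hs)) t -> exO f t.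
Proof. apply bigO_le. intros k Hk. now apply Ex_abs. Qed.

Lemma exO_abs_le f g t : (forall hs, hist hs -> Rabs (f hs) <= g hs) -> exO g t -> exO f t.
Proof.
  intros H Hg. apply exO_abs. apply (exO_le _ g); [|easy]. intros hs Hh.
  split; [apply Rabs_pos|now apply H].
Qed.

Lemma exO_ext f g t : (forall hs, hist hs -> f hs = g hs) -> exO g t -> exO f t.
Proof. intros H. apply bigO_ext. intros k Hk. apply Ex_ext; [easy|]. intros; now apply H. Qed.

(** For a signed [f] with an exact linear mean step, [|E f|] obeys the growth recursion. Only the
    mean of the source enters, so no second moment of [f] is required. *)
Lemma exO_growth_eq f e c a t k0 :
  0 <= a -> a < t -> (forall k, (1 <= k)%nat -> 0 <= c k) ->
  (forall k, (k0 <= k)%nat -> (1 <= k)%nat -> c k <= a / INR k) ->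
  (forall hs, hist hs -> exists F,
     (forall v, (1 <= v <= nv hs)%nat -> f (hs ++ [v]) = F (blk m v)) /\
     tgt hs F = (1 + c (nv hs)) * f hs + e hs) ->
  exO e (t - 1) -> exO f t.
Proof.
  intros Ha Hat Hc Hca Hstep He.
  cut (bigO (fun k => Rabs (Ex k f)) t).
  { apply bigO_le. intros; lra. }
  apply (bigO_growth _ (fun k => Rabs (Ex k e)) a t k0 Ha Hat).
  - intros; apply Rabs_pos.
  - intros k Hk0 Hk.
    rewrite (Ex_step_eq k f (fun hs => (1 + c k) * f hs + e hs) Hk), Ex_plus, Ex_scal.
    2:{ intros hs Hh <-. now apply Hstep. }
    eapply Rle_trans; [apply Rabs_triang|]. apply Rplus_le_compat_r.
    specialize (Hc k Hk). specialize (Hca k Hk0 Hk).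
    rewrite Rabs_mult, (Rabs_right (1 + c k)) by lra.
    apply Rmult_le_compat_r; [apply Rabs_pos|lra].
  - apply (bigO_le _ (fun k => Rabs (Ex k e))); [intros; rewrite Rabs_Rabsolu; lra|].
    destruct He as [K HK]. exists K. intros k Hk. rewrite Rabs_Rabsolu. now apply HK.
Qed.

Lemma exO_reset_eq f e c L t :
  0 <= L -> (forall k, (1 <= k)%nat -> 0 <= c k <= L) ->
  (forall hs, hist hs -> (nv hs mod m = 0)%nat -> (1 < nv hs)%nat -> f hs = 0) ->
  (forall hs, hist hs -> (S (nv hs mod m) < m)%nat -> exists F,
     (forall v, (1 <= v <= nv hs)%nat -> f (hs ++ [v]) = F (blk m v)) /\
     tgt hs F = (1 + c (nv hs)) * f hs + e hs) ->
  exO e t -> exO f t.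
Proof.
  intros HL Hc H0 Hstep He.
  cut (bigO (fun k => Rabs (Ex k f)) t).
  { apply bigO_le. intros; lra. }
  apply (bigO_reset m _ (fun k => Rabs (Ex k e)) (1 + L) t Hm); [lra|intros; apply Rabs_pos| | |].
  - intros k Hk E.
    replace (Ex (S k) f) with (Ex (S k) (fun _ => 0)).
    { rewrite Ex_const, Rabs_R0 by lia. easy. }
    apply Ex_ext; [lia|]. intros hs Hh En. symmetry. apply H0; [easy|now rewrite En|lia].
  - intros k Hk E.
    rewrite (Ex_step_eq k f (fun hs => (1 + c k) * f hs + e hs) Hk), Ex_plus, Ex_scal.
    2:{ intros hs Hh <-. apply Hstep; [easy|].
        destruct (mod_S_cases m (nv hs) Hm) as [[_ [_ H]]|[H _]]; lia. }
    eapply Rle_trans; [apply Rabs_triang|]. apply Rplus_le_compat_r.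
    specialize (Hc k Hk).
    rewrite Rabs_mult, (Rabs_right (1 + c k)) by lra.
    apply Rmult_le_compat_r; [apply Rabs_pos|lra].
  - destruct He as [K HK]. exists K. intros k Hk. rewrite Rabs_Rabsolu. now apply HK.
Qed.

(* [2 - 2 * gap] must exceed the growth exponent [2 * drift] of the second moment of [sq_dev] and the
   order 7/4 of [cube_wt], which is k times the conditional variance of a step. *)
Definition gap : R := Rmin (beta / (4 + beta)) (1 / 8) / 2.

Lemma gap_range : 0 < gap /\ gap <= 1 / 16 /\ drift <= 1 - 2 * gap.
Proof.
  assert (H : 0 < beta / (4 + beta)) by (apply Rdiv_lt_0_compat; lra).
  assert (E : drift = 1 - beta / (4 + beta)) by (unfold drift; field; lra).
  unfold gap. pose proof (Rmin_l (beta / (4 + beta)) (1 / 8)).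
  pose proof (Rmin_r (beta / (4 + beta)) (1 / 8)).
  pose proof (Rmin_glb_lt (beta / (4 + beta)) (1 / 8) 0 H ltac:(lra)). lra.
Qed.

(** The target is size-biased, so the squared increment [(2 w + 1)^2] picks up another factor [w]:
    this is where third powers of the weights come in. *)
Lemma tgt_d_sq_wt_sq hs : hist hs ->
  tgt hs (fun x => d_sq_wt hs x ^ 2) <= 4 * (cube_wt hs / den (nv hs)) + 4 * (sq_wt hs / den (nv hs)) + 1.
Proof.
  intros Hh. pose proof (den_pos (nv hs) (nv_pos hs)) as Hd.
  rewrite (tgt_ext _ _ (past hs (fun x => (2 * wt hs x + 1) ^ 2))).
  2:{ intros x _. unfold d_sq_wt, past. destruct (Nat.ltb _ _); ring. }
  rewrite tgt_past.
  rewrite (Sum_ext _ _ (fun x => 4 * wt hs x ^ 3 + (4 * wt hs x ^ 2 + wt hs x))) by (intros; ring).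
  rewrite !Sum_plus, !Sum_scal. fold (pow_sum 3 (open_blk hs) hs) (pow_sum 2 (open_blk hs) hs) (sq_wt hs) (cube_wt hs).
  pose proof (wt_past_le hs Hh).
  assert (Sum (open_blk hs) (wt hs) / den (nv hs) <= 1).
  { apply Rmult_le_reg_r with (den (nv hs)); [easy|]. unfold Rdiv. rewrite Rmult_assoc, Rinv_l; lra. }
  replace ((4 * cube_wt hs + (4 * sq_wt hs + Sum (open_blk hs) (wt hs))) / den (nv hs))
    with (4 * (cube_wt hs / den (nv hs)) + 4 * (sq_wt hs / den (nv hs)) + Sum (open_blk hs) (wt hs) / den (nv hs))
    by (field; lra). lra.
Qed.

Lemma young a b eta : 0 < eta -> 2 * a * b <= eta * a ^ 2 + b ^ 2 / eta.
Proof.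
  intros He. pose proof (pow2_ge_0 (eta * a - b)).
  assert (0 < / eta) by now apply Rinv_0_lt_compat.
  replace (eta * a ^ 2 + b ^ 2 / eta) with (2 * a * b + (eta * a - b) ^ 2 * / eta) by (field; lra). nra.
Qed.

(** In the step of the square, the restoring part of the cross term has rate [4 / den], and the
    squared increment is controlled by [cube_wt / den] up to bounded and lower order terms. The
    cross terms with [loops] and with the bounded remainder are split by Young's inequality; the
    former leaves [k * loops^2], of order 0 in mean. *)
Lemma sq_dev_sq_exO : exO (fun hs => sq_dev hs ^ 2) (2 - 2 * gap).
Proof.
  destruct gap_range as [Hd1 [Hd2 Hd3]]. pose proof drift_range as Ha.
  destruct inv_den_rate as [k0 Hk0].
  set (CX := 3 * wmax ^ 2 + (1 + beta) ^ 2 * INR m ^ 2 * 2 + 4 * q_lim + 5 * wmax * wmax).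
  (* [CR] bounds [d_sq_dev - d_sq_wt]: only [d_sq_wt] can be large in a single step. *)
  set (CR := 3 * wmax ^ 2 + (1 + beta) ^ 2 * (3 * INR m + 1) + Rabs q_lim).
  (* Each of the two uses of Young's inequality costs [et / k] times the square; together they make
     the extra [gap] in the rate [2 * drift + gap]. *)
  set (et := gap / 2). assert (Het : 0 < et) by (unfold et; lra).
  apply (exO_growth _ (fun hs => 4 * (1 + beta) ^ 2 / et * (INR (nv hs) * loops hs ^ 2)
     + (8 * (cube_wt hs / den (nv hs)) + (8 * (sq_wt hs / den (nv hs))
     + (2 + CX ^ 2 / (et * beta ^ 2) + 2 * CR ^ 2)))) (2 * drift + gap) (2 - 2 * gap) k0); try lra.
  - intros. apply pow2_ge_0.
  - intros hs Hh Hk.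
    exists (fun x => sq_dev hs ^ 2 + ((2 * sq_dev hs) * d_sq_dev hs x + (2 * d_sq_wt hs x ^ 2 + 2 * CR ^ 2))). split.
    + intros v Hv. rewrite sq_dev_step by easy. set (x := blk m v).
      assert (Hr : Rabs (d_sq_dev hs x - d_sq_wt hs x) <= CR).
      { unfold d_sq_dev, CR. pose proof (wt_cur_bounds hs Hh). pose proof (atcur_range hs x).
        pose proof (INR_mod_le (nv hs)). pose proof (pos_INR (nv hs mod m)).
        assert (0 <= d_wt_cur hs x <= wmax) by (unfold d_wt_cur, wmax in *; pose proof (INR_ge1 m Hm); nra).
        assert (wt_cur hs <= wmax) by (unfold wmax; lra).
        assert (0 <= wt_cur hs * d_wt_cur hs x <= wmax ^ 2) by nra.
        assert (0 <= d_wt_cur hs x ^ 2 <= wmax ^ 2) by nra.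
        pose proof (Rle_abs q_lim). pose proof (Rle_abs (- q_lim)). rewrite Rabs_Ropp in *.
        pose proof (pow2_ge_0 (1 + beta)).
        set (b2 := (1 + beta) ^ 2) in *.
        set (y := INR m - 2 * INR (nv hs mod m) - 1).
        assert (- (3 * INR m + 1) <= y <= 3 * INR m + 1) by (unfold y; lra).
        assert (- (b2 * (3 * INR m + 1)) <= b2 * y <= b2 * (3 * INR m + 1)) by nra.
        apply Rabs_le. lra. }
      assert (HCR : (d_sq_dev hs x - d_sq_wt hs x) ^ 2 <= CR ^ 2).
      { rewrite <- (pow2_abs (d_sq_dev hs x - d_sq_wt hs x)). apply pow_incr. split; [apply Rabs_pos|easy]. }
      pose proof (pow2_ge_0 (2 * d_sq_wt hs x - d_sq_dev hs x)).
      assert (d_sq_dev hs x ^ 2 <= 2 * d_sq_wt hs x ^ 2 + 2 * CR ^ 2) by nra. nra.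
    + rewrite !tgt_plus, !tgt_const, !tgt_scal by easy.
      destruct (tgt_d_sq_dev hs Hh) as [r [Hr ->]]. fold CX in Hr.
      pose proof (tgt_d_sq_wt_sq hs Hh). pose proof (nv_pos hs) as Hp.
      pose proof (den_pos (nv hs) Hp) as HD. pose proof (INR_ge1 (nv hs) Hp) as Hk1.
      pose proof (pow2_ge_0 (sq_dev hs)) as HX2.
      pose proof (rate_bound 4 (nv hs) (drift / 2) (sq_dev hs ^ 2) ltac:(lra) HX2 Hp (Hk0 _ Hk Hp)) as HA.
      destruct (inv_den_upper (nv hs) Hp) as [Hi1 Hi2].
      set (k := INR (nv hs)) in *. set (D := den (nv hs)) in *.
      pose proof (young (sq_dev hs) (2 * (1 + beta) * loops hs) (et / k) ltac:(apply Rdiv_lt_0_compat; lra)) as Y1.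
      pose proof (young (sq_dev hs) (r / D) (et / k) ltac:(apply Rdiv_lt_0_compat; lra)) as Y2.
      assert (Hr2 : (r / D) ^ 2 / (et / k) <= CX ^ 2 / (et * beta ^ 2)).
      { assert (r ^ 2 <= CX ^ 2) by (rewrite <- (pow2_abs r); apply pow_incr; split; [apply Rabs_pos|easy]).
        assert (Hib : 0 < / beta) by now apply Rinv_0_lt_compat.
        assert (Hik : 0 < / k) by (apply Rinv_0_lt_compat; lra).
        assert (/ D * k <= / beta).
        { apply Rmult_le_compat_r with (r := k) in Hi2; [|lra].
          rewrite Rmult_assoc, Rinv_l, Rmult_1_r in Hi2; lra. }
        assert (/ k <= 1) by (rewrite <- Rinv_1; apply Rinv_le_contravar; lra).
        assert (/ D <= / beta) by nra.
        assert (Hie : 0 < / et) by now apply Rinv_0_lt_compat.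
        replace ((r / D) ^ 2 / (et / k)) with (r ^ 2 * (/ D * (/ D * k)) * / et) by (field; lra).
        replace (CX ^ 2 / (et * beta ^ 2)) with (CX ^ 2 * (/ beta * / beta) * / et) by (field; lra).
        apply Rmult_le_compat_r; [lra|]. pose proof (pow2_ge_0 r).
        assert (0 <= / D * k) by nra.
        apply Rmult_le_compat; try nra. }
      replace ((2 * (1 + beta) * loops hs) ^ 2 / (et / k))
        with (4 * (1 + beta) ^ 2 / et * (k * loops hs ^ 2)) in Y1 by (field; lra).
      replace (2 * sq_dev hs * (2 * sq_dev hs / D + 2 * (1 + beta) * loops hs + r / D))
        with (4 * sq_dev hs ^ 2 / D + 2 * sq_dev hs * (2 * (1 + beta) * loops hs) + 2 * sq_dev hs * (r / D)) by (field; lra).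
      replace ((1 + (2 * drift + gap) / k) * sq_dev hs ^ 2)
        with (sq_dev hs ^ 2 + 4 * (drift / 2) / k * sq_dev hs ^ 2 + 2 * (et / k * sq_dev hs ^ 2)) by (unfold et; field; lra).
      lra.
  - apply (exO_weaken _ (3 / 4)); [lra|].
    apply exO_plus; [|apply exO_plus; [|apply exO_plus; [|apply exO_const; lra]]].
    + apply exO_scal. apply (exO_weaken _ 0); [lra|].
      apply (exO_mult (fun k => INR k) (fun hs => loops hs ^ 2) 1 (-1)); [lra|apply bigO_id|apply loops2_exO].
    + apply exO_scal. apply (exO_div_den _ (7 / 4)); [lra|apply cube_wt_exO].
    + apply exO_scal. apply (exO_weaken _ 0); [lra|]. apply (exO_div_den _ 1); [lra|apply sq_wt_exO].
Qed.

(** Cauchy-Schwarz at the level of orders, obtained from Young's inequality with the deterministic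
    weight [k^(s/2)]. *)
Lemma exO_sqrt f s t : t = s / 2 -> exO (fun hs => f hs ^ 2) s -> exO (fun hs => Rabs (f hs)) t.
Proof.
  intros -> H.
  apply (exO_le _ (fun hs => / 2 * (pw (nv hs) (- (s / 2)) * f hs ^ 2 + pw (nv hs) (s / 2)))).
  - intros hs Hh. split; [apply Rabs_pos|].
    pose proof (young 1 (Rabs (f hs)) (pw (nv hs) (s / 2)) (pw_pos _ _)) as Y.
    rewrite pow2_abs in Y. unfold Rdiv in Y at 2.
    replace (/ pw (nv hs) (s / 2)) with (pw (nv hs) (- (s / 2))) in Y by apply Rpower_Ropp. lra.
  - apply exO_scal, exO_plus.
    + apply (exO_mult (fun k => pw k (- (s / 2))) (fun hs => f hs ^ 2) (- (s / 2)) s);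
        [field|apply bigO_pw|easy].
    + apply (exO_fun (fun k => pw k (s / 2))), bigO_pw.
Qed.

Lemma sq_dev_abs_exO : exO (fun hs => Rabs (sq_dev hs)) (1 - gap).
Proof. apply (exO_sqrt _ (2 - 2 * gap)); [field|apply sq_dev_sq_exO]. Qed.

Lemma sq_dev_exO : exO sq_dev (1 - gap).
Proof. apply exO_abs, sq_dev_abs_exO. Qed.

Lemma loops_abs_exO : exO (fun hs => Rabs (loops hs)) (- gap).
Proof.
  destruct gap_range as [Hd1 [Hd2 Hd3]].
  apply (exO_weaken _ (-1 / 2)); [lra|]. apply (exO_sqrt _ (-1)); [field|apply loops2_exO].
Qed.

(** Limiting mean weight of a closed target block, including the half-edge that it has just
    gained. *)
Definition u_lim : R := q_lim / (2 + beta) + 1.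

Definition sq_err hs : R :=
  - wt_cur hs ^ 2 - (1 + beta) ^ 2 * per (nv hs) + 2 * q_lim / (2 + beta) - wt_cur hs.

Lemma q_lim_pos : 0 < q_lim.
Proof.
  unfold q_lim. pose proof (pos_INR m). pose proof (pow2_ge_0 (1 + beta)).
  apply Rdiv_lt_0_compat; [apply Rmult_lt_0_compat; nra|easy].
Qed.

Lemma sq_err_bound hs : hist hs ->
  Rabs (sq_err hs) <= wmax ^ 2 + (1 + beta) ^ 2 * INR m ^ 2 + 2 * q_lim + wmax.
Proof.
  intros Hh. unfold sq_err. pose proof (wt_cur_bounds hs Hh). pose proof (per_bound (nv hs)).
  assert (wt_cur hs <= wmax) by (unfold wmax; lra). pose proof q_lim_pos. pose proof (pow2_ge_0 (1 + beta)).
  assert (0 < 2 * q_lim / (2 + beta) <= 2 * q_lim).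
  { split; [apply Rdiv_lt_0_compat; lra|]. apply Rmult_le_reg_r with (2 + beta); [lra|].
    unfold Rdiv. rewrite Rmult_assoc, Rinv_l; nra. }
  assert (0 <= (1 + beta) ^ 2 * per (nv hs) <= (1 + beta) ^ 2 * INR m ^ 2) by (split; nra).
  assert (0 <= wt_cur hs ^ 2 <= wmax ^ 2) by nra.
  apply Rabs_le. lra.
Qed.

Lemma sq_mean hs : (sq_wt hs + den (nv hs) - wt_cur hs) / den (nv hs) = u_lim + (sq_dev hs + sq_err hs) / den (nv hs).
Proof.
  pose proof (den_pos (nv hs) (nv_pos hs)) as Hd. unfold sq_dev, sq_err, u_lim.
  replace (INR (nv hs)) with ((den (nv hs) + 2) / (2 + beta)) by (unfold den; field; lra).
  field. lra.
Qed.

Lemma exO_bounded f B : (forall hs, hist hs -> Rabs (f hs) <= B) -> exO f 0.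
Proof. intros H. apply (exO_abs_le _ (fun _ => B)); [easy|]. apply exO_const. lra. Qed.

Lemma inv_den_le k : (1 <= k)%nat -> 0 <= / den k <= / beta.
Proof.
  intros Hk. destruct (inv_den_upper k Hk). split; [lra|].
  pose proof (INR_ge1 k Hk).
  assert (/ INR k <= 1) by (rewrite <- Rinv_1; apply Rinv_le_contravar; lra).
  assert (0 < / beta) by now apply Rinv_0_lt_compat. nra.
Qed.

Lemma reset_zero hs : hist hs -> (nv hs mod m = 0)%nat -> (1 < nv hs)%nat -> nbr_cur hs = 0 /\ path_cur hs = 0.
Proof.
  intros Hh E Hn. destruct Hh as [|hs v Hh Hv]; [unfold nv in Hn; simpl in Hn; lia|].
  destruct (state_step hs v Hh Hv) as [[E' _]|[_ [_ [_ [-> [-> _]]]]]]; [lia|easy].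
Qed.

Definition nbr_cur_dev hs : R := nbr_cur hs - u_lim * INR (nv hs mod m).

(** Each vertex of the open block adds [u_lim] in mean, up to [sq_dev / den] and O(1/k); the reset
    at each closing keeps this error at order [k^(-gap)]. *)
Lemma nbr_cur_dev_exO : exO nbr_cur_dev (- gap).
Proof.
  destruct gap_range as [Hd1 [Hd2 Hd3]]. assert (0 < / beta) by now apply Rinv_0_lt_compat.
  apply (exO_reset_eq _ (fun hs => (sq_dev hs + (sq_err hs + u_lim * INR (nv hs mod m))) / den (nv hs))
    (fun k => / den k) (/ beta)); [lra|apply inv_den_le| | |].
  - intros hs Hh E Hn. unfold nbr_cur_dev. destruct (reset_zero hs Hh E Hn) as [-> _]. rewrite E. simpl. ring.
  - intros hs Hh Hr. exists (fun x => (nbr_cur hs - u_lim * INR (nv hs mod m) - u_lim) + d_nbr_cur hs x). split.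
    + intros v Hv. unfold nbr_cur_dev.
      destruct (state_step hs v Hh Hv) as [[E [_ [_ [-> _]]]]|[_ [E _]]]; [|lia].
      rewrite (INR_S_mod hs v E). ring.
    + rewrite tgt_plus, tgt_const, tgt_d_nbr_cur by easy. pose proof (den_pos (nv hs) (nv_pos hs)) as Hd.
      replace ((nbr_cur hs + sq_wt hs + den (nv hs) - wt_cur hs) / den (nv hs))
        with (nbr_cur hs / den (nv hs) + (sq_wt hs + den (nv hs) - wt_cur hs) / den (nv hs)) by (field; lra).
      rewrite sq_mean. unfold nbr_cur_dev. field. lra.
  - apply (exO_div_den _ (1 - gap)); [lra|]. apply exO_plus; [apply sq_dev_exO|].
    apply (exO_weaken _ 0); [lra|]. apply exO_plus; [apply (exO_bounded _ _ sq_err_bound)|].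
    apply exO_scal, (exO_bounded _ (INR m)). intros hs _. pose proof (INR_mod_le (nv hs)).
    pose proof (pos_INR (nv hs mod m)). rewrite Rabs_right; lra.
Qed.

Lemma r_exO : exO (fun hs => INR (nv hs mod m)) 0.
Proof.
  apply (exO_bounded _ (INR m)). intros hs _. pose proof (INR_mod_le (nv hs)).
  pose proof (pos_INR (nv hs mod m)). rewrite Rabs_right; lra.
Qed.

Lemma nbr_cur_exO : exO nbr_cur 0.
Proof.
  destruct gap_range as [Hd1 [Hd2 Hd3]].
  apply (exO_ext _ (fun hs => nbr_cur_dev hs + u_lim * INR (nv hs mod m))); [intros; unfold nbr_cur_dev; ring|].
  apply exO_plus; [apply (exO_weaken _ (- gap)); [lra|apply nbr_cur_dev_exO]|]. apply exO_scal, r_exO.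
Qed.

(** The solution of [w = 2 * w / (2 + beta) + 2 * (1 + beta) * u_lim * m]: a closing block has
    weight about [(1 + beta) * m] and neighbour weight about [u_lim * m], spread over [m]
    vertices. *)
Definition w_lim : R := 2 * (2 + beta) * (1 + beta) * u_lim * INR m / beta.

(** Built like [sq_dev]: the second term is what the open block would contribute if it closed now,
    the third removes the dependence on the position in the block. *)
Definition edge_wt_dev hs : R :=
  edge_wt hs + 2 * wt_cur hs * nbr_cur hs + 2 * (1 + beta) * u_lim * per (nv hs) - w_lim * INR (nv hs).

(** A loop adds no neighbour; this removes the only random part of the mixed increment of
    [wt_cur * nbr_cur] and keeps the mean step linear. *)
Lemma d_nbr_cur_atcur hs x : atcur hs x * d_nbr_cur hs x = 0.
Proof.
  unfold atcur, d_nbr_cur, past. destruct (Nat.eqb_spec x (open_blk hs)) as [->|].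
  - rewrite Nat.ltb_irrefl. ring.
  - simpl. ring.
Qed.

Lemma per_exO : exO (fun hs => per (nv hs)) 0.
Proof.
  apply (exO_bounded _ (INR m ^ 2)). intros hs _. pose proof (per_bound (nv hs)). rewrite Rabs_right; lra.
Qed.

Lemma wt_cur_mult_exO f t : (forall hs, 0 <= f hs) -> exO f t -> exO (fun hs => wt_cur hs * f hs) t.
Proof.
  intros Hf H. apply (exO_le _ (fun hs => wmax * f hs)); [|now apply exO_scal].
  intros hs Hh. pose proof (wt_cur_bounds hs Hh). pose proof (Hf hs).
  assert (wt_cur hs <= wmax) by (unfold wmax; lra). nra.
Qed.

Lemma edge_wt_dev_exO : exO edge_wt_dev (1 - gap).
Proof.
  destruct gap_range as [Hd1 [Hd2 Hd3]]. pose proof drift_range as Ha. destruct inv_den_rate as [k0 Hk0].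
  apply (exO_growth_eq _ (fun hs => 2 * (1 + beta) * nbr_cur_dev hs + (2 * u_lim * loops hs
      + 2 * ((wt_cur hs + (1 + beta)) * (sq_dev hs + sq_err hs) + 4 / 2 * w_lim / (2 + beta)
             + (1 + beta) * nbr_cur hs + - (2 * (1 + beta) * u_lim) * per (nv hs)) / den (nv hs)))
    (fun k => 2 * / den k) drift (1 - gap) k0); try lra.
  - intros k Hk. destruct (inv_den_upper k Hk). lra.
  - intros k Hk Hk1. specialize (Hk0 k Hk Hk1). unfold Rdiv in *. lra.
  - intros hs Hh.
    exists (fun x => (edge_wt hs + 2 * wt_cur hs * nbr_cur hs
        + 2 * (1 + beta) * u_lim * (per (nv hs) + (INR m - 2 * INR (nv hs mod m) - 1))
        - w_lim * (INR (nv hs) + 1)) + (d_edge_wt hs x + (2 * (wt_cur hs + (1 + beta)) * d_nbr_cur hs x + 2 * nbr_cur hs * d_wt_cur hs x))).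
    split.
    + intros v Hv. pose proof (d_nbr_cur_atcur hs (blk m v)) as H0. unfold edge_wt_dev. rewrite nv_snoc, per_S, S_INR.
      transitivity (edge_wt hs + d_edge_wt hs (blk m v) + 2 * (wt_cur hs + d_wt_cur hs (blk m v)) * (nbr_cur hs + d_nbr_cur hs (blk m v))
        + 2 * (1 + beta) * u_lim * (per (nv hs) + (INR m - 2 * INR (nv hs mod m) - 1))
        - w_lim * (INR (nv hs) + 1)).
      * destruct (state_step hs v Hh Hv) as [[_ [_ [-> [-> [_ [_ [_ ->]]]]]]]|[_ [_ [-> [-> [_ [_ [_ ->]]]]]]]]; ring.
      * unfold d_wt_cur.
        replace (2 * (wt_cur hs + (1 + beta + atcur hs (blk m v))) * (nbr_cur hs + d_nbr_cur hs (blk m v)))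
          with (2 * (wt_cur hs + (1 + beta + atcur hs (blk m v))) * nbr_cur hs
            + 2 * (wt_cur hs + (1 + beta)) * d_nbr_cur hs (blk m v) + 2 * (atcur hs (blk m v) * d_nbr_cur hs (blk m v))) by ring.
        rewrite H0. ring.
    + rewrite !tgt_plus, !tgt_scal, tgt_const, tgt_d_edge_wt, tgt_d_nbr_cur, tgt_d_wt_cur by easy.
      pose proof (den_pos (nv hs) (nv_pos hs)) as Hd.
      replace ((nbr_cur hs + sq_wt hs + den (nv hs) - wt_cur hs) / den (nv hs))
        with (nbr_cur hs / den (nv hs) + (sq_wt hs + den (nv hs) - wt_cur hs) / den (nv hs)) by (field; lra).
      rewrite sq_mean. unfold edge_wt_dev, nbr_cur_dev, loops.
      replace (INR (nv hs)) with ((den (nv hs) + 2) / (2 + beta)) by (unfold den; field; lra).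
      unfold w_lim. field. lra.
  - replace (1 - gap - 1) with (- gap) by ring. apply exO_plus; [apply exO_scal, nbr_cur_dev_exO|].
    apply exO_plus; [apply exO_scal, exO_abs, loops_abs_exO|].
    apply (exO_div_den _ (1 - gap)); [lra|]. apply exO_scal.
    apply exO_plus; [apply exO_plus; [apply exO_plus|]|].
    (* Here [sq_dev] is multiplied by the random [wt_cur], so its mean does not suffice; its
       absolute mean, from the second moment, does. *)
    + apply (exO_abs_le _ (fun hs => wmax * (Rabs (sq_dev hs) + (wmax ^ 2 + (1 + beta) ^ 2 * INR m ^ 2 + 2 * q_lim + wmax)))).
      * intros hs Hh. rewrite Rabs_mult. pose proof (wt_cur_bounds hs Hh).
        pose proof (sq_err_bound hs Hh). apply Rmult_le_compat; try apply Rabs_pos.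
        -- rewrite Rabs_right by lra. unfold wmax. lra.
        -- eapply Rle_trans; [apply Rabs_triang|]. lra.
      * apply exO_scal, exO_plus; [apply sq_dev_abs_exO|apply exO_const; lra].
    + apply exO_const; lra.
    + apply exO_scal, (exO_weaken _ 0); [lra|apply nbr_cur_exO].
    + apply exO_scal, (exO_weaken _ 0); [lra|apply per_exO].
Qed.

Definition path_cur_dev hs : R := path_cur hs - w_lim / (2 + beta) * INR (nv hs mod m).

Lemma path_cur_dev_exO : exO path_cur_dev (- gap).
Proof.
  destruct gap_range as [Hd1 [Hd2 Hd3]]. assert (0 < / beta) by now apply Rinv_0_lt_compat.
  apply (exO_reset_eq _ (fun hs => (edge_wt_dev hs + (2 * w_lim / (2 + beta) + (w_lim / (2 + beta) * INR (nv hs mod m)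
      + (-2 * (wt_cur hs * nbr_cur hs) + - (2 * (1 + beta) * u_lim) * per (nv hs))))) / den (nv hs))
    (fun k => / den k) (/ beta)); [lra|apply inv_den_le| | |].
  - intros hs Hh E Hn. unfold path_cur_dev. destruct (reset_zero hs Hh E Hn) as [_ ->]. rewrite E. simpl. ring.
  - intros hs Hh Hr. exists (fun x => (path_cur hs - w_lim / (2 + beta) * (INR (nv hs mod m) + 1)) + d_path_cur hs x). split.
    + intros v Hv. unfold path_cur_dev.
      destruct (state_step hs v Hh Hv) as [[E [_ [_ [_ [-> _]]]]]|[_ [E _]]]; [|lia].
      rewrite (INR_S_mod hs v E). ring.
    + rewrite tgt_plus, tgt_const, tgt_d_path_cur by easy. pose proof (den_pos (nv hs) (nv_pos hs)) as Hd.
      unfold path_cur_dev, edge_wt_dev.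
      replace (INR (nv hs)) with ((den (nv hs) + 2) / (2 + beta)) by (unfold den; field; lra).
      field. lra.
  - apply (exO_div_den _ (1 - gap)); [lra|]. apply exO_plus; [apply edge_wt_dev_exO|].
    apply (exO_weaken _ 0); [lra|]. repeat apply exO_plus; try apply exO_scal.
    + apply exO_const; lra.
    + apply r_exO.
    + apply wt_cur_mult_exO; [apply nbr_cur_nonneg|apply nbr_cur_exO].
    + apply per_exO.
Qed.

(** Triangles appear at mean rate [path_cur / den], about [w_lim * r / ((2 + beta)^2 * k)] with
    [r = k mod m], and [r] has average [(m - 1) / 2] over a block. *)
Definition g_lim : R := (INR m - 1) * w_lim / (2 * (2 + beta) ^ 2).

(** The term with [per] compensates the difference between [k mod m] and its average, since [per]
    steps by [m - 1 - 2 * (k mod m)]. *)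
Definition tri_dev hs : R :=
  tri_num hs - g_lim * ln (INR (nv hs)) + w_lim / (2 * (2 + beta) ^ 2) * (per (nv hs) / INR (nv hs)).

(** The mean increment is [path_cur_dev / den], of order [k^(-gap-1)], plus a deterministic [h] of
    order [k^(-2)], so it is summable. This is the use made of the power gain. *)
Lemma tri_dev_exO : exO tri_dev 0.
Proof.
  destruct gap_range as [Hd1 [Hd2 Hd3]].
  set (ka := w_lim / (2 * (2 + beta) ^ 2)).
  set (h := fun k => w_lim / (2 + beta) * INR (k mod m) / den k - g_lim * (ln (INR (S k)) - ln (INR k))
    + ka * (per (S k) / INR (S k) - per k / INR k)).
  set (e := fun hs => path_cur_dev hs / den (nv hs) + h (nv hs)).
  apply (bigO_convergent _ gap 0%nat (fun k => Ex k e)); [easy| |].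
  - intros k _ Hk.
    rewrite (Ex_step_eq k tri_dev (fun hs => tri_dev hs + e hs) Hk), Ex_plus; [ring|].
    intros hs Hh <-. exists (fun x => (tri_num hs - g_lim * ln (INR (S (nv hs)))
       + ka * (per (S (nv hs)) / INR (S (nv hs)))) + d_tri hs x). split.
    + intros v Hv. unfold tri_dev. rewrite nv_snoc, tri_num_step by easy. fold ka. ring.
    + rewrite tgt_plus, tgt_const, tgt_d_tri by easy. unfold tri_dev, e, h, path_cur_dev. fold ka. unfold Rdiv. ring.
  - apply exO_plus; [apply (exO_div_den _ (- gap)); [ring|apply path_cur_dev_exO]|].
    apply (exO_fun h). apply (bigO_weaken _ (-2)); [lra|].
    set (B := Rabs (w_lim / (2 + beta)) * INR m * (2 / (beta * (2 + beta))) + Rabs g_lim + Rabs ka * INR m ^ 2).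
    apply (bigO_le _ (fun k => B * (/ INR k * / INR k))).
    2:{ apply bigO_scal, (bigO_mult _ _ (-1) (-1)); [lra|apply bigO_inv|apply bigO_inv]. }
    intros k Hk. pose proof (INR_ge1 k Hk) as Hk1. pose proof (den_pos k Hk) as HD.
    destruct (inv_den_upper k Hk) as [Hi1 Hi2].
    assert (Hik : 0 < / INR k) by (apply Rinv_0_lt_compat; lra).
    set (L := / INR k - (ln (INR (S k)) - ln (INR k))).
    assert (HL : 0 <= L <= / INR k * / INR k).
    { pose proof (ln_ratio_lower k Hk). pose proof (ln_ratio_upper k Hk). rewrite S_INR in *.
      assert (/ INR k - / (INR k + 1) <= / INR k * / INR k).
      { replace (/ INR k - / (INR k + 1)) with (/ INR k * / (INR k + 1)) by (field; lra).
        apply Rmult_le_compat_l; [lra|]. apply Rinv_le_contravar; lra. }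
      unfold L. rewrite S_INR. lra. }
    (* The order [1 / k] cancels. What is left comes from replacing [den k] by [(2 + beta) * k], the
       logarithmic step by [1 / k], and [1 / (k + 1)] by [1 / k]. *)
    assert (E : h k = w_lim / (2 + beta) * INR (k mod m) * (2 / (2 + beta) * (/ den k * / INR k))
       + g_lim * L + (- ka) * (per (S k) * (/ INR k * / INR (S k)))).
    { unfold h, L, g_lim, ka. rewrite per_S, S_INR.
      assert (Ed : (2 + beta) * INR k - 2 <> 0) by (unfold den in HD; lra).
      unfold den. field. lra. }
    rewrite E. eapply Rle_trans; [apply Rabs_triang|]. eapply Rle_trans; [apply Rplus_le_compat_r, Rabs_triang|].
    unfold B. rewrite !Rmult_plus_distr_r. rewrite !Rabs_mult, Rabs_Ropp.
    apply Rplus_le_compat; [apply Rplus_le_compat|].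
    + rewrite (Rabs_right (INR (k mod m))) by (apply Rle_ge, pos_INR).
      pose proof (INR_mod_le k). pose proof (pos_INR (k mod m)).
      rewrite (Rabs_right (/ den k)), (Rabs_right (/ INR k)) by lra.
      assert (0 < 2 / (2 + beta)) by (apply Rdiv_lt_0_compat; lra).
      rewrite (Rabs_right (2 / (2 + beta))) by lra.
      pose proof (Rabs_pos (w_lim / (2 + beta))).
      replace (Rabs (w_lim / (2 + beta)) * INR m * (2 / (beta * (2 + beta))) * (/ INR k * / INR k))
        with (Rabs (w_lim / (2 + beta)) * INR m * (2 / (2 + beta) * (/ beta * / INR k * / INR k)))
        by (field; lra).
      apply Rmult_le_compat; [nra| |nra|].
      * apply Rmult_le_pos; [lra|]. nra.
      * apply Rmult_le_compat_l; [lra|]. nra.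
    + apply Rmult_le_compat_l; [apply Rabs_pos|]. rewrite Rabs_right; lra.
    + rewrite Rmult_assoc. apply Rmult_le_compat_l; [apply Rabs_pos|].
      pose proof (per_bound (S k)). rewrite S_INR.
      assert (0 < / (INR k + 1) <= / INR k).
      { split; [apply Rinv_0_lt_compat; lra|apply Rinv_le_contravar; lra]. }
      rewrite (Rabs_right (per (S k))), (Rabs_right (/ INR k)), (Rabs_right (/ (INR k + 1))) by lra.
      apply Rmult_le_compat; nra.
Qed.

(** * Second moment of the number of triangles *)

Lemma edge_wt_exO : exO edge_wt 1.
Proof.
  destruct gap_range as [Hd1 [Hd2 Hd3]].
  apply (exO_ext _ (fun hs => edge_wt_dev hs + (-2 * (wt_cur hs * nbr_cur hs)
     + (- (2 * (1 + beta) * u_lim) * per (nv hs) + w_lim * INR (nv hs))))).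
  { intros; unfold edge_wt_dev; ring. }
  apply exO_plus; [apply (exO_weaken _ (1 - gap)); [lra|apply edge_wt_dev_exO]|].
  apply exO_plus; [|apply exO_plus]; try apply exO_scal.
  - apply (exO_weaken _ 0); [lra|]. apply wt_cur_mult_exO; [apply nbr_cur_nonneg|apply nbr_cur_exO].
  - apply (exO_weaken _ 0); [lra|apply per_exO].
  - apply (exO_fun (fun k => INR k)), bigO_id.
Qed.

Lemma path_cur_exO : exO path_cur 0.
Proof.
  destruct gap_range as [Hd1 [Hd2 Hd3]].
  apply (exO_ext _ (fun hs => path_cur_dev hs + w_lim / (2 + beta) * INR (nv hs mod m)));
    [intros; unfold path_cur_dev; ring|].
  apply exO_plus; [apply (exO_weaken _ (- gap)); [lra|apply path_cur_dev_exO]|]. apply exO_scal, r_exO.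
Qed.

(** The moments below end at order [4 * eta = 2 * gap] for the squared number of triangles. Of the
    constants, [cN] bounds the factor of the neighbour weight that moves into [edge_wt] at a
    closing, [cQ] pays for the source [cN * sq_wt / den] out of the slack [1 - drift], and [cK] pays
    for all additive constants out of the slack [eta]. *)
Definition eta : R := gap / 2.
Definition cN : R := 2 * wmax.
Definition cQ : R := cN / (1 - drift).
Definition cK : R := (cN + cQ + cQ * wmax ^ 2) / eta + 1.

(* [envelope] dominates the conditional rate of triangle creation and grows at rate at most
   [(1 + eta) / k], which is what keeps the second moment of [tri_num] of order [k^(2 * gap)]. *)
Definition envelope hs : R := edge_wt hs + cN * nbr_cur hs + cQ * sq_wt hs + cK * INR (nv hs).
Definition d_envelope hs x : R := d_edge_wt hs x + cN * d_nbr_cur hs x + cQ * d_sq_wt hs x + (cQ * wmax ^ 2 + cK).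
(** Size of a single step relative to [k]: one vertex multiplies [envelope] by at most [1 + cU]. *)
Definition cU : R :=
  2 * INR m * (2 + beta) + cN * (INR m + (2 + beta) + 1) + cQ * (2 * (2 + beta) + 1) + (cQ * wmax ^ 2 + cK).

Lemma consts_pos : 0 < eta /\ 0 < cN /\ 0 < cQ /\ 1 <= cK /\ 0 < cU.
Proof.
  destruct gap_range as [Hd1 _]. pose proof drift_range. pose proof wmax_pos. pose proof (pos_INR m).
  assert (P1 : 0 < eta) by (unfold eta; lra).
  assert (P2 : 0 < cN) by (unfold cN; lra).
  assert (P3 : 0 < cQ) by (unfold cQ; apply Rdiv_lt_0_compat; lra).
  assert (P5 : 0 < cQ * wmax ^ 2) by (apply Rmult_lt_0_compat; [easy|nra]).
  assert (P4 : 1 <= cK).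
  { unfold cK. assert (0 < (cN + cQ + cQ * wmax ^ 2) / eta) by (apply Rdiv_lt_0_compat; lra). lra. }
  repeat split; try easy. unfold cU.
  assert (0 <= 2 * INR m * (2 + beta)) by nra.
  assert (0 <= cN * (INR m + (2 + beta) + 1)) by nra.
  assert (0 <= cQ * (2 * (2 + beta) + 1)) by nra. lra.
Qed.

(** At a closing, the term [cN * nbr_cur] that is reset to zero pays for the jump of [edge_wt]. *)
Lemma envelope_step hs v : hist hs -> (1 <= v <= nv hs)%nat -> envelope (hs ++ [v]) <= envelope hs + d_envelope hs (blk m v).
Proof.
  intros Hh Hv. unfold envelope, d_envelope. rewrite nv_snoc, S_INR.
  destruct consts_pos as [H1 [H2 [H3 [H4 H5]]]]. pose proof (wt_cur_next_bounds hs (blk m v) Hh) as [Hw1 Hw2].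
  pose proof (nbr_cur_nonneg hs). pose proof (d_nbr_cur_bounds hs (blk m v) Hh) as [Hn _].
  pose proof (pow_incr _ _ 2 (conj Hw1 Hw2)) as Hsq. pose proof (pow_le _ 2 Hw1).
  destruct (state_step hs v Hh Hv) as [[_ [_ [_ [-> [_ [-> [_ ->]]]]]]]|[_ [_ [_ [-> [_ [-> [_ ->]]]]]]]].
  - nra.
  - assert (2 * (wt_cur hs + d_wt_cur hs (blk m v)) * (nbr_cur hs + d_nbr_cur hs (blk m v)) <= cN * (nbr_cur hs + d_nbr_cur hs (blk m v))).
    { unfold cN. apply Rmult_le_compat_r; lra. }
    assert (cQ * (wt_cur hs + d_wt_cur hs (blk m v)) ^ 2 <= cQ * wmax ^ 2) by (apply Rmult_le_compat_l; lra).
    lra.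
Qed.

Lemma den_le k : den k <= (2 + beta) * INR k.
Proof. unfold den. lra. Qed.

Lemma d_envelope_bounds hs x : hist hs -> 0 <= d_envelope hs x <= cU * INR (nv hs).
Proof.
  intros Hh. destruct consts_pos as [H1 [H2 [H3 [H4 H5]]]]. unfold d_envelope.
  destruct (d_edge_wt_bounds hs x Hh), (d_nbr_cur_bounds hs x Hh), (d_sq_wt_bounds hs x Hh).
  pose proof (den_le (nv hs)) as HD. pose proof (INR_ge1 (nv hs) (nv_pos hs)) as Hk. pose proof (pos_INR m).
  set (k := INR (nv hs)) in *.
  assert (0 <= cQ * wmax ^ 2) by (apply Rmult_le_pos; [lra|apply pow2_ge_0]).
  split; [nra|]. unfold cU. rewrite !Rmult_plus_distr_r.
  assert (d_edge_wt hs x <= 2 * INR m * (2 + beta) * k) by nra.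
  assert (cN * d_nbr_cur hs x <= cN * (INR m + (2 + beta) + 1) * k).
  { rewrite Rmult_assoc. apply Rmult_le_compat_l; nra. }
  assert (cQ * d_sq_wt hs x <= cQ * (2 * (2 + beta) + 1) * k).
  { rewrite Rmult_assoc. apply Rmult_le_compat_l; nra. }
  nra.
Qed.

Lemma envelope_lower hs : INR (nv hs) <= envelope hs /\ edge_wt hs <= envelope hs.
Proof.
  destruct consts_pos as [H1 [H2 [H3 [H4 H5]]]]. unfold envelope.
  pose proof (edge_wt_nonneg hs). pose proof (nbr_cur_nonneg hs). pose proof (sq_wt_nonneg hs).
  pose proof (INR_ge1 (nv hs) (nv_pos hs)). split; nra.
Qed.

Lemma tgt_d_envelope : exists k0, forall hs, hist hs -> (k0 <= nv hs)%nat ->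
  tgt hs (d_envelope hs) <= (1 + eta) / INR (nv hs) * envelope hs.
Proof.
  destruct inv_den_rate as [k0 Hk0]. exists k0. intros hs Hh Hk.
  destruct consts_pos as [H1 [H2 [H3 [H4 H5]]]]. pose proof drift_range as Ha.
  unfold d_envelope. rewrite !tgt_plus, !tgt_scal, !tgt_const, tgt_d_edge_wt, tgt_d_nbr_cur, tgt_d_sq_wt by easy.
  pose proof (nv_pos hs) as Hp. pose proof (INR_ge1 (nv hs) Hp) as Hk1.
  pose proof (den_pos (nv hs) Hp) as HD. specialize (Hk0 _ Hk Hp).
  pose proof (edge_wt_nonneg hs) as HW. pose proof (nbr_cur_nonneg hs) as HN. pose proof (sq_wt_nonneg hs) as HQ.
  pose proof (wt_cur_bounds hs Hh) as [Hw _]. unfold envelope.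
  set (k := INR (nv hs)) in *. set (D := den (nv hs)) in *.
  assert (Hi : 0 < / D) by now apply Rinv_0_lt_compat.
  assert (Hik : 0 < / k) by (apply Rinv_0_lt_compat; lra).
  assert (Hwd : 0 <= wt_cur hs / D) by (unfold Rdiv; nra).
  replace (2 * edge_wt hs / D + cN * ((nbr_cur hs + sq_wt hs + D - wt_cur hs) / D) + cQ * ((2 * sq_wt hs + D - wt_cur hs) / D) + (cQ * wmax ^ 2 + cK))
    with (/ D * (2 * edge_wt hs + cN * nbr_cur hs + (cN + 2 * cQ) * sq_wt hs) - (cN + cQ) * (wt_cur hs / D)
          + (cN + cQ + cQ * wmax ^ 2 + cK)) by (field; lra).
  replace ((1 + eta) / k * (edge_wt hs + cN * nbr_cur hs + cQ * sq_wt hs + cK * k))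
    with ((1 + eta) / k * (edge_wt hs + cN * nbr_cur hs + cQ * sq_wt hs) + (1 + eta) * cK) by (field; lra).
  assert (HK : cN + cQ + cQ * wmax ^ 2 <= eta * cK).
  { unfold cK. replace (eta * ((cN + cQ + cQ * wmax ^ 2) / eta + 1))
      with (cN + cQ + cQ * wmax ^ 2 + eta) by (field; lra). lra. }
  assert (HE : drift / 2 * (cN + 2 * cQ) <= cQ).
  { assert (cN = cQ * (1 - drift)) by (unfold cQ; field; lra). rewrite H. nra. }
  assert (0 <= (cN + cQ) * (wt_cur hs / D)) by nra.
  assert (HC : 0 <= cN * nbr_cur hs) by nra.
  assert (HB : 0 <= (cN + 2 * cQ) * sq_wt hs) by nra.
  assert (Hm1 : / D * (2 * edge_wt hs + cN * nbr_cur hs + (cN + 2 * cQ) * sq_wt hs)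
     <= drift / 2 / k * (2 * edge_wt hs + cN * nbr_cur hs + (cN + 2 * cQ) * sq_wt hs)) by (apply Rmult_le_compat_r; lra).
  assert (Hm2 : drift / 2 / k * (2 * edge_wt hs + cN * nbr_cur hs + (cN + 2 * cQ) * sq_wt hs)
     <= (1 + eta) / k * (edge_wt hs + cN * nbr_cur hs + cQ * sq_wt hs)).
  { unfold Rdiv. rewrite (Rmult_comm _ (/ k)), (Rmult_comm (1 + eta) (/ k)), !(Rmult_assoc (/ k)).
    apply Rmult_le_compat_l; [lra|].
    assert (drift / 2 * (cN + 2 * cQ) * sq_wt hs <= cQ * sq_wt hs) by (apply Rmult_le_compat_r; lra).
    assert (0 <= cQ * sq_wt hs) by nra. unfold Rdiv in *. nra. }
  lra.
Qed.

Lemma envelope_nonneg hs : 0 <= envelope hs.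
Proof. destruct (envelope_lower hs). pose proof (pos_INR (nv hs)). lra. Qed.

Lemma envelope_exO : exO envelope 1.
Proof.
  unfold envelope. apply exO_plus; [apply exO_plus; [apply exO_plus; [apply edge_wt_exO|]|]|]; apply exO_scal.
  - apply (exO_weaken _ 0); [lra|apply nbr_cur_exO].
  - apply sq_wt_exO.
  - apply (exO_fun (fun k => INR k)), bigO_id.
Qed.

(** A step may be of order [k], but its square is at most [cU * k] times the step, whose mean is a
    multiple of [envelope / k]; this leaves a source linear in [envelope]. *)
Lemma envelope_sq_exO : exO (fun hs => envelope hs ^ 2) (2 + 3 * eta).
Proof.
  destruct consts_pos as [H1 [H2 [H3 [H4 H5]]]]. destruct tgt_d_envelope as [k0 Hk0].
  apply (exO_growth _ (fun hs => cU * (1 + eta) * envelope hs) (2 + 2 * eta) _ k0); try lra.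
  - intros; apply pow2_ge_0.
  - intros hs Hh Hk. exists (fun x => envelope hs ^ 2 + (2 * envelope hs + cU * INR (nv hs)) * d_envelope hs x). split.
    + intros v Hv. pose proof (envelope_step hs v Hh Hv). pose proof (d_envelope_bounds hs (blk m v) Hh).
      pose proof (envelope_nonneg hs). pose proof (envelope_nonneg (hs ++ [v])).
      assert (envelope (hs ++ [v]) ^ 2 <= (envelope hs + d_envelope hs (blk m v)) ^ 2) by (apply pow_incr; lra). nra.
    + rewrite tgt_plus, tgt_const, tgt_scal by easy. specialize (Hk0 hs Hh Hk).
      pose proof (envelope_nonneg hs). pose proof (INR_ge1 (nv hs) (nv_pos hs)).
      apply Rle_trans with (envelope hs ^ 2 + (2 * envelope hs + cU * INR (nv hs)) * ((1 + eta) / INR (nv hs) * envelope hs)).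
      * apply Rplus_le_compat_l, Rmult_le_compat_l; [nra|easy].
      * right. field. lra.
  - apply exO_scal, (exO_weaken _ 1); [lra|apply envelope_exO].
Qed.

(** [path_cur] restarts with each block, so the crude factor [1 + cU] for a step of [envelope] is
    affordable; the source is [envelope^2 / den] because [edge_wt <= envelope]. *)
Lemma path_envelope_exO : exO (fun hs => path_cur hs * envelope hs) (1 + 3 * eta).
Proof.
  destruct consts_pos as [H1 [H2 [H3 [H4 H5]]]]. assert (Hb : 0 < / beta) by now apply Rinv_0_lt_compat.
  apply (exO_reset _ (fun hs => (1 + cU) * (envelope hs ^ 2 / den (nv hs))) (1 + cU + (1 + cU) * / beta)); try nra.
  - intros hs _. apply Rmult_le_pos; [apply path_cur_nonneg|apply envelope_nonneg].
  - intros hs Hh E Hn. destruct (reset_zero hs Hh E Hn) as [_ ->]. ring.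
  - intros hs Hh Hr.
    exists (fun x => (1 + cU) * (path_cur hs * envelope hs) + (1 + cU) * envelope hs * d_path_cur hs x). split.
    + intros v Hv. pose proof (envelope_step hs v Hh Hv). pose proof (d_envelope_bounds hs (blk m v) Hh).
      destruct (state_step hs v Hh Hv) as [[_ [_ [_ [_ [-> _]]]]]|[_ [E _]]]; [|lia].
      pose proof (path_cur_nonneg hs). pose proof (d_path_cur_nonneg hs (blk m v) Hh). destruct (envelope_lower hs).
      apply Rle_trans with ((path_cur hs + d_path_cur hs (blk m v)) * ((1 + cU) * envelope hs)); [|right; ring].
      apply Rmult_le_compat_l; [lra|]. nra.
    + rewrite tgt_plus, tgt_const, tgt_scal, tgt_d_path_cur by easy.
      destruct (inv_den_le (nv hs) (nv_pos hs)) as [Hi1 Hi2]. destruct (envelope_lower hs).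
      pose proof (envelope_nonneg hs). pose proof (path_cur_nonneg hs). pose proof (edge_wt_nonneg hs).
      unfold Rdiv. set (i := / den (nv hs)) in *.
      assert (envelope hs * edge_wt hs * i <= envelope hs ^ 2 * i) by (apply Rmult_le_compat_r; nra).
      assert (path_cur hs * envelope hs * i <= path_cur hs * envelope hs * / beta) by (apply Rmult_le_compat_l; nra).
      apply Rle_trans with ((1 + cU) * (path_cur hs * envelope hs + (envelope hs * edge_wt hs * i + path_cur hs * envelope hs * i))); [right; ring|].
      apply Rle_trans with ((1 + cU) * (path_cur hs * envelope hs + (envelope hs ^ 2 * i + path_cur hs * envelope hs * / beta))); [|right; ring].
      apply Rmult_le_compat_l; lra.
  - apply exO_scal, (exO_div_den _ (2 + 3 * eta)); [ring|apply envelope_sq_exO].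
Qed.

(** [tri_num] never resets, so here the step of [envelope] must enter through its mean, at rate
    [(1 + eta) / k]. The crude factor [1 + cU] is used only next to the increment of [tri_num]. *)
Lemma tri_envelope_exO : exO (fun hs => tri_num hs * envelope hs) (1 + 4 * eta).
Proof.
  destruct consts_pos as [H1 [H2 [H3 [H4 H5]]]]. destruct tgt_d_envelope as [k0 Hk0].
  apply (exO_growth _ (fun hs => (1 + cU) * (path_cur hs * envelope hs / den (nv hs))) (1 + eta) _ k0); try lra.
  - intros hs _. apply Rmult_le_pos; [apply tri_num_nonneg|apply envelope_nonneg].
  - intros hs Hh Hk. exists (fun x => tri_num hs * envelope hs + (tri_num hs * d_envelope hs x + (1 + cU) * envelope hs * d_tri hs x)). split.
    + intros v Hv. pose proof (envelope_step hs v Hh Hv). pose proof (d_envelope_bounds hs (blk m v) Hh).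
      rewrite tri_num_step by (easy || lia). pose proof (d_tri_bounds hs (blk m v) Hh). pose proof (tri_num_nonneg hs).
      destruct (envelope_lower hs).
      apply Rle_trans with ((tri_num hs + d_tri hs (blk m v)) * (envelope hs + d_envelope hs (blk m v))).
      { apply Rmult_le_compat_l; lra. }
      assert (d_tri hs (blk m v) * d_envelope hs (blk m v) <= d_tri hs (blk m v) * (cU * envelope hs)) by (apply Rmult_le_compat_l; nra).
      nra.
    + rewrite !tgt_plus, tgt_const, !tgt_scal, tgt_d_tri by easy. specialize (Hk0 hs Hh Hk).
      pose proof (tri_num_nonneg hs).
      assert (tri_num hs * tgt hs (d_envelope hs) <= tri_num hs * ((1 + eta) / INR (nv hs) * envelope hs)) by (apply Rmult_le_compat_l; lra).
      replace ((1 + eta) / INR (nv hs)) with ((1 + eta) * / INR (nv hs)) in * by easy. unfold Rdiv. nra.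
  - apply exO_scal, (exO_weaken _ (3 * eta)); [lra|]. apply (exO_div_den _ (1 + 3 * eta)); [ring|apply path_envelope_exO].
Qed.

Lemma tri_path_exO : exO (fun hs => tri_num hs * path_cur hs) (4 * eta).
Proof.
  destruct consts_pos as [H1 [H2 [H3 [H4 H5]]]]. assert (Hb : 0 < / beta) by now apply Rinv_0_lt_compat.
  apply (exO_reset _ (fun hs => tri_num hs * envelope hs / den (nv hs)
     + INR m ^ 2 * (path_cur hs + (edge_wt hs + path_cur hs) / den (nv hs))) (1 + / beta)); try lra.
  - intros hs _. apply Rmult_le_pos; [apply tri_num_nonneg|apply path_cur_nonneg].
  - intros hs Hh E Hn. destruct (reset_zero hs Hh E Hn) as [_ ->]. ring.
  - intros hs Hh Hr.
    exists (fun x => (tri_num hs * path_cur hs + INR m ^ 2 * path_cur hs) + (tri_num hs + INR m ^ 2) * d_path_cur hs x). split.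
    + intros v Hv. rewrite tri_num_step by (easy || lia). pose proof (d_tri_bounds hs (blk m v) Hh).
      destruct (state_step hs v Hh Hv) as [[_ [_ [_ [_ [-> _]]]]]|[_ [E _]]]; [|lia].
      pose proof (path_cur_nonneg hs). pose proof (d_path_cur_nonneg hs (blk m v) Hh).
      assert (d_tri hs (blk m v) * (path_cur hs + d_path_cur hs (blk m v)) <= INR m ^ 2 * (path_cur hs + d_path_cur hs (blk m v)))
        by (apply Rmult_le_compat_r; lra). lra.
    + rewrite tgt_plus, tgt_const, tgt_scal, tgt_d_path_cur by easy.
      destruct (inv_den_le (nv hs) (nv_pos hs)) as [Hi1 Hi2]. destruct (envelope_lower hs).
      pose proof (tri_num_nonneg hs). pose proof (path_cur_nonneg hs). pose proof (edge_wt_nonneg hs).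
      unfold Rdiv. set (i := / den (nv hs)) in *.
      assert (tri_num hs * edge_wt hs * i <= tri_num hs * envelope hs * i) by (apply Rmult_le_compat_r; nra).
      assert (tri_num hs * path_cur hs * i <= tri_num hs * path_cur hs * / beta) by (apply Rmult_le_compat_l; nra).
      lra.
  - apply exO_plus; [apply (exO_div_den _ (1 + 4 * eta)); [ring|apply tri_envelope_exO]|].
    apply (exO_weaken _ 0); [lra|]. apply exO_scal, exO_plus; [apply path_cur_exO|].
    apply (exO_div_den _ 1); [ring|]. apply exO_plus; [apply edge_wt_exO|].
    apply (exO_weaken _ 0); [lra|apply path_cur_exO].
Qed.

Lemma tri_sq_exO : exO (fun hs => tri_num hs ^ 2) (4 * eta).
Proof.
  destruct consts_pos as [H1 [H2 [H3 [H4 H5]]]].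
  apply (exO_growth _ (fun hs => 2 * (tri_num hs * path_cur hs / den (nv hs)) + INR m ^ 2 * (path_cur hs / den (nv hs))) 0 _ 0%nat); try lra.
  - intros; apply pow2_ge_0.
  - intros hs Hh _. exists (fun x => tri_num hs ^ 2 + (2 * tri_num hs + INR m ^ 2) * d_tri hs x). split.
    + intros v Hv. rewrite tri_num_step by (easy || lia). pose proof (d_tri_bounds hs (blk m v) Hh). nra.
    + rewrite tgt_plus, tgt_const, tgt_scal, tgt_d_tri by easy. unfold Rdiv. right. ring.
  - apply exO_plus; apply exO_scal.
    + apply (exO_div_den _ (4 * eta)); [ring|apply tri_path_exO].
    + apply (exO_weaken _ (-1)); [lra|]. apply (exO_div_den _ 0); [ring|apply path_cur_exO].
Qed.

(** * The clustering coefficient *)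

(** The weight [k^(1 - 4 * eta)] in Young's inequality balances the orders [4 * eta] and
    [2 - 2 * gap]: both parts become exactly of order 1. *)
Lemma tri_sq_dev_exO b : 0 <= b -> exO (fun hs => tri_num hs * (Rabs (sq_dev hs) + b)) 1.
Proof.
  intros Hb. destruct gap_range as [Hd1 [Hd2 Hd3]].
  apply (exO_le _ (fun hs => / 2 * (pw (nv hs) (1 - 4 * eta) * tri_num hs ^ 2 + pw (nv hs) (- (1 - 4 * eta)) * sq_dev hs ^ 2)
     + b / 2 * (tri_num hs ^ 2 + 1))).
  - intros hs Hh. pose proof (tri_num_nonneg hs) as Ht. pose proof (Rabs_pos (sq_dev hs)). split; [nra|].
    pose proof (young (tri_num hs) (Rabs (sq_dev hs)) (pw (nv hs) (1 - 4 * eta)) (pw_pos _ _)) as Y.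
    rewrite pow2_abs in Y. unfold Rdiv in Y.
    replace (/ pw (nv hs) (1 - 4 * eta)) with (pw (nv hs) (- (1 - 4 * eta))) in Y by apply Rpower_Ropp.
    pose proof (pow2_ge_0 (tri_num hs - 1)). nra.
  - apply exO_plus; apply exO_scal; apply exO_plus.
    + apply (exO_mult (fun k => pw k (1 - 4 * eta)) _ (1 - 4 * eta) (4 * eta));
        [ring|apply bigO_pw|apply tri_sq_exO].
    + apply (exO_mult (fun k => pw k (- (1 - 4 * eta))) _ (- (1 - 4 * eta)) (2 - 2 * gap));
        [unfold eta; field|apply bigO_pw|apply sq_dev_sq_exO].
    + apply (exO_weaken _ (4 * eta)); [unfold eta; lra|apply tri_sq_exO].
    + apply exO_const; lra.
Qed.

(** * Degrees at [n * m] vertices *)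

Lemma block_size n x : (1 <= x <= n)%nat ->
  lsum (seq 1 (n * m)) (fun v => b2r (Nat.eqb (blk m v) x)) = INR m.
Proof.
  assert (Hz : forall n y, (n < y)%nat -> lsum (seq 1 (n * m)) (fun v => b2r (Nat.eqb (blk m v) y)) = 0).
  { intros l y Hy. apply lsum_zero. intros v Hv. apply in_seq in Hv.
    rewrite (proj2 (Nat.eqb_neq _ _)); [easy|]. unfold blk.
    assert ((v - 1) / m < l)%nat by (apply Nat.Div0.div_lt_upper_bound; nia). lia. }
  induction n as [|n IH]; intros Hx; [lia|].
  replace (S n * m)%nat with (n * m + m)%nat by lia. rewrite seq_app, lsum_app.
  assert (Hb : forall v, In v (seq (1 + n * m) m) -> blk m v = S n).
  { intros v Hv. apply in_seq in Hv. unfold blk.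
    rewrite <- (Nat.div_unique (v - 1) m n (v - 1 - n * m)); lia. }
  destruct (Nat.eq_dec x (S n)) as [->|Hn].
  - rewrite (Hz n (S n)) by lia.
    rewrite (lsum_ext _ _ (fun _ => 1)); [rewrite lsum_const, length_seq; ring|].
    intros v Hv. rewrite Hb by easy. now rewrite Nat.eqb_refl.
  - rewrite IH by lia. rewrite (lsum_zero (seq (1 + n * m) m)); [ring|].
    intros v Hv. rewrite Hb by easy. rewrite (proj2 (Nat.eqb_neq _ _)) by lia. easy.
Qed.

Lemma degree_lsum E w :
  INR (degree E w) = lsum E (fun e => b2r (Nat.eqb (fst e) w) + b2r (Nat.eqb (snd e) w)).
Proof.
  induction E as [|[a b] E IH]; [easy|]. rewrite lsum_cons, <- IH. cbn [degree fold_right fst snd].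
  fold (degree E w). rewrite !plus_INR. destruct (Nat.eqb a w), (Nat.eqb b w); simpl; ring.
Qed.

Lemma wt_degree hs n x : nv hs = (n * m)%nat -> (1 <= x <= n)%nat ->
  wt hs x = beta * INR m + INR (degree (edges_m m hs) x).
Proof.
  intros E Hx. unfold wt. rewrite E, (block_size n x Hx), degree_lsum. easy.
Qed.

Lemma wt_zero hs : wt hs O = 0.
Proof.
  unfold wt. rewrite !lsum_zero; [ring| |].
  - intros e He. unfold edges_m in He. apply in_map_iff in He as [[i h] [<- _]]. cbn [fst snd].
    rewrite !(proj2 (Nat.eqb_neq _ _)) by (unfold blk; lia). simpl. ring.
  - intros v _. rewrite (proj2 (Nat.eqb_neq _ _)) by (unfold blk; lia). easy.
Qed.

Lemma lsum_seq_Sum n f : f O = 0 -> lsum (seq 1 n) f = Sum (S n) f.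
Proof.
  intros H0. induction n as [|n IH]; [simpl; rewrite H0; ring|].
  rewrite seq_S, lsum_app, IH. cbn [lsum fold_right Sum Nat.add]. ring.
Qed.

Lemma binom2_INR d : INR (d * (d - 1) / 2) = INR d * (INR d - 1) / 2.
Proof.
  destruct d as [|d]; [simpl; field|]. simpl (S d - 1)%nat. rewrite Nat.sub_0_r.
  assert (H : exists q, (S d * d = 2 * q)%nat).
  { induction d as [|d [q IH]]; [now exists O|]. exists (q + S d)%nat. lia. }
  destruct H as [q Hq]. rewrite Hq, (Nat.mul_comm 2 q), Nat.div_mul by lia.
  assert (E : INR (S d) * INR d = 2 * INR q) by (rewrite <- mult_INR, Hq, mult_INR; easy).
  rewrite S_INR in *. lra.
Qed.

Lemma sum_binom2_lsum n E :
  INR (sum_binom2 n E) = lsum (seq 1 n) (fun w => INR (degree E w) * (INR (degree E w) - 1) / 2).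
Proof.
  unfold sum_binom2. induction (seq 1 n) as [|w l IH]; [easy|]. rewrite lsum_cons, <- IH.
  cbn [fold_right]. cbv zeta. now rewrite plus_INR, binom2_INR.
Qed.

Section Full.

Context (n : nat) (hs : list nat).
Context (Hn : (1 <= n)%nat) (Hh : hist hs) (Ek : nv hs = (n * m)%nat).

(** With [n * m] vertices the open block is the empty block [n + 1], so sums over closed blocks run
    over the whole graph. *)
Let cur_full : open_blk hs = S n.
Proof. unfold open_blk, blk_next. rewrite Ek, Nat.div_mul by lia. easy. Qed.

Let blk_full : (blk m (nv hs) < S n)%nat.
Proof.
  rewrite Ek. unfold blk.
  assert ((n * m - 1) / m < n)%nat by (apply Nat.Div0.div_lt_upper_bound; nia). lia.
Qed.

Lemma degree_sum : lsum (seq 1 n) (fun w => INR (degree (edges_m m hs) w)) = 2 * INR (n * m) - 2.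
Proof.
  pose proof (wt_total hs (S n) Hh blk_full) as H. rewrite <- lsum_seq_Sum in H by apply wt_zero.
  rewrite (lsum_ext _ _ (fun w => beta * INR m + INR (degree (edges_m m hs) w))) in H.
  2:{ intros w Hw. apply in_seq in Hw. apply (wt_degree hs n); [easy|lia]. }
  rewrite lsum_plus, lsum_const, length_seq in H. unfold den in H. rewrite Ek, mult_INR in *. lra.
Qed.

Lemma degree_sq_sum :
  lsum (seq 1 n) (fun w => INR (degree (edges_m m hs) w) ^ 2)
  = sq_dev hs + q_lim * INR (n * m) - 2 * beta * INR m * (2 * INR (n * m) - 2) - beta ^ 2 * INR m ^ 2 * INR n.
Proof.
  assert (EX : sq_wt hs = sq_dev hs + q_lim * INR (n * m)).
  { unfold sq_dev. assert (Hw : wt_cur hs = 0) by (apply wt_fresh; [easy|rewrite cur_full; lia]).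
    unfold per. rewrite Hw, Ek, Nat.Div0.mod_mul. simpl. ring. }
  rewrite <- EX. unfold sq_wt, pow_sum. rewrite cur_full, <- lsum_seq_Sum by (rewrite wt_zero; ring).
  rewrite (lsum_ext (seq 1 n) (fun x => wt hs x ^ 2) (fun w => INR (degree (edges_m m hs) w) ^ 2
     + (2 * beta * INR m * INR (degree (edges_m m hs) w) + beta ^ 2 * INR m ^ 2))).
  2:{ intros w Hw. apply in_seq in Hw. rewrite (wt_degree hs n) by (easy || lia). ring. }
  rewrite !lsum_plus, lsum_scal, lsum_const, length_seq, degree_sum. ring.
Qed.

(** [const_c2] is [q_lim * m / 2] corrected for the shift [beta * m] between weight and degree and
    for the linear part of the binomial. *)
Lemma sum_binom2_sq_dev :
  INR (sum_binom2 n (edges_m m hs)) = const_c2 beta m * INR n + (sq_dev hs / 2 + 2 * beta * INR m + 1).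
Proof.
  rewrite sum_binom2_lsum.
  rewrite (lsum_ext _ _ (fun w => / 2 * INR (degree (edges_m m hs) w) ^ 2
     + (- / 2) * INR (degree (edges_m m hs) w))) by (intros; field).
  rewrite lsum_plus, !lsum_scal, degree_sq_sum, degree_sum, mult_INR.
  unfold const_c2, q_lim. field. lra.
Qed.

(** From [d (d - 1) / 2 >= d - 1] and the degree sum [2 n m - 2]. Being deterministic, the bound
    makes division by the random denominator safe without a tail estimate. *)
Lemma sum_binom2_lower : INR n - 2 <= INR (sum_binom2 n (edges_m m hs)).
Proof.
  rewrite sum_binom2_lsum.
  apply Rle_trans with (lsum (seq 1 n) (fun w => INR (degree (edges_m m hs) w) + -1)).
  - rewrite lsum_plus, lsum_const, length_seq, degree_sum, mult_INR.
    pose proof (INR_ge1 n Hn). pose proof (INR_ge1 m Hm). nra.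
  - apply lsum_le. intros w _. set (d := degree (edges_m m hs) w).
    destruct d as [|[|d]]; [simpl; lra|simpl; lra|]. rewrite !S_INR. pose proof (pos_INR d). nra.
Qed.

End Full.

Lemma c2_pos : 0 < const_c2 beta m.
Proof.
  unfold const_c2. pose proof (INR_ge1 m Hm).
  replace ((2 + 5 * beta) / (2 * beta) * INR m ^ 2 + (2 - beta) / (2 * beta) * INR m)
    with ((2 * INR m ^ 2 + 2 * INR m + beta * (5 * INR m ^ 2 - INR m)) / (2 * beta)) by (field; lra).
  apply Rdiv_lt_0_compat; [|lra].
  assert (0 <= beta * (5 * INR m ^ 2 - INR m)) by (apply Rmult_le_pos; nra). nra.
Qed.

Lemma c1_g_lim : const_c1 beta m = g_lim.
Proof. unfold const_c1, g_lim, w_lim, u_lim, q_lim. field. lra. Qed.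

Lemma expected_clustering_Ex n :
  expected_clustering beta m n = Ex (n * m) (fun hs => clustering n (edges_m m hs)).
Proof.
  unfold expected_clustering, Ex. induction (outcomes beta (n * m)) as [|[p hs] l IH]; [easy|].
  rewrite lsum_cons, <- IH. easy.
Qed.

(** The difference of [1 / S] and [1 / (c n)] is [(c n - S) / (S c n)], and [S >= n - 2 >= n / 2]
    for [n >= 4], which doubles the constant 3. *)
Lemma clustering_approx n hs : (4 <= n)%nat -> hist hs -> nv hs = (n * m)%nat ->
  Rabs (clustering n (edges_m m hs) - 3 / (const_c2 beta m * INR n) * tri_num hs)
  <= 6 / (const_c2 beta m * INR n ^ 2) * (tri_num hs * (Rabs (sq_dev hs) + (2 * beta * INR m + 1))).
Proof.
  intros Hn Hh Ek. pose proof c2_pos as Hc. set (c := const_c2 beta m) in *.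
  assert (H4 : 4 <= INR n) by (apply (le_INR 4) in Hn; simpl in Hn; lra).
  pose proof (sum_binom2_sq_dev n hs ltac:(lia) Hh Ek) as HS. fold c in HS.
  pose proof (sum_binom2_lower n hs ltac:(lia) Hh Ek) as HL.
  pose proof (tri_num_nonneg hs) as Ht. pose proof (pos_INR m).
  unfold clustering. set (s := sum_binom2 n (edges_m m hs)) in *.
  (* The default value 0 of [clustering] does not occur, as [S >= n - 2 > 0]. *)
  destruct (Nat.eqb_spec s 0) as [E|_]; [rewrite E in HL; simpl in HL; lra|].
  fold (tri_num hs). set (S := INR s) in *.
  replace (3 * tri_num hs / S - 3 / (c * INR n) * tri_num hs)
    with (tri_num hs * (- (sq_dev hs / 2 + 2 * beta * INR m + 1) * (3 / (S * (c * INR n)))))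
    by (replace (sq_dev hs / 2 + 2 * beta * INR m + 1) with (S - c * INR n) by lra; field; lra).
  rewrite !Rabs_mult, Rabs_Ropp, (Rabs_right (tri_num hs)) by lra.
  assert (HcS : 0 < S * (c * INR n)) by (apply Rmult_lt_0_compat; [lra|nra]).
  rewrite (Rabs_right (3 / (S * (c * INR n)))) by (left; apply Rdiv_lt_0_compat; lra).
  replace (6 / (c * INR n ^ 2) * (tri_num hs * (Rabs (sq_dev hs) + (2 * beta * INR m + 1))))
    with (tri_num hs * ((Rabs (sq_dev hs) + (2 * beta * INR m + 1)) * (3 / (INR n / 2 * (c * INR n))))) by (field; nra).
  apply Rmult_le_compat_l; [easy|]. apply Rmult_le_compat; [apply Rabs_pos| | |].
  - left. apply Rdiv_lt_0_compat; lra.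
  - rewrite Rplus_assoc. eapply Rle_trans; [apply Rabs_triang|].
    unfold Rdiv. rewrite Rabs_mult, (Rabs_right (/ 2)) by lra. pose proof (Rabs_pos (sq_dev hs)).
    rewrite (Rabs_right (2 * beta * INR m + 1)) by nra. lra.
  - apply Rmult_le_compat_l; [lra|]. apply Rinv_le_contravar; [|apply Rmult_le_compat_r; nra].
    apply Rmult_lt_0_compat; nra.
Qed.

Lemma expected_clustering_asymptotics :
  exists K : R, exists N0 : nat, forall n : nat, (N0 <= n)%nat ->
    Rabs (expected_clustering beta m n
          - 3 * const_c1 beta m * ln (INR n) / (const_c2 beta m * INR n)) <= K / INR n.
Proof.
  pose proof c2_pos as Hc. rewrite c1_g_lim. set (c := const_c2 beta m) in *.
  set (b := 2 * beta * INR m + 1).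
  assert (Hb : 0 <= b) by (unfold b; pose proof (pos_INR m); nra).
  destruct (tri_sq_dev_exO b Hb) as [K1 HK1]. destruct tri_dev_exO as [K2 HK2].
  exists (6 / c * (K1 * INR m) + 3 / c * (K2 + Rabs (g_lim * ln (INR m)))), 4%nat. intros n Hn.
  assert (H4 : 4 <= INR n) by (apply (le_INR 4) in Hn; simpl in Hn; lra).
  pose proof (INR_ge1 m Hm) as Hm1.
  assert (Hk : (1 <= n * m)%nat) by nia. specialize (HK1 _ Hk). specialize (HK2 _ Hk). cbv beta in HK1, HK2.
  rewrite pw_1, mult_INR in HK1 by easy. rewrite pw_0, Rmult_1_r in HK2 by easy.
  rewrite expected_clustering_Ex.
  (* At [k = n * m] the periodic term vanishes and [ln k] splits; the part with [ln m] joins the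
     O(1/n) error. *)
  assert (ET : Ex (n * m) tri_dev = Ex (n * m) tri_num - g_lim * (ln (INR n) + ln (INR m))).
  { rewrite <- ln_mult, <- mult_INR by lra. unfold Rminus. rewrite <- (Ex_const (n * m) (- (g_lim * _)) Hk), <- Ex_plus.
    apply Ex_ext; [easy|]. intros hs Hh E. unfold tri_dev, per. rewrite E, Nat.Div0.mod_mul. simpl (INR 0).
    unfold Rdiv. ring. }
  assert (EC : Rabs (Ex (n * m) (fun hs => clustering n (edges_m m hs)) - 3 / (c * INR n) * Ex (n * m) tri_num)
     <= 6 / (c * INR n ^ 2) * (K1 * (INR n * INR m))).
  { rewrite <- Ex_scal. replace (Ex (n * m) (fun hs => clustering n (edges_m m hs)) - Ex (n * m) (fun hs => 3 / (c * INR n) * tri_num hs))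
      with (Ex (n * m) (fun hs => clustering n (edges_m m hs) + -1 * (3 / (c * INR n) * tri_num hs)))
      by (rewrite Ex_plus, Ex_scal; ring).
    eapply Rle_trans; [apply Ex_abs; easy|].
    eapply Rle_trans.
    - apply (Ex_le _ _ (fun hs => 6 / (c * INR n ^ 2) * (tri_num hs * (Rabs (sq_dev hs) + b)))); [easy|].
      intros hs Hh E. replace (clustering n (edges_m m hs) + -1 * (3 / (c * INR n) * tri_num hs))
        with (clustering n (edges_m m hs) - 3 / (c * INR n) * tri_num hs) by ring.
      now apply clustering_approx.
    - rewrite Ex_scal. apply Rmult_le_compat_l.
      + left. apply Rdiv_lt_0_compat; [lra|]. apply Rmult_lt_0_compat; nra.
      + eapply Rle_trans; [apply Rle_abs|exact HK1]. }
  set (EX := Ex (n * m) (fun hs => clustering n (edges_m m hs))) in *.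
  replace (EX - 3 * g_lim * ln (INR n) / (c * INR n))
    with ((EX - 3 / (c * INR n) * Ex (n * m) tri_num)
          + 3 / (c * INR n) * (Ex (n * m) tri_dev + g_lim * ln (INR m)))
    by (rewrite ET; field; lra).
  eapply Rle_trans; [apply Rabs_triang|].
  replace ((6 / c * (K1 * INR m) + 3 / c * (K2 + Rabs (g_lim * ln (INR m)))) / INR n)
    with (6 / (c * INR n ^ 2) * (K1 * (INR n * INR m)) + 3 / (c * INR n) * (K2 + Rabs (g_lim * ln (INR m))))
    by (field; lra).
  apply Rplus_le_compat; [exact EC|].
  assert (H3 : 0 < 3 / (c * INR n)) by (apply Rdiv_lt_0_compat; nra).
  rewrite Rabs_mult, (Rabs_right (3 / (c * INR n))) by lra. apply Rmult_le_compat_l; [lra|].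
  eapply Rle_trans; [apply Rabs_triang|]. lra.
Qed.

End Model.

Theorem theorem10 (beta : R) (m : nat) (Hbeta : 0 < beta) (Hm : (1 <= m)%nat) :
  exists K : R, exists N0 : nat, forall n : nat, (N0 <= n)%nat ->
    Rabs (expected_clustering beta m n
          - 3 * const_c1 beta m * ln (INR n) / (const_c2 beta m * INR n)) <= K / INR n.
Proof. now apply expected_clustering_asymptotics. Qed.
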